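(* Let $L u = a_{ij}(x)u_{ij} + b_i(x)u_i$ be an operator on $\overline{B}_1\subset\mathbb{R}^n$ with smooth coefficients, with $A=(a_{ij})$ symmetric and $0<\lambda \le A(x)\le \Lambda$ in $B_1$. Let $u\in C^\infty(\overline{B}_1)$ be a stable solution of $-Lu=f(u)$ in $B_1$, for some function $f\in C^1(\mathbb{R})$. Assume that $$\|DA\|_{C^0(\overline{B}_1)}+\|b\|_{C^0(\overline{B}_1)}\le\varepsilon$$ for some $\varepsilon>0$. Then $$\int_{B_1}\mathcal{A}^2\eta^2\,dx\le\int_{B_1}|\nabla u|_{A(0)}^2\Big(|\nabla\eta|_{A(x)}^2+C\varepsilon|\nabla(\eta^2)|+C\varepsilon^2\eta^2\Big)dx+C\varepsilon\int_{B_1}|D^2u||\nabla u|\eta^2\,dx$$ for all $\eta\in C_c^\infty(B_1)$, where $C$ is a universal constant and $$\mathcal{A}:=\begin{cases}\Big(\mathrm{tr}\big(A(x)D^2u\,A(0)D^2u\big)-|\nabla u|_{A(0)}^{-2}\,|D^2u\,A(0)\nabla u|_{A(x)}^2\Big)^{1/2}&\text{if }\nabla u\ne0,\\0&\text{if }\nabla u=0.\end{cases}$$ Assume in addition that $f\ge0$. Then there is a universal constant $\varepsilon_0>0$ with the following property: if $\varepsilon\le\varepsilon_0$, then $$\big\|\,|\nabla u|\,D^2u\,\big\|_{L^1(B_{3/4})}\le C\|\nabla u\|_{L^2(B_1)}^2$$ and $$\big\|\,|\nabla u|\,D^2u\,\big\|_{L^1(B_{1/2}\setminus B_{1/4})}\le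 C\|\nabla u\|_{L^2(B_1\setminus B_{1/8})}^2,$$ where $C$ is a universal constant.
   Context: $B_r$ is the open ball of radius $r$ centered at $0$ in $\mathbb{R}^n$. Repeated indices are summed; $u_i=\partial_i u$, $u_{ij}=\partial_{ij}u$. The operator is $Lu=a_{ij}(x)u_{ij}+b_i(x)u_i$ with $a_{ij}=a_{ji}$, $A(x)=(a_{ij}(x))$, $b=(b_i)$, the coefficients being smooth on $\overline{B}_1$. Uniform ellipticity $\lambda\le A(x)\le\Lambda$ means $0<\lambda\le a_{ij}(x)p_ip_j\le\Lambda$ for all $x\in B_1$ and all $p\in\mathbb{R}^n$ with $|p|=1$. For a vector $p\in\mathbb{R}^n$ and a point $x$, $|p|_{A(x)}:=(a_{ij}(x)p_ip_j)^{1/2}$. A constant is called universal if it depends only on $n$, $\lambda$, and $\Lambda$. Stability: a solution $u$ of $-Lu=f(u)$ in $B_1$ is stable if there exists $\varphi\in C^2(B_1)\cap C^0(\overline{B}_1)$ with $-L\varphi\ge f'(u)\varphi$ in $B_1$, $\varphi>0$ in $B_1$, and $\varphi=0$ on $\partial B_1$. No boundary condition is imposed on $u$. *)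

(* Defs.v *)
From HB Require Import structures.
From mathcomp Require Import all_boot all_order all_algebra.
From mathcomp Require Import all_classical all_reals all_analysis.

Set Implicit Arguments.
Unset Strict Implicit.
Unset Printing Implicit Defensive.

Import Order.TTheory GRing.Theory Num.Theory.
Import numFieldNormedType.Exports.

Local Open Scope classical_set_scope.
Local Open Scope ring_scope.

(** * Lebesgue measure on ['rV[R]_n]

    ['rV[R]_n] carries the product (hence Borel) sigma-algebra, generated by
    the coordinate maps; the measure is the n-fold product of the Lebesgue
    measure of [R]. *)

Definition rV_display : measure_display -> measure_display.
Proof. exact. Qed.

Section measurable_rV.
Context {d} {T : measurableType d} (n : nat).

Let coord (i : 'I_n) (x : 'rV[T]_n) : T := x ord0 i.

Let rV_set0 : g_sigma_preimage coord set0.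
Proof. exact: sigma_algebra0. Qed.

Let rV_setC A : g_sigma_preimage coord A -> g_sigma_preimage coord (~` A).
Proof. exact: sigma_algebraC. Qed.

Let rV_bigcup (F : (set 'rV[T]_n)^nat) :
  (forall i, g_sigma_preimage coord (F i)) ->
  g_sigma_preimage coord (\bigcup_i F i).
Proof. exact: sigma_algebra_bigcup. Qed.

HB.instance Definition _ := @isMeasurable.Build (rV_display d)
  'rV[T]_n (g_sigma_preimage coord) rV_set0 rV_setC rV_bigcup.

End measurable_rV.


Lemma measurable_coord {d} {T : measurableType d} n (i : 'I_n) :
  measurable_fun [set: 'rV[T]_n] (fun x => x ord0 i).
Proof.
move=> _ Y mY; rewrite setTI; apply: sub_sigma_algebra => /=.
rewrite -bigcup_seq/=; exists i => /=; first by rewrite mem_index_enum.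
by exists Y => //; rewrite setTI.
Qed.

Lemma measurable_fun_rV {d d'} {S : measurableType d} {T : measurableType d'} n
    (f : S -> 'rV[T]_n) :
  (forall i, measurable_fun [set: S] (fun x => f x ord0 i)) ->
  measurable_fun [set: S] f.
Proof.
move=> mf.
have : measurable_fun [set: S] (fun x => [tuple f x ord0 i | i < n]).
  apply/measurable_fun_tnthP => i; apply: (eq_measurable_fun _ _ (mf i)).
  by move=> x _; rewrite /= tnth_mktuple.
move=> mt _ A mA; rewrite setTI.
have mrow : measurable_fun [set: n.-tuple T] (fun t => \row_i tnth t i : 'rV[T]_n).
  move=> _ B mB; rewrite setTI.
  move: B mB; apply: smallest_sub.
    split => [|B|F].
    - by rewrite /= preimage_set0; exact: measurable0.
    - by move=> mB; rewrite setTD preimage_setC; exact: measurableC.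
    - by move=> mF; rewrite /= preimage_bigcup; exact: bigcupT_measurable.
  move=> B; rewrite -bigcup_seq/= => -[i _ [C mC]]; rewrite setTI => <-.
  rewrite /preimage/= (_ : mkset _ = (@tnth _ T ^~ i) @^-1` C).
    by rewrite -[X in measurable X]setTI; exact: measurable_tnth.
  by apply/funext => t /=; rewrite mxE.
have := mt measurableT _ (mrow measurableT _ mA).
rewrite !setTI; congr measurable; apply/funext => x /=.
by congr (A _); apply/rowP => i; rewrite mxE tnth_mktuple.
Qed.

Section lebesgue_cons.
Context {R : realType} (n : nat).

Definition cons_rV (p : R * 'rV[R]_n) : 'rV[R]_n.+1 :=
  \row_i (if unlift ord0 i is Some j then p.2 ord0 j else p.1).

Definition uncons_rV (x : 'rV[R]_n.+1) : R * 'rV[R]_n :=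
  (x ord0 ord0, \row_i x ord0 (lift ord0 i)).

Lemma cons_rVK : cancel cons_rV uncons_rV.
Proof.
move=> [r x]; rewrite /uncons_rV /cons_rV mxE unlift_none; congr pair.
by apply/rowP => i; rewrite !mxE liftK.
Qed.

Lemma uncons_rVK : cancel uncons_rV cons_rV.
Proof. by move=> x; apply/rowP => i; rewrite mxE; case: unliftP => [j|] ->; rewrite ?mxE. Qed.

Lemma measurable_uncons_rV : measurable_fun [set: 'rV[R]_n.+1] uncons_rV.
Proof.
apply/measurable_fun_pair; first exact: measurable_coord.
apply: measurable_fun_rV => i.
by apply: (eq_measurable_fun _ _ (measurable_coord (lift ord0 i))) => x _;
  rewrite mxE.
Qed.

Lemma measurable_cons_rV : measurable_fun [set: R * 'rV[R]_n] cons_rV.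
Proof.
apply: measurable_fun_rV => i.
case: (unliftP ord0 i) => [j ij|i0].
  apply: (eq_measurable_fun ((fun x : 'rV[R]_n => x ord0 j) \o snd)).
    by move=> x _; rewrite mxE ij liftK.
  by apply: measurableT_comp => //; exact: measurable_coord.
apply: (eq_measurable_fun fst) => // x _.
by rewrite mxE i0 unlift_none.
Qed.

Variable mu : {sigma_finite_measure set 'rV[R]_n -> \bar R}.

Definition lebesgue_cons : set 'rV[R]_n.+1 -> \bar R :=
  pushforward (@lebesgue_measure R \x mu)%E cons_rV.

Let pf : {measure set 'rV[R]_n.+1 -> \bar R} :=
  measure_function_pushforward__canonical__measure_function_Measure
    (@lebesgue_measure R \x mu)%E measurable_cons_rV.

HB.instance Definition _ := isMeasure.Build _ _ _ lebesgue_cons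
  (measure0 pf) (measure_ge0 pf) (@measure_semi_sigma_additive _ _ _ pf).

Let lebesgue_cons_sigma_finite : sigma_finite setT lebesgue_cons.
Proof.
have /sigma_finiteP[F [TF ndF Foo]] := sigma_finiteT (@lebesgue_measure R).
have /sigma_finiteP[G [TG ndG Goo]] := sigma_finiteT mu.
exists (fun k => uncons_rV @^-1` (F k `*` G k)).
  apply/esym; rewrite -subTset => x _.
  have [i _ Fi] : (\bigcup_k F k) (uncons_rV x).1 by rewrite -TF.
  have [j _ Gj] : (\bigcup_k G k) (uncons_rV x).2 by rewrite -TG.
  exists (maxn i j) => //; split.
    by move: Fi; exact/subsetPset/ndF/leq_maxl.
  by move: Gj; exact/subsetPset/ndG/leq_maxr.
move=> k; have [mF Fk] := Foo k; have [mG Gk] := Goo k; split.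
  rewrite -[X in measurable X]setTI; apply: measurable_uncons_rV => //.
  exact: measurableX.
rewrite /lebesgue_cons /pushforward (_ : _ @^-1` _ = F k `*` G k).
  by rewrite product_measure1E// lte_mul_pinfty// ge0_fin_numE.
by apply/seteqP; split=> p; rewrite /preimage /mkset cons_rVK.
Qed.

HB.instance Definition _ := Measure_isSigmaFinite.Build _ _ _ lebesgue_cons
  lebesgue_cons_sigma_finite.

End lebesgue_cons.

Fixpoint lebesgue_rV (R : realType) (n : nat) :
    {sigma_finite_measure set 'rV[R]_n -> \bar R} :=
  match n with
  | 0 => @dirac _ 'rV[R]_0 0 R
  | n'.+1 => lebesgue_cons (lebesgue_rV R n')
  end.

Lemma lebesgue_rV_box (R : realType) (n : nat) (A : 'I_n -> set R) :
  (forall i, measurable (A i)) ->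
  lebesgue_rV R n [set x | forall i, A i (x ord0 i)] =
  (\prod_(i < n) lebesgue_measure (A i))%E.
Proof.
elim: n A => [A _|n IH A mA].
  rewrite big_ord0 /= diracE mem_set//= => -[]//.
rewrite big_ord_recl -IH// -product_measure1E//.
  rewrite /= /lebesgue_cons /pushforward; congr ((_ \x _)%E _).
  apply/seteqP; split => -[r x] /=.
    move=> H; split; first by have := H ord0; rewrite mxE unlift_none.
    by move=> i; have := H (lift ord0 i); rewrite mxE liftK.
  by move=> [? ?] i; rewrite mxE; case: unliftP => [j|] ->.
  exact: mA.
rewrite [X in measurable X](_ : _ = \bigcap_i
    ((fun x : 'rV[R]_n => x ord0 i) @^-1` A (lift ord0 i))).
  apply: fin_bigcap_measurable => // i _.
  by rewrite -[X in measurable X]setTI; exact: measurable_coord.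
by apply/seteqP; split => x /= H i; have := H i => //; exact.
Qed.

Section euclidean.
Context {R : realType}.

(* Euclidean (Hilbert-Schmidt) norm; the library norm [`|M|] is the sup norm,
   which induces the same topology. *)
Definition enorm m n (M : 'M[R]_(m, n)) : R :=
  Num.sqrt (\sum_i \sum_j M i j ^+ 2).

(* [|p|_A] *)
Definition anorm n (A : 'M[R]_n) (p : 'cV[R]_n) : R :=
  Num.sqrt ((p^T *m A *m p) ord0 ord0).

Definition eball {n} (r : R) : set 'rV[R]_n := [set x | enorm x < r].
Definition ecball {n} (r : R) : set 'rV[R]_n := [set x | enorm x <= r].
Definition esphere {n} (r : R) : set 'rV[R]_n := [set x | enorm x = r].

End euclidean.

Section calculus.
Context {R : realType} {n : nat}.
Implicit Types (f g u eta : 'rV[R]_n -> R) (x : 'rV[R]_n) (s : seq 'I_n).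

Definition partial (i : 'I_n) f : 'rV[R]_n -> R :=
  fun x => 'D_(delta_mx ord0 i) f x.

Definition partials s f : 'rV[R]_n -> R := foldr partial f s.

Definition grad f x : 'cV[R]_n := \col_i partial i f x.

Definition hess f x : 'M[R]_n := \matrix_(i, j) partial i (partial j f) x.

(* [f \in C^k(U)], for [U] open *)
Definition Ck (k : nat) (U : set 'rV[R]_n) f : Prop :=
  (forall s i x, (size s < k)%N -> U x ->
     derivable (partials s f) x (delta_mx ord0 i)) /\
  (forall s x, (size s <= k)%N -> U x -> {for x, continuous (partials s f)}).

Definition smooth (U : set 'rV[R]_n) f : Prop := forall k, Ck k U f.

(* [f \in C^oo] of the closed unit ball: [f] is smooth in the open ball, is
   continuous on the closed ball, and each of its derivatives extends
   continuously from the open ball to the closed ball. *)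
Definition smooth_cball f : Prop :=
  [/\ smooth (eball 1) f,
      {within ecball 1, continuous f} &
      forall s, exists2 g, {within ecball 1, continuous g} &
                           forall x, eball 1 x -> g x = partials s f x].

(* The continuous extension to the closed unit ball of a function on the open
   ball; this gives a meaning on the boundary to the derivatives of an [f] with
   [smooth_cball f]. *)
Definition cball_ext f x : R := lim (f @ within (eball 1) (nbhs x)).

(* [f \in C_c^oo(U)], for [U] open; [f] is extended by zero outside [U]. *)
Definition test_function (U : set 'rV[R]_n) f : Prop :=
  [/\ smooth setT f,
      compact (closure [set x | f x != 0]) &
      closure [set x | f x != 0] `<=` U].

(* Norm in [C^0] of the closed unit ball of a function with modulus [f] *)
Definition C0norm f : \bar R := ereal_sup [set (f x)%:E | x in ecball 1].

End calculus.

Definition C1_real {R : realType} (f : R -> R) : Prop :=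
  (forall t, derivable f t 1) /\ continuous (derive1 f).

Section elliptic.
Context {R : realType} {n : nat}.
Implicit Types (a : 'rV[R]_n -> 'M[R]_n) (b : 'rV[R]_n -> 'cV[R]_n).
Implicit Types (f : R -> R) (u : 'rV[R]_n -> R) (x : 'rV[R]_n).

(* [L u = a_ij u_ij + b_i u_i] *)
Definition elliptic_op a b u x : R :=
  \sum_i \sum_j a x i j * hess u x i j + \sum_i b x i ord0 * grad u x i ord0.

(* [|DA(x)|] *)
Definition dmx_norm a x : R :=
  Num.sqrt (\sum_k \sum_i \sum_j
    cball_ext (partial k (fun y => a y i j)) x ^+ 2).

Definition stable_solution a b f u : Prop :=
  (forall x, eball 1 x -> - elliptic_op a b u x = f (u x)) /\
  exists phi : 'rV[R]_n -> R,
    [/\ Ck 2 (eball 1) phi,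
        {within ecball 1, continuous phi},
        forall x, eball 1 x -> derive1 f (u x) * phi x <= - elliptic_op a b phi x,
        forall x, eball 1 x -> 0 < phi x &
        forall x, esphere 1 x -> phi x = 0].

Record stable_setting (lam Lam eps : R) a b f u : Prop := StableSetting {
  smooth_a : forall i j, smooth_cball (fun x => a x i j);
  smooth_b : forall i, smooth_cball (fun x => b x i ord0);
  sym_a : forall x, ecball 1 x -> (a x)^T = a x;
  elliptic_a : forall x (p : 'cV[R]_n), eball 1 x -> enorm p = 1 ->
    lam <= (p^T *m a x *m p) ord0 ord0 <= Lam;
  C1_f : C1_real f;
  smooth_u : smooth_cball u;
  stable_u : stable_solution a b f u;
  eps_gt0 : 0 < eps;
  coef_bound :
    (C0norm (dmx_norm a) + C0norm (fun x => enorm (b x)) <= eps%:E)%E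
}.

(* The quantity under the square root is nonnegative when [a x] and [a 0] are
   symmetric positive definite ([Num.sqrt] is zero on negative numbers). *)
Definition curlyA a u x : R :=
  if grad u x == 0 then 0
  else Num.sqrt (\tr (a x *m hess u x *m a 0 *m hess u x)
    - (anorm (a 0) (grad u x)) ^- 2
      * anorm (a x) (hess u x *m a 0 *m grad u x) ^+ 2).

End elliptic.

(* Main.v *)
Require Import Defs.
From HB Require Import structures.
From mathcomp Require Import all_boot all_order all_algebra.
From mathcomp Require Import all_classical all_reals all_analysis measurable_realfun.
From mathcomp Require Import ring lra.

Import Order.TTheory GRing.Theory Num.Theory Num.Def.
Import numFieldNormedType.Exports.

Local Open Scope classical_set_scope.
Local Open Scope ring_scope.
Set Implicit Arguments.
Unset Strict Implicit.
Unset Printing Implicit Defensive.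

(** Fix a point and write [p] for the gradient of [u], [M] for its Hessian,
    [A = a x], [al = a 0], [c2 = |p|_al^2] and [q = M al p].  As [al] does not
    depend on the point, [grad c2 = 2 q] involves only second derivatives of [u].

    First inequality.  A positive supersolution [phi] of the linearised equation
    is available, so formally one tests the linearised operator with
    [c2 eta^2 / phi].  This is done pointwise: with [psi = grad phi / phi], the
    field
<<
      X_i = eta^2 (sum_j a_ij (q_j - c2 psi_j) + (al p)_i (b . p))
>>
    is C^1 and vanishes outside the support of [eta].  In its divergence the
    equation differentiated once removes the third derivatives of [u] and the
    derivatives of [b] (this is why the last term is put in [X]); what is left
    of [f'(u)] has a sign by stability.  Completing the square of
    [c2 eta psi - eta q - c2 grad eta] in the metric [A] gives
<<
      eta^2 (tr (A M al M) - |q|_A^2 / c2) <= div X + c2 |grad eta|_A^2 + errors,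
>>
    where each error carries a factor [DA] or [b], hence [eps]
    ([stability_inequality], [stab_divergence]).  The integral of [div X] is
    zero, and integration gives the first claim ([curvature_integral]).

    Second part.  Let [T = tr (A M)] and let [nu] be the norm of the rows of [M]
    projected off [p].  Writing [A] as a sum of nonnegative rank one forms
    ([psd_decomposition]) shows that the curvature term above is at least
    [lam^2 nu^2] ([normal_deficit_le]), and ellipticity gives
    [|M| <= C (|T| + nu)] ([hess_entry_le]).  Since [f >= 0], the equation bounds
    [T] from above by [C eps |p|], so the weighted integral of [|p| |T|] can be
    read off from that of [- |p| T].  The divergence of the flux
    [w (A p) eta^2], with [w = sqrt (|p|^2 + d^2)], contains [|p| T] twice up to
    [C nu |p|], once from the divergence of [A p] and once from the gradient of
    [w], because [A (M p) . p = |p|^2 T] up to [C nu |p|^2] ([hess_normal_le],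
    [flux_estimate]).  Altogether [|M| |p| eta^2] is bounded by divergences,
    by [nu^2 eta^2] and by [|p|^2] times a weight depending on [eta]; the term
    [nu^2 eta^2] is controlled by the first inequality, whose error
    [C eps |M| |p| eta^2] is absorbed when [eps] is small
    ([absorption], [hessian_pointwise]).  Letting [d] tend to zero gives
    [hessian_integral].

    The function [eta] enters only through its first derivatives, so the two
    regions are treated with C^1 cutoffs built from squares of positive parts of
    quadratic polynomials ([ball_cutoff], [annulus_cutoff]). *)

(** * Lebesgue measure on row vectors *)

Section rV_measure.
Context {R : realType}.

Lemma rV_norm_lt n (x : 'rV[R]_n) (r : R) : 0 < r ->
  (`|x| < r) = [forall i, `|x ord0 i| < r].
Proof.
move=> r0; rewrite {1}/normr /= mx_normrE; apply/idP/idP.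
  move=> /bigmax_ltP[_ H]; apply/forallP => i; exact: (H (ord0, i)).
move/forallP => H; apply/bigmax_ltP; split => // -[i j] _ /=.
by rewrite (ord1 i).
Qed.

Lemma rV_norm_coord n (x : 'rV[R]_n) i : `|x ord0 i| <= `|x|.
Proof.
by rewrite [leRHS]/normr /= mx_normrE; apply/bigmax_geP; right => /=; exists (ord0, i).
Qed.

(** The measurable sets come from the coordinates and the open sets from the sup
    norm.  An open set is the union of the cubes with rational centre and radius
    [1 / (k + 1)] that it contains, and there are countably many of them. *)
Lemma open_measurable_rV n (U : set 'rV[R]_n) : open U -> measurable U.
Proof.
move=> oU.
pose box (z : 'rV[rat]_n * nat) : set 'rV[R]_n :=
  [set x | forall i, `|x ord0 i - ratr (z.1 ord0 i)| < z.2.+1%:R^-1].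
pose F z := if `[< box z `<=` U >] then box z else set0.
have -> : U = \bigcup_z F z.
  apply/seteqP; split => [x Ux|x [z _]]; last first.
    by rewrite /F; case: asboolP => // + bx; exact.
  have /nbhs_ballP[e /= e0 He] : nbhs x U by exact: open_nbhs_nbhs.
  have [k Hk] : exists k : nat, k.+1%:R^-1 < e / 2.
    have e20 : 0 < e / 2 by rewrite divr_gt0.
    exists (Num.trunc (e / 2)^-1).
    by rewrite -[ltRHS]invrK ltf_pV2 ?posrE ?invr_gt0// truncnS_gt.
  have [q Hq] : exists q : 'rV[rat]_n, forall i, `|x ord0 i - ratr (q ord0 i)| < k.+1%:R^-1.
    have H i : exists r : rat, `|x ord0 i - ratr r| < k.+1%:R^-1.
      have k0 : (0 : R) < k.+1%:R^-1 by rewrite invr_gt0.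
      have /rat_in_itvoo[r] : x ord0 i - k.+1%:R^-1 < x ord0 i + k.+1%:R^-1.
        by rewrite ltrD2l gtrN.
      rewrite in_itv/= => /andP[h1 h2]; exists r.
      by rewrite ltr_distlC h1 h2.
    have [g Hg] := choice H.
    by exists (\row_i g i) => i; rewrite mxE.
  exists (q, k) => //; rewrite /F; case: asboolP => [_ i|[]]; first exact: Hq.
  move=> y /= Hy; apply: He; rewrite -ball_normE /= rV_norm_lt//.
  apply/forallP => i; rewrite !mxE.
  have -> : x ord0 i - y ord0 i = (x ord0 i - ratr (q ord0 i)) - (y ord0 i - ratr (q ord0 i)).
    by rewrite opprB addrA subrK.
  rewrite (le_lt_trans (ler_normB _ _))// (splitr e).
  by apply: ltrD; apply: (lt_trans _ Hk); [exact: Hq|exact: Hy].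
apply: countable_bigcupT_measurable; first exact: countableP.
move=> z; rewrite /F; case: asboolP => // _.
have -> : box z = \bigcap_(i : 'I_n)
    ((fun x : 'rV[R]_n => x ord0 i) @^-1` [set t | `|t - ratr (z.1 ord0 i)| < z.2.+1%:R^-1]).
  by apply/seteqP; split => x H i => //; have := H i; exact.
apply: fin_bigcap_measurable => // i _.
rewrite -[X in measurable X]setTI; apply: (measurable_coord i) => //.
have -> : [set t : R | `|t - ratr (z.1 ord0 i)| < z.2.+1%:R^-1] =
   `]ratr (z.1 ord0 i) - z.2.+1%:R^-1, ratr (z.1 ord0 i) + z.2.+1%:R^-1[%classic.
  by apply/seteqP; split => t /=; rewrite in_itv/= ltr_distl.
exact: measurable_itv.
Qed.

Lemma continuous_measurable_rV n (D : set 'rV[R]_n) (f : 'rV[R]_n -> R) :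
  open D -> (forall x, D x -> {for x, continuous f}) -> measurable_fun D f.
Proof.
move=> oD cf; apply: (measurability _ (RGenOpens.measurableE R)).
move=> _ [_ [a [b ->]] <-]; apply: open_measurable_rV.
rewrite openE => x [Dx fx]; apply: filterI; first exact: open_nbhs_nbhs.
apply: cf => //; apply: open_nbhs_nbhs; split => //; exact: interval_open.
Qed.

Lemma cvg_rV {T} (F : set_system T) {FF : Filter F} n (h : T -> 'rV[R]_n) (l : 'rV[R]_n) :
  (forall i, (fun t => h t ord0 i) @ F --> l ord0 i) -> h @ F --> l.
Proof.
move=> H; apply/cvgrPdist_lt => e e0.
have : \forall t \near F, forall i, `|l ord0 i - h t ord0 i| < e.
  by apply: filter_forall => i; move/cvgrPdist_lt: (H i); apply.
apply: filterS => t Ht; rewrite rV_norm_lt//; apply/forallP => i.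
by rewrite !mxE; exact: Ht.
Qed.

Lemma continuous_cons_rV n (y : 'rV[R]_n) (r : R) :
  {for (r, y), continuous (@cons_rV R n)}.
Proof.
apply: cvg_rV => i; rewrite mxE.
case: unliftP => [j ->|->].
  under eq_fun do rewrite mxE liftK.
  apply: (@cvg_comp _ _ _ snd (fun z : 'rV[R]_n => z ord0 j)); first exact: cvg_snd.
  exact: coord_continuous.
under eq_fun do rewrite mxE unlift_none.
exact: cvg_fst.
Qed.

(** Written with intervals, so that compactness and measure of products apply. *)
Definition rV_box n (K : R) : set 'rV[R]_n :=
  [set x | forall i, `[(-K), K]%classic (x ord0 i)].

Lemma rV_boxP n (K : R) (x : 'rV[R]_n) : rV_box K x <-> forall i, `|x ord0 i| <= K.
Proof.
by split => H i; have := H i; rewrite /= in_itv/= -ler_norml.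
Qed.

Lemma measurable_rV_box n (K : R) : measurable (@rV_box n K).
Proof.
have -> : @rV_box n K = \bigcap_(i : 'I_n)
    ((fun x : 'rV[R]_n => x ord0 i) @^-1` `[(-K), K]%classic).
  by apply/seteqP; split => x H i //; have := H i; exact.
apply: fin_bigcap_measurable => // i _.
rewrite -[X in measurable X]setTI; apply: (measurable_coord i) => //.
Qed.

Lemma compact_rV_box n (K : R) : compact (@rV_box n K).
Proof.
by apply: (@rV_compact _ _ (fun=> `[(-K), K]%classic)) => i; exact: segment_compact.
Qed.

Lemma lebesgue_rV_box_fin n (K : R) : (lebesgue_rV R n (rV_box K) < +oo)%E.
Proof.
pose I : set R := `[(-K), K]%classic.
rewrite (@lebesgue_rV_box R n (fun=> I)); last by move=> i; exact: measurable_itv.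
suff : (\prod_(i < n) lebesgue_measure I)%E \is a fin_num.
  by move=> /fin_numPlt/andP[].
apply: prode_fin_num => i _; rewrite lebesgue_measure_itv/=.
by case: ifP.
Qed.

Lemma rV_boxN n (K : R) (x : 'rV[R]_n) : ~ rV_box K x -> K < `|x|.
Proof.
move=> xB; rewrite ltNge; apply/negP => xK; apply: xB; apply/rV_boxP => i.
exact: le_trans (rV_norm_coord _ _) _.
Qed.

(** Off a box the function is zero; the box is compact and has finite measure. *)
Lemma Cc_integrable n (g : 'rV[R]_n -> R) (K : R) :
  continuous g -> (forall x, K < `|x| -> g x = 0) ->
  (lebesgue_rV R n).-integrable setT (EFin \o g).
Proof.
move=> cg gK.
have gB : (EFin \o g) \_ (rV_box K) = EFin \o g.
  apply/funext => x; rewrite /patch; case: ifPn => //; rewrite notin_setE => xB.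
  by rewrite /= gK//; exact: rV_boxN.
rewrite -gB; apply/(integrable_mkcond _ (measurable_rV_box K)).
apply: measurable_bounded_integrable.
- exact: measurable_rV_box.
- exact: lebesgue_rV_box_fin.
- apply: measurable_funTS.
  by apply: (@continuous_measurable_rV n setT) => [|x _]; [exact: openT|exact: cg].
have /compact_bounded[M [Mr HM]] : compact (g @` (rV_box K)).
  apply: continuous_compact; [exact: continuous_subspaceT|exact: compact_rV_box].

by exists M; split => // M' MM' x Bx; apply: HM => //; exists x.
Qed.

Lemma cons_rV_shift0 n (h r : R) (y : 'rV[R]_n) :
  cons_rV (h + r, y) = h *: delta_mx ord0 ord0 + cons_rV (r, y).
Proof.
apply/rowP => i; rewrite !mxE eqxx/=; case: unliftP => [j ->|->].
  by rewrite mulr0 add0r.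
by rewrite mulr1.
Qed.

Lemma cons_rV_shiftS n (h r : R) (y : 'rV[R]_n) (j : 'I_n) :
  cons_rV (r, h *: delta_mx ord0 j + y) = h *: delta_mx ord0 (lift ord0 j) + cons_rV (r, y).
Proof.
apply/rowP => i; rewrite !mxE eqxx/=; case: unliftP => [k ->|->].
  by rewrite !mxE eqxx/= (inj_eq (@lift_inj _ _)).
by rewrite mulr0 add0r.
Qed.

Lemma cons_rV_norm n (r : R) (y : 'rV[R]_n) K : (K < `|r|) || (K < `|y|) -> K < `|cons_rV (r, y)|.
Proof.
case/orP => H; first by apply: (lt_le_trans H); have := rV_norm_coord (cons_rV (r, y)) ord0; rewrite mxE unlift_none.
have [K0|K0] := ltP K 0; first exact: (lt_le_trans K0).
have := H; rewrite {1}/normr /= mx_normrE => /bigmax_gtP[]; first by rewrite ltNge K0.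
move=> [[i j] _ /=]; rewrite (ord1 i) => Hj; apply: (lt_le_trans Hj).
by have := rV_norm_coord (cons_rV (r, y)) (lift ord0 j); rewrite mxE liftK.
Qed.

Lemma partial_far n (i : 'I_n) (g : 'rV[R]_n -> R) K :
  (forall x, K < `|x| -> g x = 0) -> forall x, K < `|x| -> partial i g x = 0.
Proof.
move=> gK x Kx; rewrite /partial -(derive_cst (0 : R) x (delta_mx ord0 i)).
apply: near_eq_derive.
have : \forall y \near x, K < `|y| by exact: (cvgr_gt _ (@norm_continuous _ _ x) _ Kx).
by apply: filterS => y /gK.
Qed.

(** The fundamental theorem of calculus on an interval larger than the support. *)
Lemma integral_derive_eq0 (h : R -> R) K :
  (forall r, derivable h r 1) -> continuous (derive1 h) ->
  (forall r, K < `|r| -> h r = 0) ->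
  (\int[lebesgue_measure]_r (derive1 h r)%:E = 0)%E.
Proof.
move=> dh ch hK.
pose K' := Num.max K 0 + 1.
have KK' : K < K' by rewrite (@le_lt_trans _ _ (Num.max K 0)) ?ltrDl// le_max lexx.
have K'0 : 0 < K' by rewrite ltr_wpDl// le_max lexx orbT.
have dhK r : K < `|r| -> derive1 h r = 0.
  move=> Kr; rewrite derive1E -(derive_cst (0 : R) r (1 : R)).
  apply: near_eq_derive.
  have : \forall y \near r, K < `|y| by exact: (cvgr_gt _ (@norm_continuous _ _ r) _ Kr).
  by apply: filterS => y /hK.
have hc : continuous h.
  by move=> r; apply: differentiable_continuous; apply/derivable1_diffP.
have E : (fun r => (derive1 h r)%:E) = ((fun r => (derive1 h r)%:E) \_ `[- K', K']%classic).
  apply/funext => r; rewrite /patch; case: ifPn => //; rewrite notin_setE /= in_itv/= -ler_norml.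
  by move/negP; rewrite -ltNge => rK; rewrite dhK// (lt_trans KK').
rewrite E -integral_mkcond (@continuous_FTC2 _ _ h).
- by rewrite !hK ?subee// ?normrN gtr0_norm.
- by rewrite gtrN.
- by apply: continuous_subspaceT; exact: ch.
- split => //.
  + by apply: cvg_at_right_filter; exact: hc.
  + by apply: cvg_at_left_filter; exact: hc.
- by [].
Qed.

Lemma cvg_pair_cons_rV n (r : R) (y : 'rV[R]_n) :
  (cons_rV (r, z) @[z --> y] --> cons_rV (r, y)) /\
  (cons_rV (z, y) @[z --> r] --> cons_rV (r, y)).
Proof.
have c1 : (fun _ : 'rV[R]_n => r) @ y --> r by exact: (@cvg_cst _ r _ (nbhs y) _).
have c2 : (fun z : 'rV[R]_n => z) @ y --> y by exact: cvg_id.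
have c3 : (fun _ : R => y) @ r --> y by exact: (@cvg_cst _ y _ (nbhs r) _).
have c4 : (fun z : R => z) @ r --> r by exact: cvg_id.
split.
  exact: (cvg_comp _ _ (cvg_pair c1 c2) (@continuous_cons_rV n y r)).
exact: (cvg_comp _ _ (cvg_pair c4 c3) (@continuous_cons_rV n y r)).
Qed.

Lemma continuous_sectionr n (g : 'rV[R]_n.+1 -> R) r :
  continuous g -> continuous (fun y => g (cons_rV (r, y))).
Proof. move=> cg y; exact: (cvg_comp _ _ (cvg_pair_cons_rV r y).1 (cg (cons_rV (r, y)))). Qed.

Lemma continuous_sectionl n (g : 'rV[R]_n.+1 -> R) y :
  continuous g -> continuous (fun r => g (cons_rV (r, y))).
Proof. move=> cg r; exact: (cvg_comp _ _ (cvg_pair_cons_rV r y).2 (cg (cons_rV (r, y)))). Qed.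

(** A directional derivative depends only on the restriction to a line; this
    moves derivatives between spaces of different dimension. *)
Lemma derive_line (V V' : normedModType R) (f : V -> R) (g : V' -> R) a b v w :
  (forall h, f (h *: v + a) = g (h *: w + b)) ->
  'D_v f a = 'D_w g b /\ (derivable f a v <-> derivable g b w).
Proof.
move=> H.
have fa : f a = g b by have := H 0; rewrite !scale0r !add0r.
have E : (fun h => h^-1 *: ((f \o shift a) (h *: v) - f a)) =
         (fun h => h^-1 *: ((g \o shift b) (h *: w) - g b)).
  by apply/funext => h /=; rewrite H fa.
by rewrite /derive /derivable E.
Qed.

(** Fubini's theorem.  If [i] is the first coordinate, integrate first in it:
    the inner integral is that of the derivative of a compactly supported
    function of one variable.  Otherwise integrate first in the other
    coordinates, where the induction hypothesis applies to each slice. *)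
Lemma integral_partial_eq0 n (i : 'I_n) (g : 'rV[R]_n -> R) K :
  (forall x, derivable g x (delta_mx ord0 i)) -> continuous (partial i g) ->
  (forall x, K < `|x| -> g x = 0) ->
  (\int[lebesgue_rV R n]_x (partial i g x)%:E = 0)%E.
Proof.
elim: n => [|n IH] in i g K *; first by case: i.
move=> dg cg gK.
have pgK := @partial_far _ i g K gK.
have ipg := Cc_integrable cg pgK.
pose F := fun z : R * 'rV[R]_n => (partial i g (cons_rV z))%:E.
pose X : measurableType _ := (measurableTypeR R * 'rV[R]_n)%type.
pose m : {measure set _ -> \bar R} := (@lebesgue_measure R \x lebesgue_rV R n)%E.
have [mp fp] := integrableP _ _ _ ipg.
have mF : measurable_fun setT F.
  apply/measurable_EFinP.
  exact: (measurableT_comp ((measurable_EFinP _ _).1 mp) (@measurable_cons_rV R n)).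
have iF : m.-integrable setT F.
  apply/integrableP; split; first exact: mF.
  apply: le_lt_trans fp; rewrite le_eqVlt; apply/orP; left; apply/eqP; apply/esym.
  have H := @ge0_integral_pushforward _ _ X 'rV[R]_n.+1 R (@cons_rV R n) (@measurable_cons_rV R n) m setT (abse \o (EFin \o partial i g)).
  apply: H; [exact: measurableT|exact: measurableT_comp|by move=> y _; exact: abse_ge0].
apply: (etrans (@integral_pushforward _ _ X 'rV[R]_n.+1 R (@cons_rV R n) (@measurable_cons_rV R n) m setT (EFin \o partial i g) mp iF measurableT)).
change (\int[m]_z F z = 0)%E.
rewrite /m.
case: (unliftP ord0 i) => [j ij|i0].
- rewrite -integral12_prod_meas1//= /fubini_F; apply: integral0_eq => r _.
  rewrite /F.
  pose gr y := g (cons_rV (r, y)).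
  have L y := @derive_line _ _ gr g y (cons_rV (r, y)) (delta_mx ord0 j) (delta_mx ord0 i).
  have {}L y := L y (fun h => congr1 g (etrans (cons_rV_shiftS h r y j) (congr1 (fun k => h *: delta_mx ord0 k + cons_rV (r, y)) (esym ij)))).
  have E y : partial i g (cons_rV (r, y)) = partial j gr y by rewrite /partial (L y).1.
  under eq_integral do rewrite E.
  apply: (IH _ _ K).
  + by move=> y; apply/(L y).2; exact: dg.
  + have -> : partial j gr = fun y => partial i g (cons_rV (r, y)) by apply/funext => y; rewrite E.
    exact: continuous_sectionr.
  + by move=> y Ky; apply: gK; apply: cons_rV_norm; rewrite Ky orbT.
- rewrite -integral21_prod_meas1//= /fubini_G; apply: integral0_eq => y _.
  rewrite /F.
  pose gr r := g (cons_rV (r, y)).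
  have L r : 'D_1 gr r = 'D_(delta_mx ord0 i) g (cons_rV (r, y)) /\ (derivable gr r 1 <-> derivable g (cons_rV (r, y)) (delta_mx ord0 i)).
    by apply: derive_line => h; rewrite /gr [h *: 1]mulr1 cons_rV_shift0 i0.
  have E r : partial i g (cons_rV (r, y)) = derive1 gr r by rewrite derive1E (L r).1.
  under eq_integral do rewrite E.
  apply: (@integral_derive_eq0 _ K).
  + by move=> r; apply/(L r).2; exact: dg.
  + have -> : derive1 gr = fun r => partial i g (cons_rV (r, y)) by apply/funext => r; rewrite E.
    exact: continuous_sectionl.
  + by move=> r Kr; apply: gK; apply: cons_rV_norm; rewrite Kr.
Qed.

End rV_measure.

(** * Functions of class C^1 on an open set *)

Section calculus.
Context {R : realType} {n : nat}.
Implicit Types (f g : 'rV[R]_n -> R) (x : 'rV[R]_n) (U : set 'rV[R]_n) (i : 'I_n).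

Local Notation e_ i := (delta_mx ord0 i : 'rV[R]_n).

Lemma near_continuous f g x :
  (\forall y \near x, f y = g y) -> {for x, continuous f} -> {for x, continuous g}.
Proof.
move=> fg cf; have fgx := nbhs_singleton fg.
rewrite /prop_for /continuous_at -fgx.
exact: (cvg_trans (@near_eq_cvg _ _ (nbhs x) _ f g fg) cf).
Qed.

Definition C1on U f := forall x, U x ->
  {for x, continuous f} /\
  forall i, derivable f x (e_ i) /\ {for x, continuous (partial i f)}.

Lemma C1onW U V f : U `<=` V -> C1on V f -> C1on U f.
Proof. by move=> UV Vf x /UV /Vf. Qed.

Lemma ctsD f g x : {for x, continuous f} -> {for x, continuous g} ->
  {for x, continuous (fun y => f y + g y)}.
Proof. exact: continuousD. Qed.

Lemma ctsN f x : {for x, continuous f} -> {for x, continuous (fun y => - f y)}.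
Proof. exact: continuousN. Qed.

Lemma ctsM f g x : {for x, continuous f} -> {for x, continuous g} ->
  {for x, continuous (fun y => f y * g y)}.
Proof. exact: continuousM. Qed.

Lemma ctsV f x : f x != 0 -> {for x, continuous f} ->
  {for x, continuous (fun y => (f y)^-1)}.
Proof. exact: continuousV. Qed.

Lemma cts_cst (c : R) x : {for x, continuous (fun _ : 'rV[R]_n => c)}.
Proof. exact: cst_continuous. Qed.

Lemma cts_sum (I : Type) (r : seq I) (P : pred I) (F : I -> 'rV[R]_n -> R) x :
  (forall j, P j -> {for x, continuous (F j)}) ->
  {for x, continuous (fun y => \sum_(j <- r | P j) F j y)}.
Proof.
move=> CF; elim: r => [|j r IH].
  have -> : (fun y => \sum_(j <- [::] | P j) F j y) = fun=> 0.
    by apply/funext => y; rewrite big_nil.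
  exact: cts_cst.
have -> : (fun y => \sum_(k <- j :: r | P k) F k y) =
    if P j then fun y => F j y + \sum_(k <- r | P k) F k y
    else fun y => \sum_(k <- r | P k) F k y.
  by apply/funext => y; rewrite big_cons; case: ifP.
case: ifP => Pj; last exact: IH.
exact: ctsD (CF j Pj) IH.
Qed.

Lemma ctsX f k x : {for x, continuous f} -> {for x, continuous (fun y => f y ^+ k)}.
Proof.
move=> cf; elim: k => [|k IH]; first exact: cts_cst.
have -> : (fun y => f y ^+ k.+1) = (fun y => f y * f y ^+ k) by apply/funext => y; rewrite exprS.
exact: ctsM.
Qed.

Lemma cts_sqrt f x : {for x, continuous f} -> {for x, continuous (fun y => Num.sqrt (f y))}.
Proof.
by move=> cf; apply: (@continuous_comp _ _ _ f (@Num.sqrt R)) => //; exact: sqrt_continuous.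
Qed.

Lemma cts_norm f x : {for x, continuous f} -> {for x, continuous (fun y => `|f y|)}.
Proof.
by move=> cf; apply: (@continuous_comp _ _ _ f (@normr R R)) => //; exact: norm_continuous.
Qed.

Lemma partial_cst i (c : R) x : partial i (fun=> c) x = 0.
Proof. exact: derive_cst. Qed.

Lemma partialD i f g x : derivable f x (e_ i) -> derivable g x (e_ i) ->
  partial i (fun y => f y + g y) x = partial i f x + partial i g x.
Proof. by move=> df dg; exact: (deriveD df dg). Qed.

Lemma partialN i f x : derivable f x (e_ i) ->
  partial i (fun y => - f y) x = - partial i f x.
Proof. by move=> df; exact: (deriveN df). Qed.

Lemma partialM i f g x : derivable f x (e_ i) -> derivable g x (e_ i) ->
  partial i (fun y => f y * g y) x = partial i f x * g x + f x * partial i g x.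
Proof.
move=> df dg; apply: (etrans (deriveM df dg)).
by rewrite addrC; congr (_ + _); exact: mulrC.
Qed.

Lemma derivableV_fun i f x : f x != 0 -> derivable f x (e_ i) ->
  derivable (fun y => (f y)^-1) x (e_ i).
Proof. exact: derivableV. Qed.

Lemma partialV i f x : f x != 0 -> derivable f x (e_ i) ->
  partial i (fun y => (f y)^-1) x = - partial i f x / f x ^+ 2.
Proof. by move=> f0 df; rewrite /partial deriveV//= /GRing.scale/= mulrC mulrN mulNr. Qed.

Lemma chain_rule (F : R -> R) f x (v : 'rV[R]_n) : derivable f x v -> derivable F (f x) 1 ->
  derivable (fun y => F (f y)) x v /\
  'D_v (fun y => F (f y)) x = derive1 F (f x) * 'D_v f x.
Proof.
move=> df dF; pose p (h : R) := f (h *: v + x).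
have Hp h : f (h *: v + x) = p (h *: 1 + 0) by rewrite /p [h *: 1]mulr1 addr0.
have HF h : F (f (h *: v + x)) = (F \o p) (h *: 1 + 0) by rewrite /p /= [h *: 1]mulr1 addr0.
have p0 : p 0 = f x by rewrite /p scale0r add0r.
have [E1 /iffLR/(_ df) D1] := derive_line Hp.
have [E2 D2] := @derive_line _ _ _ (fun y => F (f y)) (F \o p) _ _ _ _ HF.
have dF' : derivable F (p 0) 1 by rewrite p0.
have D1' : derivable p 0 1 := D1.
split.
  apply/D2; apply/derivable1_diffP; apply: differentiable_comp.
    exact: (iffLR (derivable1_diffP _ _) D1').
  exact: (iffLR (derivable1_diffP _ _) dF').
rewrite E2 -derive1E (derive1_comp (D1 : derivable p 0 1) dF') p0; congr (_ * _).
by rewrite derive1E -E1.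
Qed.

Lemma C1on_cst U (c : R) : C1on U (fun=> c).
Proof.
move=> x _; split; first exact: cst_continuous.
move=> i; split; first exact: derivable_cst.
have -> : partial i (fun=> c) = fun=> 0 by apply/funext => y; exact: partial_cst.
exact: cst_continuous.
Qed.

Section rules.
Variables (U : set 'rV[R]_n) (oU : open U).

Lemma open_near x (P : 'rV[R]_n -> Prop) : U x -> (forall y, U y -> P y) -> \forall y \near x, P y.
Proof. by move=> Ux UP; apply: filterS UP _; exact: open_nbhs_nbhs. Qed.

(** As [U] is open, a formula for the partial derivatives that holds at the
    points of [U] also gives their continuity. *)
Lemma C1onP f (F' : 'I_n -> 'rV[R]_n -> R) :
  (forall x, U x -> {for x, continuous f}) ->
  (forall x i, U x -> derivable f x (e_ i)) ->
  (forall x i, U x -> partial i f x = F' i x) ->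
  (forall x i, U x -> {for x, continuous (F' i)}) -> C1on U f.
Proof.
move=> cf df pf cF x Ux; split; first exact: cf.
move=> i; split; first exact: df.
apply: near_continuous (cF x i Ux).
by apply: open_near Ux _ => y Uy; rewrite pf.
Qed.

Lemma C1onD f g : C1on U f -> C1on U g -> C1on U (fun y => f y + g y).
Proof.
move=> Cf Cg; apply: (@C1onP _ (fun i y => partial i f y + partial i g y)).
- by move=> x Ux; apply: ctsD; [exact: (Cf x Ux).1|exact: (Cg x Ux).1].
- by move=> x i Ux; apply: derivableD; [exact: ((Cf x Ux).2 i).1|exact: ((Cg x Ux).2 i).1].
- by move=> x i Ux; rewrite partialD//; [exact: ((Cf x Ux).2 i).1|exact: ((Cg x Ux).2 i).1].
- by move=> x i Ux; apply: ctsD; [exact: ((Cf x Ux).2 i).2|exact: ((Cg x Ux).2 i).2].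
Qed.

Lemma C1onN f : C1on U f -> C1on U (fun y => - f y).
Proof.
move=> Cf; apply: (@C1onP _ (fun i y => - partial i f y)).
- by move=> x Ux; apply: ctsN; exact: (Cf x Ux).1.
- by move=> x i Ux; apply: derivableN; exact: ((Cf x Ux).2 i).1.
- by move=> x i Ux; rewrite partialN//; exact: ((Cf x Ux).2 i).1.
- by move=> x i Ux; apply: ctsN; exact: ((Cf x Ux).2 i).2.
Qed.

Lemma C1onM f g : C1on U f -> C1on U g -> C1on U (fun y => f y * g y).
Proof.
move=> Cf Cg; apply: (@C1onP _ (fun i y => partial i f y * g y + f y * partial i g y)).
- by move=> x Ux; apply: ctsM; [exact: (Cf x Ux).1|exact: (Cg x Ux).1].
- by move=> x i Ux; apply: derivableM; [exact: ((Cf x Ux).2 i).1|exact: ((Cg x Ux).2 i).1].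
- by move=> x i Ux; rewrite partialM//; [exact: ((Cf x Ux).2 i).1|exact: ((Cg x Ux).2 i).1].
- move=> x i Ux; apply: ctsD.
    exact: ctsM ((Cf x Ux).2 i).2 (Cg x Ux).1.
  exact: ctsM (Cf x Ux).1 ((Cg x Ux).2 i).2.
Qed.

Lemma C1on_sum (I : Type) (r : seq I) (P : pred I) (F : I -> 'rV[R]_n -> R) :
  (forall j, P j -> C1on U (F j)) -> C1on U (fun y => \sum_(j <- r | P j) F j y).
Proof.
move=> CF; elim: r => [|j r IH].
  have -> : (fun y => \sum_(j <- [::] | P j) F j y) = fun=> 0.
    by apply/funext => y; rewrite big_nil.
  exact: C1on_cst.
have -> : (fun y => \sum_(k <- j :: r | P k) F k y) =
    if P j then fun y => F j y + \sum_(k <- r | P k) F k y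
    else fun y => \sum_(k <- r | P k) F k y.
  by apply/funext => y; rewrite big_cons; case: ifP.
case: ifP => Pj; last exact: IH.
exact: C1onD (CF j Pj) IH.
Qed.

Lemma partial_sum (I : Type) (r : seq I) (P : pred I) (F : I -> 'rV[R]_n -> R) i x :
  U x -> (forall j, P j -> C1on U (F j)) ->
  partial i (fun y => \sum_(j <- r | P j) F j y) x = \sum_(j <- r | P j) partial i (F j) x.
Proof.
move=> Ux CF; elim: r => [|j r IH].
  have -> : (fun y => \sum_(j <- [::] | P j) F j y) = fun=> 0.
    by apply/funext => y; rewrite big_nil.
  by rewrite big_nil partial_cst.
have -> : (fun y => \sum_(k <- j :: r | P k) F k y) =
    if P j then fun y => F j y + \sum_(k <- r | P k) F k y
    else fun y => \sum_(k <- r | P k) F k y.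
  by apply/funext => y; rewrite big_cons; case: ifP.
rewrite big_cons -IH; case: ifP => // Pj; rewrite partialD//.
  exact: ((CF _ Pj x Ux).2 i).1.
exact: ((C1on_sum r CF Ux).2 i).1.
Qed.

Lemma C1onV f : (forall x, U x -> f x != 0) -> C1on U f -> C1on U (fun y => (f y)^-1).
Proof.
move=> f0 Cf; apply: (@C1onP _ (fun i y => - partial i f y / (f y ^+ 2))).
- by move=> x Ux; apply: ctsV; [exact: f0|exact: (Cf x Ux).1].
- by move=> x i Ux; apply: derivableV_fun; [exact: f0|exact: ((Cf x Ux).2 i).1].
- by move=> x i Ux; rewrite partialV//; [exact: f0|exact: ((Cf x Ux).2 i).1].
- move=> x i Ux; apply: ctsM; first by apply: ctsN; exact: ((Cf x Ux).2 i).2.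
  apply: ctsV; first by rewrite expf_neq0// f0.
  by apply: ctsX; exact: (Cf x Ux).1.
Qed.

Lemma C1on_comp (F : R -> R) f : (forall x, U x -> derivable F (f x) 1) ->
  (forall x, U x -> {for (f x), continuous (derive1 F)}) ->
  C1on U f -> C1on U (fun y => F (f y)).
Proof.
move=> dF cF Cf; apply: (@C1onP _ (fun i y => derive1 F (f y) * partial i f y)).
- move=> x Ux; apply: (@continuous_comp _ _ _ f F); first exact: (Cf x Ux).1.
  by apply: differentiable_continuous; apply/derivable1_diffP; exact: dF.
- by move=> x i Ux; apply: (chain_rule ((Cf x Ux).2 i).1 _).1; exact: dF.
- by move=> x i Ux; rewrite /partial (chain_rule ((Cf x Ux).2 i).1 _).2//; exact: dF.
- move=> x i Ux; apply: ctsM; last exact: ((Cf x Ux).2 i).2.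
  by apply: (@continuous_comp _ _ _ f (derive1 F)); [exact: (Cf x Ux).1|exact: cF].
Qed.

Lemma eq_partial f g i x : U x -> (forall y, U y -> f y = g y) -> partial i f x = partial i g x.
Proof. by move=> Ux fg; apply: near_eq_derive; exact: open_near. Qed.

End rules.

Lemma Ck_C1on k U f s : Ck k U f -> (size s < k)%N -> C1on U (partials s f).
Proof.
move=> [df cf] sk x Ux; split; first by apply: cf => //; exact: ltnW.
by move=> i; split; [exact: df|exact: (cf (i :: s))].
Qed.

(** * Symmetry of second derivatives *)

Lemma is_derive_line g x v (s : R) : derivable g (s *: v + x) v ->
  is_derive s 1 (fun t : R => g (t *: v + x)) ('D_v g (s *: v + x)).
Proof.
move=> dg.
have H h : (fun t : R => g (t *: v + x)) (h *: 1 + s) = g (h *: v + (s *: v + x)).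
  by rewrite [h *: 1]mulr1 scalerDl addrA.
have [E D] : 'D_1 (fun t : R => g (t *: v + x)) s = 'D_v g (s *: v + x) /\
  (derivable (fun t : R => g (t *: v + x)) s 1 <-> derivable g (s *: v + x) v) by exact: derive_line.
by apply: DeriveDef; [exact/D|].
Qed.

Lemma line_MVT U g (i : 'I_n) x (h : R) : 0 < h -> C1on U g ->
  (forall t, 0 <= t <= h -> U (t *: e_ i + x)) ->
  exists2 t, 0 <= t <= h & g (h *: e_ i + x) - g x = h * partial i g (t *: e_ i + x).
Proof.
move=> h0 Cg HU.
have dl t : 0 <= t <= h -> is_derive t 1 (fun t : R => g (t *: e_ i + x)) (partial i g (t *: e_ i + x)).
  by move=> /HU Ut; apply: is_derive_line; exact: ((Cg _ Ut).2 i).1.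
have d1 t : t \in `]0, h[ -> is_derive t 1 (fun t => g (t *: e_ i + x)) (partial i g (t *: e_ i + x)).
  by rewrite in_itv/= => /andP[t0 th]; apply: dl; rewrite !ltW.
have c1 : {within `[0, h], continuous (fun t => g (t *: e_ i + x))}.
  apply/continuous_in_subspaceT => t; rewrite inE/= in_itv/= => /dl[dt _].
  by apply: differentiable_continuous; exact/derivable1_diffP.
have [t] := MVT h0 d1 c1.
rewrite in_itv/= => /andP[t0 th] E; exists t; first by rewrite !ltW.
by move: E; rewrite scale0r add0r subr0 mulrC.
Qed.

(** The mean value theorem twice: in direction [j] for the increment
    [y |-> g (y + h e_i) - g y], then in direction [i] for [partial j g]. *)
Lemma second_difference U g (i j : 'I_n) x (h : R) : 0 < h ->
  (forall s t, 0 <= s <= h -> 0 <= t <= h -> U (t *: e_ i + (s *: e_ j + x))) ->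
  open U -> C1on U g -> C1on U (partial j g) ->
  exists s t, [/\ 0 <= s <= h, 0 <= t <= h &
   g (h *: e_ i + (h *: e_ j + x)) - g (h *: e_ j + x) - g (h *: e_ i + x) + g x =
   h ^+ 2 * partial i (partial j g) (t *: e_ i + (s *: e_ j + x))].
Proof.
move=> h0 HU oU Cg Cjg.
have hh : 0 <= h <= h by rewrite lexx ltW.
have zh : 0 <= (0 : R) <= h by rewrite lexx ltW.
pose G (y : 'rV[R]_n) := g (y + h *: e_ i) - g y.
pose V := [set y : 'rV[R]_n | U y /\ U (y + h *: e_ i)].
have shift_derive (f : 'rV[R]_n -> R) (y : 'rV[R]_n) k : 'D_(e_ k) (fun y : 'rV[R]_n => f (y + h *: e_ i)) y = 'D_(e_ k) f (y + h *: e_ i) /\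
   (derivable (fun y : 'rV[R]_n => f (y + h *: e_ i)) y (e_ k) <-> derivable f (y + h *: e_ i) (e_ k)).
  by apply: derive_line => t; rewrite addrA.
have shift_cont (f : 'rV[R]_n -> R) (y : 'rV[R]_n) : {for y + h *: e_ i, continuous f} -> {for y, continuous (fun y : 'rV[R]_n => f (y + h *: e_ i))}.
  move=> cf; apply: (@continuous_comp _ _ _ (fun y : 'rV[R]_n => y + h *: e_ i) f) => //.
  by apply: continuousD; [exact: cvg_id|exact: cst_continuous].
have CG : C1on V G.
  move=> y [Uy Uyh]; split.
    by apply: ctsD; [apply: shift_cont; exact: (Cg _ Uyh).1|apply: ctsN; exact: (Cg _ Uy).1].
  move=> k; split.
    apply: derivableD; first by apply/(shift_derive _ _ _).2; exact: ((Cg _ Uyh).2 k).1.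
    by apply: derivableN; exact: ((Cg _ Uy).2 k).1.
  have oV : \forall z \near y, V z.
    near=> z; split; first by near: z; exact: open_nbhs_nbhs.
    near: z.
    have c : {for y, continuous (fun z : 'rV[R]_n => z + h *: e_ i)}.
      by apply: continuousD; [exact: cvg_id|exact: cst_continuous].
    by apply: c; exact: open_nbhs_nbhs.
  apply: (@near_continuous (fun z => partial k g (z + h *: e_ i) - partial k g z)).
    apply: filterS oV => z [Uz Uzh]; rewrite /G partialD.
    - by rewrite partialN /partial ?(shift_derive _ _ _).1//; exact: ((Cg _ Uz).2 k).1.
    - by apply/(shift_derive _ _ _).2; exact: ((Cg _ Uzh).2 k).1.
    - by apply: derivableN; exact: ((Cg _ Uz).2 k).1.
  by apply: ctsD; [apply: shift_cont; exact: ((Cg _ Uyh).2 k).2|apply: ctsN; exact: ((Cg _ Uy).2 k).2].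
have VG s : 0 <= s <= h -> V (s *: e_ j + x).
  move=> hs; split; last by rewrite addrC; exact: HU.
  by have := HU s 0 hs zh; rewrite scale0r add0r.
have [s hs E1] := line_MVT h0 CG VG.
have [t ht E2] := @line_MVT U (partial j g) i (s *: e_ j + x) h h0 Cjg (fun t ht => HU s t hs ht).
exists s, t; split => //.
rewrite expr2 -mulrA -E2.
have E3 : partial j G (s *: e_ j + x) = partial j g (h *: e_ i + (s *: e_ j + x)) - partial j g (s *: e_ j + x).
  have [Uy Uyh] := VG s hs.
  rewrite /G partialD.
  - by rewrite partialN /partial ?(shift_derive _ _ _).1 1?addrC// 1?[h *: _ + _]addrC 1?addrC//; exact: ((Cg _ Uy).2 j).1.
  - by apply/(shift_derive _ _ _).2; exact: ((Cg _ Uyh).2 j).1.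
  - by apply: derivableN; exact: ((Cg _ Uy).2 j).1.
rewrite -E3 -E1 /G [h *: e_ j + x + _]addrC [x + _]addrC.
by ring.
Unshelve. all: by end_near. Qed.

(** Both functions are the limit at [x] of the same quotient [d h / h^2]. *)
Lemma second_difference_limit U (F1 F2 : 'rV[R]_n -> R) (w v x : 'rV[R]_n) (d : R -> R) :
  open U -> U x -> {for x, continuous F1} -> {for x, continuous F2} ->
  (forall h : R, 0 < h ->
    (forall s t, 0 <= s <= h -> 0 <= t <= h -> U (t *: w + (s *: v + x))) ->
    exists s t, [/\ 0 <= s <= h, 0 <= t <= h & d h = h ^+ 2 * F1 (t *: w + (s *: v + x))]) ->
  (forall h : R, 0 < h ->
    (forall s t, 0 <= s <= h -> 0 <= t <= h -> U (t *: v + (s *: w + x))) ->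
    exists s t, [/\ 0 <= s <= h, 0 <= t <= h & d h = h ^+ 2 * F2 (t *: v + (s *: w + x))]) ->
  F1 x = F2 x.
Proof.
move=> oU Ux c1 c2 d1 d2.
apply/eqP; rewrite -subr_eq0 -normr_le0; apply/ler_addgt0Pl => e e0; rewrite addr0.
have e20 : 0 < e / 2 by rewrite divr_gt0.
have : \forall y \near x, [/\ U y, `|F1 x - F1 y| < e / 2 & `|F2 x - F2 y| < e / 2].
  near=> y; split.
  - by near: y; exact: open_nbhs_nbhs.
  - by near: y; move: c1 => /cvgrPdist_lt; apply.
  - by near: y; move: c2 => /cvgrPdist_lt; apply.
move=> /nbhs_ballP[r /= r0 Hr].
pose N := `|w| + `|v| + 1.
have N0 : 0 < N by rewrite ltr_wpDl// addr_ge0.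
pose h := r / 2 / N.
have h0 : 0 < h by rewrite !divr_gt0.
have Hb (k l : 'rV[R]_n) s t : `|k| + `|l| + 1 = N -> 0 <= s <= h -> 0 <= t <= h ->
    ball x r (t *: k + (s *: l + x)).
  move=> EN /andP[s0 sh] /andP[t0 th]; rewrite -ball_normE/= addrA opprD addrCA subrr addr0 normrN.
  rewrite (le_lt_trans (ler_normD _ _))// !normrZ (ger0_norm s0) (ger0_norm t0).
  apply: (@le_lt_trans _ _ (h * N)).
    by rewrite -EN !mulrDr mulr1 -[leLHS]addr0 !lerD// ?ler_wpM2r// ltW.
  by rewrite /h divfK ?gt_eqF// gtr_pMr// invf_lt1// ltr1n.
have HN' : `|v| + `|w| + 1 = N by rewrite [`|v| + _]addrC.
have HN : `|w| + `|v| + 1 = N by [].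
have [s [t [hs ht E1]]] := d1 h h0 (fun s t hs ht => let: And3 u _ _ := Hr _ (Hb w v s t HN hs ht) in u).
have [s' [t' [hs' ht' E2]]] := d2 h h0 (fun s t hs ht => let: And3 u _ _ := Hr _ (Hb v w s t HN' hs ht) in u).
have [_ B1 _] := Hr _ (Hb w v s t HN hs ht).
have [_ _ B2] := Hr _ (Hb v w s' t' HN' hs' ht').
have E : F1 (t *: w + (s *: v + x)) = F2 (t' *: v + (s' *: w + x)).
  apply: (@mulfI _ (h ^+ 2)); first by rewrite expf_neq0// gt_eqF.
  by rewrite -E1 -E2.
rewrite E in B1; rewrite distrC in B2.
have -> : F1 x - F2 x = (F1 x - F2 (t' *: v + (s' *: w + x))) + (F2 (t' *: v + (s' *: w + x)) - F2 x).
  by rewrite addrA subrK.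
by rewrite (le_trans (ler_normD _ _))// (splitr e) lerD// ltW.
Unshelve. all: by end_near. Qed.

(** Schwarz's theorem: the second difference is symmetric in the two directions. *)
Lemma partial_comm U g (i j : 'I_n) x : open U -> U x -> C1on U g ->
  C1on U (partial i g) -> C1on U (partial j g) ->
  partial i (partial j g) x = partial j (partial i g) x.
Proof.
move=> oU Ux Cg Cig Cjg.
pose d (h : R) := g (h *: e_ i + (h *: e_ j + x)) - g (h *: e_ j + x) - g (h *: e_ i + x) + g x.
apply: (@second_difference_limit U _ _ (e_ i) (e_ j) x d oU Ux
  ((Cjg _ Ux).2 i).2 ((Cig _ Ux).2 j).2) => h h0 HU.
  exact: (second_difference h0 HU oU Cg Cjg).
have [s [t [hs ht E]]] := second_difference h0 HU oU Cg Cig.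
exists s, t; split; [exact: hs|exact: ht|rewrite -E /d].
by rewrite addrCA; congr (_ + _); rewrite addrAC.
Qed.

(** * Integration of divergences *)

Section cutoff.
Variables (U S : set 'rV[R]_n) (oU : open U) (cS : closed S) (SU : S `<=` U).
Hypothesis U1 : forall x, U x -> `|x| <= 1.

Let notS_near x : ~ S x -> \forall y \near x, ~ S y.
Proof. by move=> xS; apply: open_nbhs_nbhs; split => //; exact: closed_openC. Qed.

Let restrict_in (F : 'rV[R]_n -> R) x : U x -> (F \_ U) x = F x.
Proof. by move=> Ux; rewrite patchE mem_set. Qed.

Let restrict_out (F : 'rV[R]_n -> R) x : (forall x, U x -> ~ S x -> F x = 0) -> ~ S x -> (F \_ U) x = 0.
Proof. by move=> FS xS; rewrite patchE; case: ifPn => // /set_mem Ux; exact: FS. Qed.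

(** Extension by zero: near a point of [S] nothing changes, and near any other
    point the extension vanishes because [S] is closed. *)
Lemma cutoff_continuous (F : 'rV[R]_n -> R) :
  (forall x, U x -> {for x, continuous F}) -> (forall x, U x -> ~ S x -> F x = 0) ->
  continuous (F \_ U).
Proof.
move=> cF FS x; have [Sx|xS] := pselect (S x).
  apply: (@near_continuous F); last by apply: cF; exact: SU.
  by apply: (open_near oU (SU Sx)) => y Uy; rewrite restrict_in.
apply: (@near_continuous (fun=> 0)); last exact: cts_cst.
by apply: filterS (notS_near xS) => y yS; rewrite restrict_out.
Qed.

Lemma restrict_far (F : 'rV[R]_n -> R) x : 1 < `|x| -> (F \_ U) x = 0.
Proof. by move=> x1; rewrite patchE; case: ifPn => // /set_mem/U1; rewrite leNgt x1. Qed.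

Lemma restrict_EFinE (F : 'rV[R]_n -> R) : (EFin \o F) \_ U = EFin \o (F \_ U).
Proof. by apply/funext => x; rewrite /= !patchE; case: ifP. Qed.

Lemma cutoff_integrable (F : 'rV[R]_n -> R) :
  (forall x, U x -> {for x, continuous F}) -> (forall x, U x -> ~ S x -> F x = 0) ->
  (lebesgue_rV R n).-integrable U (EFin \o F).
Proof.
move=> cF FS; apply/(integrable_mkcond _ (open_measurable_rV oU)).
rewrite restrict_EFinE; apply: (@Cc_integrable _ _ _ 1); first exact: cutoff_continuous.
by move=> x; exact: restrict_far.
Qed.

Lemma integral_cutoff_partial i (F : 'rV[R]_n -> R) :
  C1on U F -> (forall x, U x -> ~ S x -> F x = 0) ->
  (lebesgue_rV R n).-integrable U (EFin \o partial i F) /\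
  (\int[lebesgue_rV R n]_(x in U) (partial i F x)%:E = 0)%E.
Proof.
move=> CF FS.
have pS x : U x -> ~ S x -> partial i F x = 0.
  move=> Ux xS; rewrite -(partial_cst i 0 x); apply: near_eq_derive.
  near=> y; apply: FS; first by near: y; exact: open_nbhs_nbhs.
  by near: y; exact: notS_near.
split; first by apply: cutoff_integrable => // x Ux; exact: ((CF _ Ux).2 i).2.
have E : partial i (F \_ U) = (partial i F) \_ U.
  apply/funext => x; have [Sx|xS] := pselect (S x).
    rewrite restrict_in; last exact: SU.
    by apply: (eq_partial oU) (SU Sx) _ => y Uy; rewrite restrict_in.
  rewrite (restrict_out pS xS) -(partial_cst i 0 x); apply: near_eq_derive.
  by apply: filterS (notS_near xS) => y yS; rewrite restrict_out.
rewrite integral_mkcond -/(EFin \o partial i F) restrict_EFinE -E.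
apply: (@integral_partial_eq0 _ _ i _ 1).
- move=> x; have [Sx|xS] := pselect (S x).
    apply: (@near_eq_derivable _ _ _ F); last exact: ((CF _ (SU Sx)).2 i).1.
    by apply: (open_near oU (SU Sx)) => y Uy; rewrite restrict_in.
  apply: (@near_eq_derivable _ _ _ (fun=> 0)); last exact: derivable_cst.
  by apply: filterS (notS_near xS) => y yS; rewrite restrict_out.
- rewrite E; apply: cutoff_continuous => // x Ux; exact: ((CF _ Ux).2 i).2.
- by move=> x; exact: restrict_far.
Unshelve. all: by end_near. Qed.

(** The divergence theorem for a field that vanishes off a closed set [S] inside
    [U]: extended by zero it is C^1 on the whole space. *)
Lemma integral_cutoff_div (F : 'I_n -> 'rV[R]_n -> R) :
  (forall i, C1on U (F i)) -> (forall i x, U x -> ~ S x -> F i x = 0) ->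
  (lebesgue_rV R n).-integrable U (fun x => (\sum_i partial i (F i) x)%:E) /\
  (\int[lebesgue_rV R n]_(x in U) (\sum_i partial i (F i) x)%:E = 0)%E.
Proof.
move=> CF FS.
have mU := open_measurable_rV oU.
have H i := integral_cutoff_partial i (CF i) (FS i).
have I1 : (lebesgue_rV R n).-integrable U (fun x => (\sum_i (partial i (F i) x)%:E)%E).
  by apply: integrable_sum => // i _; exact: (H i).1.
have E : (fun x => (\sum_i partial i (F i) x)%:E) = (fun x => (\sum_i (partial i (F i) x)%:E)%E).
  by apply/funext => x; rewrite sumEFin.
rewrite E; split => //.
rewrite (@integral_sum _ _ _ (lebesgue_rV R n) U mU _ (fun i x => (partial i (F i) x)%:E)); last by move=> i; exact: (H i).1.
by rewrite big1// => i _; exact: (H i).2.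
Qed.

End cutoff.

(** The integral of a nonnegative function is a supremum over the simple functions
    below it, so it is monotone for arbitrary functions, [curlyA] among them. *)
Lemma ge0_le_integral_nomeas (U : set 'rV[R]_n) (F G : 'rV[R]_n -> \bar R) :
  (forall x, U x -> (0 <= F x)%E) -> (forall x, U x -> (F x <= G x)%E) ->
  (\int[lebesgue_rV R n]_(x in U) F x <= \int[lebesgue_rV R n]_(x in U) G x)%E.
Proof.
move=> F0 FG.
rewrite !ge0_integralE//; last by move=> x Ux; exact: le_trans (F0 _ Ux) (FG _ Ux).
apply: le_ereal_sup => _ [h /= hF <-]; exists h => // x.
apply: (le_trans (hF x)); rewrite !patchE; case: ifPn => // /set_mem; exact: FG.
Qed.

(** * Euclidean norm and balls *)

Lemma enorm_sq m k (M : 'M[R]_(m, k)) : enorm M ^+ 2 = \sum_i \sum_j M i j ^+ 2.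
Proof.
by rewrite sqr_sqrtr//; apply: sumr_ge0 => i _; apply: sumr_ge0 => j _; exact: sqr_ge0.
Qed.

Lemma enorm_ge0 m k (M : 'M[R]_(m, k)) : 0 <= enorm M.
Proof. exact: sqrtr_ge0. Qed.

Lemma enorm_entry m k (M : 'M[R]_(m, k)) (i : 'I_m) (j : 'I_k) : `|M i j| <= enorm M.
Proof.
rewrite -(ler_pXn2r (_ : (0 < 2)%N)) ?nnegrE ?enorm_ge0// enorm_sq real_normK ?num_real//.
rewrite (bigD1 i)//= (bigD1 j)//= -addrA lerDl addr_ge0//.
  by apply: sumr_ge0 => l _; exact: sqr_ge0.
by apply: sumr_ge0 => p _; apply: sumr_ge0 => l _; exact: sqr_ge0.
Qed.

Lemma enorm_rV_sq x : enorm x ^+ 2 = \sum_i x ord0 i ^+ 2.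
Proof. by rewrite enorm_sq big_ord1. Qed.

Lemma enorm_cV_sq (p : 'cV[R]_n) : enorm p ^+ 2 = \sum_i p i ord0 ^+ 2.
Proof. by rewrite enorm_sq; apply: eq_bigr => i _; rewrite big_ord1. Qed.

Lemma continuous_enorm_rV : continuous (@enorm R 1 n).
Proof.
move=> x; apply: cts_sqrt; apply: cts_sum => i _; apply: cts_sum => j _; apply: ctsX.
exact: coord_continuous.
Qed.

Lemma open_eball r : open (@eball R n r).
Proof.
have -> : @eball R n r = (@enorm R 1 n) @^-1` [set t | t < r] by [].
by apply: open_comp; [move=> x _; exact: continuous_enorm_rV|exact: open_lt].
Qed.

Lemma closed_ecball r : closed (@ecball R n r).
Proof.
have -> : @ecball R n r = (@enorm R 1 n) @^-1` [set t | t <= r] by [].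
by apply: closed_comp; [move=> x _; exact: continuous_enorm_rV|exact: closed_le].
Qed.

Lemma eball_norm x : eball 1 x -> `|x| <= 1.
Proof.
move=> x1; apply: ltW; rewrite rV_norm_lt//; apply/forallP => i.
exact: le_lt_trans (enorm_entry _ _ _) _.
Qed.

End calculus.

(** * Quadratic forms and the Hessian relative to the gradient *)

Section forms.
Context {R : realFieldType} {n : nat}.
Implicit Types (A P M : 'I_n -> 'I_n -> R) (x y z p : 'I_n -> R).

Definition bform A x y := \sum_i \sum_j A i j * x i * y j.

Definition dotf x y := \sum_i x i * y i.

Lemma dotfC x y : dotf x y = dotf y x.
Proof. by apply: eq_bigr => i _; rewrite mulrC. Qed.

Lemma dotf_ge0 x : 0 <= dotf x x.
Proof. by apply: sumr_ge0 => i _; rewrite -expr2 sqr_ge0. Qed.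

Lemma dotf_eq0 x : dotf x x = 0 -> forall i, x i = 0.
Proof.
move=> /eqP; rewrite psumr_eq0 => [/allP H i|i _]; last by rewrite -expr2 sqr_ge0.
by have := H i (mem_index_enum i); rewrite /= -expr2 sqrf_eq0 => /eqP.
Qed.

Lemma dotf_line x y (t : R) : dotf (fun i => x i + t * y i) (fun i => x i + t * y i) =
  dotf x x + 2 * t * dotf x y + t ^+ 2 * dotf y y.
Proof.
rewrite /dotf !mulr_sumr -!big_split/=; apply: eq_bigr => i _; ring.
Qed.

Lemma bform_line A x y (t : R) :
  bform A (fun i => x i + t * y i) (fun i => x i + t * y i) =
  bform A x x + t * (bform A x y + bform A y x) + t ^+ 2 * bform A y y.
Proof.
rewrite /bform mulrDr !mulr_sumr -!big_split/=; apply: eq_bigr => i _.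
rewrite !mulr_sumr -!big_split/=; apply: eq_bigr => j _; ring.
Qed.

Lemma bformC A x y : (forall i j, A i j = A j i) -> bform A x y = bform A y x.
Proof.
move=> sA; rewrite /bform exchange_big/=; apply: eq_bigr => i _; apply: eq_bigr => j _.
by rewrite sA mulrAC.
Qed.

Lemma bform_rank1 x y z : bform (fun k l => x k * x l) y z = dotf x y * dotf x z.
Proof.
rewrite /bform /dotf mulr_suml; apply: eq_bigr => i _; rewrite mulr_sumr.
apply: eq_bigr => j _; ring.
Qed.

Lemma bform_suml A (v : 'I_n -> R) M y :
  bform A (fun k => \sum_j v j * M j k) y = \sum_j v j * bform A (M j) y.
Proof.
rewrite /bform; under [RHS]eq_bigr do rewrite mulr_sumr.
rewrite [RHS]exchange_big/=; apply: eq_bigr => k _.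
under [RHS]eq_bigr do rewrite mulr_sumr.
rewrite [RHS]exchange_big/=; apply: eq_bigr => l _.
rewrite mulr_sumr mulr_suml; apply: eq_bigr => j _; ring.
Qed.

Lemma bform_sumr A (v : 'I_n -> R) M x :
  bform A x (fun k => \sum_j v j * M j k) = \sum_j v j * bform A x (M j).
Proof.
rewrite /bform; under [RHS]eq_bigr do rewrite mulr_sumr.
rewrite [RHS]exchange_big/=; apply: eq_bigr => k _.
under [RHS]eq_bigr do rewrite mulr_sumr.
rewrite [RHS]exchange_big/=; apply: eq_bigr => l _.
rewrite mulr_sumr; apply: eq_bigr => j _; ring.
Qed.

Definition single (i : 'I_n) : 'I_n -> R := fun k => (k == i)%:R.

Lemma sum_single (F : 'I_n -> R) i : \sum_k F k * single i k = F i.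
Proof.
rewrite (bigD1 i)//= /single eqxx mulr1 big1 ?addr0// => k /negPf ->.
by rewrite mulr0.
Qed.

Lemma bform_singlel A i y : bform A (single i) y = \sum_j A i j * y j.
Proof.
rewrite /bform exchange_big/=; apply: eq_bigr => j _.
rewrite -(sum_single (fun k => A k j * y j) i); apply: eq_bigr => k _; ring.
Qed.

Lemma bform_single A i j : bform A (single i) (single j) = A i j.
Proof. by rewrite bform_singlel sum_single. Qed.

Definition psd A := forall z, 0 <= bform A z z.

(** Otherwise the form is negative far out on the line through [single j] in the
    direction [single i]. *)
Lemma psd_diag0 A i j : (forall i j, A i j = A j i) -> psd A -> A i i = 0 -> A i j = 0.
Proof.
move=> sA pA Aii.
have H (t : R) : 0 <= A j j + 2 * t * A i j.
  have := pA (fun k => single j k + t * single i k).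
  rewrite bform_line !bform_single Aii (sA j i).
  by move/le_trans; apply; rewrite le_eqVlt; apply/orP; left; apply/eqP; ring.
apply/eqP; apply/negPn/negP => Aij0.
have := H (- (A j j + 1) / (2 * A i j)).
have -> : A j j + 2 * (- (A j j + 1) / (2 * A i j)) * A i j = -1 by field.
by rewrite oppr_ge0 ler10.
Qed.

(** Symmetric Gaussian elimination.  With the pivot [d = B i0 i0 > 0], subtracting
    [d^-1 (B i0) (B i0)^T] clears the row and the column of [i0], and the form
    stays nonnegative: its value at [z] is the minimum of the form [B] on the
    line [z + t * single i0]. *)
Lemma psd_decomposition A : (forall i j, A i j = A j i) -> psd A ->
  exists s : seq (R * ('I_n -> R)), all (fun c => 0 <= c.1) s /\
   forall i j, A i j = \sum_(c <- s) c.1 * c.2 i * c.2 j.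
Proof.
move=> sA pA.
(* Outside [l] the diagonal, hence by [psd_diag0] the whole row, is zero. *)
suff H (l : seq 'I_n) A' : (forall i j, A' i j = A' j i) -> psd A' ->
   (forall i, i \notin l -> A' i i = 0) ->
   exists s : seq (R * ('I_n -> R)), all (fun c => 0 <= c.1) s /\
   forall i j, A' i j = \sum_(c <- s) c.1 * c.2 i * c.2 j.
  by apply: (H (enum 'I_n)) => // i; rewrite mem_enum.
elim: l A' => [|i0 l IH] B sB pB Bl.
  exists [::]; split => // i j; rewrite big_nil; apply: psd_diag0 => //; exact: Bl.
have [B0|B0] := eqVneq (B i0 i0) 0.
  apply: IH => // i il; have [->//|ii0] := eqVneq i i0.
  by apply: Bl; rewrite inE negb_or ii0.
have Bp : 0 < B i0 i0 by rewrite lt0r B0 -(bform_single B) pB.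
pose d := B i0 i0.
pose B' i j := B i j - d^-1 * (B i0 i * B i0 j).
have sB' i j : B' i j = B' j i by rewrite /B' sB [B i0 i * _]mulrC.
have pB' : psd B'.
  move=> z; pose w := \sum_j B i0 j * z j.
  have E : bform B' z z = bform B z z - d^-1 * w ^+ 2.
    have -> : w ^+ 2 = bform (fun k l => B i0 k * B i0 l) z z.
      by rewrite bform_rank1.
    rewrite /bform mulr_sumr -sumrB; apply: eq_bigr => i _.
    by rewrite mulr_sumr -sumrB; apply: eq_bigr => j _; rewrite /B'; ring.
  have := pB (fun k => z k + (- (w / d)) * single i0 k).
  rewrite bform_line bform_single (bformC z (single i0) sB) bform_singlel -/w -/d.
  by rewrite E; move/le_trans; apply; rewrite le_eqVlt; apply/orP; left; apply/eqP; field.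
have Bl' i : i \notin l -> B' i i = 0.
  move=> il; rewrite /B'; have [->|ii0] := eqVneq i i0.
    by rewrite -/d mulrA mulVf// mul1r subrr.
  have Bii : B i i = 0 by apply: Bl; rewrite inE negb_or ii0.
  by rewrite Bii [B i0 i]sB (psd_diag0 (i:=i))// mulr0 mulr0 subr0.
have [s [s0 Es]] := IH B' sB' pB' Bl'.
exists ((d^-1, B i0) :: s); split; first by rewrite /= s0 invr_ge0 ltW.
by move=> i j; rewrite big_cons -Es /= /B'; ring.
Qed.

(** The sum is the trace of [A M P M^T].  For [A = v v^T] it is the value of the
    form [P] at [M^T v], and [A] is a nonnegative combination of such terms. *)
Lemma trace_psd_ge0 A P M : (forall i j, A i j = A j i) -> psd A -> psd P ->
  0 <= \sum_i \sum_j A i j * bform P (M j) (M i).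
Proof.
move=> sA pA pP; have [s [s0 Es]] := psd_decomposition sA pA.
have -> : \sum_i \sum_j A i j * bform P (M j) (M i) =
  \sum_(c <- s) c.1 * bform P (fun k => \sum_j c.2 j * M j k) (fun k => \sum_j c.2 j * M j k).
  under eq_bigr do under eq_bigr do rewrite Es mulr_suml.
  under eq_bigr do rewrite exchange_big.
  rewrite exchange_big/=; apply: eq_bigr => c _.
  rewrite bform_suml mulr_sumr exchange_big/=; apply: eq_bigr => j _.
  rewrite bform_sumr !mulr_sumr; apply: eq_bigr => i _; ring.
elim: s s0 {Es} => [|c s IH]; first by rewrite big_nil.
by rewrite big_cons => /= /andP[c0 /IH s0]; rewrite addr_ge0// mulr_ge0.
Qed.

Lemma ler_sum_const (F : 'I_n -> R) (B : R) : (forall i, `|F i| <= B) -> `|\sum_i F i| <= n%:R * B.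
Proof.
move=> H; rewrite (le_trans (ler_norm_sum _ _ _))//.
rewrite (le_trans (ler_sum _ (fun i _ => H i)))//.
by rewrite sumr_const card_ord mulr_natl.
Qed.

Section normal_form.
Variables (A al M : 'I_n -> 'I_n -> R) (p : 'I_n -> R) (lam : R).
Hypotheses (lam0 : 0 < lam) (sA : forall i j, A i j = A j i) (sal : forall i j, al i j = al j i).
Hypotheses (eA : forall z, lam * dotf z z <= bform A z z).
Hypotheses (eal : forall z, lam * dotf z z <= bform al z z).

Let P2 := dotf p p.
Let s k := \sum_l al k l * p l.
Let c2 := dotf s p.
Let q j := \sum_k M j k * s k.
(* The rows of [M] projected off [p]; [N = M] if [p = 0], as [0^-1 = 0]. *)
Let N i k := M i k - P2^-1 * dotf (M i) p * p k.
Let nu2 := \sum_i dotf (N i) (N i).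

Lemma c2E : c2 = bform al p p.
Proof.
rewrite /c2 /bform /dotf; apply: eq_bigr => i _; rewrite /s mulr_suml.
by apply: eq_bigr => j _; ring.
Qed.

Lemma dotf_proj z : dotf (fun k => z k - P2^-1 * dotf z p * p k) (fun k => z k - P2^-1 * dotf z p * p k)
  = dotf z z - P2^-1 * dotf z p ^+ 2.
Proof.
have -> : dotf (fun k => z k - P2^-1 * dotf z p * p k) (fun k => z k - P2^-1 * dotf z p * p k) =
  dotf (fun k => z k + (- (P2^-1 * dotf z p)) * p k) (fun k => z k + (- (P2^-1 * dotf z p)) * p k).
  by apply: eq_bigr => i _; ring.
rewrite dotf_line -/P2; have [->|P20] := eqVneq P2 0; last by field.
by rewrite invr0; ring.
Qed.

(** The right side is the minimum over [t] of the form [al] at [z + t p], the left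
    side is [lam] times the minimum over [t] of the squared length of [z + t p]. *)
Lemma projected_form_ge z :
  lam * (dotf z z - P2^-1 * dotf z p ^+ 2) <= bform al z z - c2^-1 * dotf s z ^+ 2.
Proof.
have szE : dotf s z = bform al z p.
  rewrite /bform /dotf; apply: eq_bigr => i _; rewrite /s mulr_suml.
  by apply: eq_bigr => j _; ring.
have [P20|P20] := eqVneq P2 0.
  have p0 := dotf_eq0 P20.
  have -> : dotf s z = 0.
    by rewrite szE /bform big1// => i _; rewrite big1// => j _; rewrite p0 mulr0.
  by rewrite P20 invr0 mul0r expr0n mulr0 !subr0.
have P2p : 0 < P2 by rewrite lt0r P20 dotf_ge0.
have c2p : 0 < c2 by rewrite c2E (lt_le_trans _ (eal p))// mulr_gt0.
pose t := - (dotf s z / c2).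
have -> : bform al z z - c2^-1 * dotf s z ^+ 2 =
  bform al (fun k => z k + t * p k) (fun k => z k + t * p k).
  rewrite bform_line (bformC p z sal) -szE -c2E /t.
  by field; rewrite gt_eqF.
apply: le_trans (eal _); rewrite ler_pM2l// dotf_line.
have -> : dotf z z + 2 * t * dotf z p + t ^+ 2 * dotf p p =
   dotf z z - P2^-1 * dotf z p ^+ 2 + P2 * (t + dotf z p / P2) ^+ 2.
  by rewrite -/P2; field.
by rewrite lerDl mulr_ge0 ?sqr_ge0// ltW.
Qed.

(** Let [P] be the form [al] minus [c2^-1 (s . z)^2].  The right side is the trace
    of [A M P M^T]; it decreases when [A] is replaced by [lam] times the identity
    ([trace_psd_ge0]), and then when [P] is replaced by [lam] times the
    projection off [p] ([projected_form_ge]). *)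
Lemma normal_deficit_le :
  lam ^+ 2 * nu2 <= \sum_i \sum_j A i j * bform al (M j) (M i) - c2^-1 * bform A q q.
Proof.
pose P k l := al k l - c2^-1 * (s k * s l).
have PE x y : bform P x y = bform al x y - c2^-1 * (dotf s x * dotf s y).
  rewrite -bform_rank1 /bform mulr_sumr -sumrB; apply: eq_bigr => i _.
  by rewrite mulr_sumr -sumrB; apply: eq_bigr => j _; rewrite /P; ring.
have Pge z : lam * (dotf z z - P2^-1 * dotf z p ^+ 2) <= bform P z z.
  by rewrite PE -expr2; exact: projected_form_ge.
have pP : psd P.
  move=> z; apply: le_trans (Pge z); rewrite -dotf_proj mulr_ge0 ?(ltW lam0)//.
  exact: dotf_ge0.
pose A' i j := A i j - lam * (i == j)%:R.
have sA' i j : A' i j = A' j i by rewrite /A' sA eq_sym.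
have A'E z : bform A' z z = bform A z z - lam * dotf z z.
  rewrite /bform /dotf mulr_sumr -sumrB; apply: eq_bigr => i _.
  rewrite /A'; under eq_bigr do rewrite mulrBl mulrBl.
  rewrite sumrB; congr (_ - _).
  rewrite (bigD1 i)//= eqxx mulr1 big1 ?addr0; first by ring.
  by move=> j /negPf; rewrite eq_sym => ->; rewrite mulr0 !mul0r.
have pA' : psd A' by move=> z; rewrite A'E subr_ge0.
have := trace_psd_ge0 M sA' pA' pP.
have -> : \sum_i \sum_j A' i j * bform P (M j) (M i) =
  \sum_i \sum_j A i j * bform P (M j) (M i) - lam * \sum_i bform P (M i) (M i).
  rewrite mulr_sumr -sumrB; apply: eq_bigr => i _.
  rewrite /A'; under eq_bigr do rewrite mulrBl.
  rewrite sumrB; congr (_ - _).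
  rewrite (bigD1 i)//= eqxx mulr1 big1 ?addr0; first by ring.
  by move=> j /negPf; rewrite eq_sym => ->; rewrite mulr0 !mul0r.
have -> : \sum_i \sum_j A i j * bform P (M j) (M i) =
  \sum_i \sum_j A i j * bform al (M j) (M i) - c2^-1 * bform A q q.
  rewrite /bform mulr_sumr -sumrB; apply: eq_bigr => i _.
  rewrite mulr_sumr -sumrB; apply: eq_bigr => j _.
  rewrite -/(bform P _ _) PE /bform.
  have qE m : dotf s (M m) = q m by rewrite dotfC.
  rewrite !qE; ring.
rewrite subr_ge0; apply: le_trans; rewrite expr2 -mulrA ler_pM2l// /nu2 mulr_sumr.
by apply: ler_sum => i _; rewrite dotf_proj.
Qed.

Hypothesis sM : forall i j, M i j = M j i.
Variables (Lam nu rP : R).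
Hypotheses (bA : forall i j, `|A i j| <= Lam) (nu0 : 0 <= nu) (nuE : nu ^+ 2 = nu2).
Hypotheses (rP0 : 0 <= rP) (rPE : rP ^+ 2 = P2).

Let T := \sum_i \sum_j A i j * M i j.
(* By definition [M = N + (M p) p^T / |p|^2], and [M p = N^T p + mu |p|^2 p] by
   symmetry.  Hence [M = E + mu p p^T], where [E] is bounded by [nu]. *)
Let mu := P2^-1 ^+ 2 * bform M p p.
Let Np i := \sum_k N k i * p k.
Let E i j := N i j + P2^-1 * (Np i * p j).
Let k : R := n%:R.

Lemma entry_le_norm (x : 'I_n -> R) (r : R) i : 0 <= r -> r ^+ 2 = dotf x x -> `|x i| <= r.
Proof.
move=> r0 rE; rewrite -(ler_pXn2r (_ : (0 < 2)%N)) ?nnegrE// rE real_normK ?num_real//.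
rewrite /dotf (bigD1 i)//= -expr2 lerDl; apply: sumr_ge0 => j _.
by rewrite -expr2 sqr_ge0.
Qed.

Let N_le i j : `|N i j| <= nu.
Proof.
rewrite -(ler_pXn2r (_ : (0 < 2)%N)) ?nnegrE// nuE real_normK ?num_real//.
rewrite /nu2 /dotf (bigD1 i)//= (bigD1 j)//= -expr2 -addrA lerDl addr_ge0//.
  by apply: sumr_ge0 => l _; rewrite -expr2 sqr_ge0.
by apply: sumr_ge0 => p' _; apply: sumr_ge0 => l _; rewrite -expr2 sqr_ge0.
Qed.

Let p_le i : `|p i| <= rP.
Proof. exact: entry_le_norm. Qed.

Let k0 : 0 <= k.
Proof. exact: ler0n. Qed.

Let Np_le i : `|Np i| <= k * (nu * rP).
Proof. by apply: ler_sum_const => j; rewrite normrM ler_pM. Qed.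

Let E_le i j : `|E i j| <= (1 + k) * nu.
Proof.
rewrite mulrDl mul1r (le_trans (ler_normD _ _))// lerD//.
have [P20|P20] := eqVneq P2 0; first by rewrite P20 invr0 mul0r normr0 mulr_ge0.
have P2p : 0 < P2 by rewrite lt0r P20 dotf_ge0.
rewrite normrM normrV ?unitfE// (ger0_norm (ltW P2p)) ler_pdivrMl// normrM.
rewrite (le_trans (ler_pM _ _ (Np_le i) (p_le j)))// -rPE.
by rewrite le_eqVlt; apply/orP; left; apply/eqP; ring.
Qed.

Let Mp_eq i : dotf (M i) p = Np i + mu * P2 * p i.
Proof.
have -> : mu * P2 * p i = P2^-1 * bform M p p * p i.
  rewrite /mu; have [P20|P20] := eqVneq P2 0; first by rewrite (dotf_eq0 P20) !mulr0.
  by field.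
rewrite /Np /N /dotf.
have -> : \sum_k0 (M k0 i - P2^-1 * (\sum_i0 M k0 i0 * p i0) * p i) * p k0 =
  \sum_k0 M k0 i * p k0 - P2^-1 * bform M p p * p i.
  rewrite /bform mulr_sumr mulr_suml -sumrB; apply: eq_bigr => l _.
  rewrite mulrBl; congr (_ - _).
  rewrite !mulr_sumr !mulr_suml; apply: eq_bigr => m _; ring.
by rewrite subrK; apply: eq_bigr => l _; rewrite sM.
Qed.

Let M_eq i j : M i j = E i j + mu * (p i * p j).
Proof.
have [P20|P20] := eqVneq P2 0.
  by rewrite /E /mu /N P20 invr0 !(dotf_eq0 P20); ring.
have -> : M i j = N i j + P2^-1 * dotf (M i) p * p j by rewrite /N subrK.
rewrite Mp_eq /E; move: (N i j) (Np i) => c d.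
have /divff H : P2 != 0 by [].
transitivity (c + P2^-1 * (d * p j) + (P2 / P2) * (mu * (p i * p j))); first by ring.
by rewrite H mul1r.
Qed.

Let T_eq : T = \sum_i \sum_j A i j * E i j + mu * bform A p p.
Proof.
rewrite /bform mulr_sumr -big_split/=; apply: eq_bigr => i _.
rewrite mulr_sumr -big_split/=; apply: eq_bigr => j _; rewrite M_eq; ring.
Qed.

Let AE_le : `|\sum_i \sum_j A i j * E i j| <= k ^+ 2 * Lam * ((1 + k) * nu).
Proof.
rewrite expr2 -!mulrA; apply: ler_sum_const => i; apply: ler_sum_const => j.
by rewrite normrM ler_pM.
Qed.

(** Ellipticity recovers the coefficient [mu] of [M = mu p p^T + E] from the trace
    of [A M], up to the trace of [A E]. *)
Lemma hess_entry_le i j :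
  `|M i j| <= (1 + k) * nu + lam^-1 * (`|T| + k ^+ 2 * Lam * ((1 + k) * nu)).
Proof.
rewrite M_eq (le_trans (ler_normD _ _))// lerD//.
rewrite ler_pdivlMl//.
have H : `|mu| * (lam * P2) <= `|T| + k ^+ 2 * Lam * ((1 + k) * nu).
  rewrite (le_trans (ler_wpM2l (normr_ge0 mu) (eA p)))//.
  have Ap0 : 0 <= bform A p p by rewrite (le_trans _ (eA p))// mulr_ge0 ?(ltW lam0) ?dotf_ge0.
  rewrite -[X in _ * X]ger0_norm// -normrM.
  have -> : mu * bform A p p = T - \sum_i \sum_j A i j * E i j by rewrite T_eq; ring.
  by rewrite (le_trans (ler_normB _ _))// lerD2l.
apply: le_trans H; rewrite normrM mulrCA ler_wpM2l// ler_pM2l// normrM -rPE expr2.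
by rewrite ler_pM.
Qed.

(** If [M = mu p p^T] then [M p = mu |p|^2 p] and [tr (A M) = mu (A p . p)], so the
    difference is zero; in general only [E] contributes. *)
Lemma hess_normal_le :
  `|bform A (fun i => dotf (M i) p) p - P2 * T| <=
  (k ^+ 3 * Lam + k ^+ 2 * Lam * (1 + k)) * nu * P2.
Proof.
have -> : bform A (fun i => dotf (M i) p) p - P2 * T =
  bform A Np p - P2 * \sum_i \sum_j A i j * E i j.
  rewrite T_eq.
  have -> : bform A (fun i => dotf (M i) p) p = bform A Np p + mu * P2 * bform A p p.
    rewrite /bform mulr_sumr -big_split/=; apply: eq_bigr => i _.
    rewrite mulr_sumr -big_split/=; apply: eq_bigr => j _; rewrite Mp_eq; ring.
  ring.
rewrite (le_trans (ler_normB _ _))// mulrDl mulrDl; apply: lerD.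
  have -> : k ^+ 3 * Lam * nu * P2 = k * (k * (Lam * (k * (nu * rP)) * rP)) by rewrite -rPE; ring.
  apply: ler_sum_const => i; apply: ler_sum_const => j.
  by rewrite normrM ler_pM// normrM ler_pM.
rewrite normrM ger0_norm ?dotf_ge0// mulrC.
rewrite ler_wpM2r ?dotf_ge0//.
by apply: (le_trans AE_le); rewrite le_eqVlt; apply/orP; left; apply/eqP; ring.
Qed.

End normal_form.

End forms.

(** * The stability inequality at one point *)

Section curvature_form.
Context {R : realFieldType} {n : nat}.
Implicit Types (A al M : 'I_n -> 'I_n -> R) (x p : 'I_n -> R).

Definition mulv M x i := \sum_j M i j * x j.

(** For symmetric [M] and [p <> 0] this is the expression under the root in
    [curlyA]; for [p = 0] the second term vanishes, as [0^-1 = 0]. *)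
Definition curv A al M p :=
  \sum_i \sum_j A i j * bform al (M j) (M i)
  - (dotf (mulv al p) p)^-1 * bform A (mulv M (mulv al p)) (mulv M (mulv al p)).

End curvature_form.

Section stability_algebra.
Context {R : realFieldType} {n : nat}.
Variables (A al M : 'I_n -> 'I_n -> R) (DA T3 : 'I_n -> 'I_n -> 'I_n -> R).
(* Values at one point: [p], [M], [T3] are the derivatives of u of order one, two
   and three, [DA k] and [Db k] the derivatives of the coefficients in direction
   [k], [e] the gradient of eta and [fp] the number f'(u).  [G] is the stability
   field without its factor eta^2, [dG i] the derivative of [G i] in direction
   [i], and [D] the divergence of [eta ^+ 2 * G]. *)
Variables (b p dphi e : 'I_n -> R) (Db ddphi : 'I_n -> 'I_n -> R) (fp phi eta : R).

Let s k := \sum_l al k l * p l.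
Let c2 := dotf s p.
Let q j := \sum_k M j k * s k.
Let psi j := dphi j / phi.
Let beta := \sum_k b k * p k.
Let ds i k := \sum_l al k l * M i l.
Let dbeta i := \sum_k (Db i k * p k + b k * M i k).
Let G i := \sum_j A i j * (q j - c2 * psi j) + s i * beta.
Let dG i := \sum_j (DA i i j * (q j - c2 * psi j) +
    A i j * (\sum_k (T3 i j k * s k + M j k * ds i k)
             - ((\sum_k (ds i k * p k + s k * M i k)) * psi j
                + c2 * (ddphi i j / phi - dphi i * dphi j / phi ^+ 2))))
  + (ds i i * beta + s i * dbeta i).
Let D := \sum_i (dG i * eta ^+ 2 + G i * (2 * eta * e i)).

Hypotheses (sA : forall i j, A i j = A j i) (sal : forall i j, al i j = al j i).
Hypotheses (sT3 : forall i j k, T3 k i j = T3 i j k).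
Hypotheses (phi0 : 0 < phi).
Hypothesis pde : forall k, fp * p k + \sum_i \sum_j (DA k i j * M i j + A i j * T3 k i j) + dbeta k = 0.
Hypothesis stab : fp * phi <= - (\sum_i \sum_j A i j * ddphi i j + \sum_i b i * dphi i).

Let S1 := \sum_i \sum_j DA i i j * q j.
Let S2 := \sum_i \sum_j DA i i j * psi j.
Let S3 := \sum_i \sum_j A i j * \sum_k T3 i j k * s k.
Let B4 i j := bform al (M j) (M i).
Let S4 := \sum_i \sum_j A i j * B4 i j.
Let S6 := \sum_i \sum_j A i j * ddphi i j.
Let S8 := \sum_i ds i i.
Let S9 := \sum_i s i * dbeta i.
Let S13 := \sum_k s k * \sum_i \sum_j DA k i j * M i j.

Let dc2E i : \sum_k (ds i k * p k + s k * M i k) = 2 * q i.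
Proof.
rewrite big_split/= mulr_natl mulr2n; congr (_ + _); last by apply: eq_bigr => k _; rewrite mulrC.
rewrite /ds; under eq_bigr do rewrite mulr_suml.
rewrite exchange_big/=; apply: eq_bigr => l _; rewrite /s mulr_sumr.
by apply: eq_bigr => k _; rewrite sal; ring.
Qed.

Let DE : D = eta ^+ 2 * S1 + (- (eta ^+ 2 * c2)) * S2 + eta ^+ 2 * S3 + eta ^+ 2 * S4
   + (- (2 * eta ^+ 2)) * bform A q psi + (- (eta ^+ 2 * c2 / phi)) * S6
   + (eta ^+ 2 * c2) * bform A psi psi + (eta ^+ 2 * beta) * S8 + eta ^+ 2 * S9
   + (2 * eta) * bform A e q + (- (2 * eta * c2)) * bform A e psi + (2 * eta * beta) * dotf s e.
Proof.
clearbody c2 beta.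
rewrite /D /S1 /S2 /S3 /S4 /S6 /S8 /S9 /bform /dotf !mulr_sumr -!big_split/=.
apply: eq_bigr => i _.
have -> : dG i = \sum_j DA i i j * q j + (- c2) * \sum_j DA i i j * psi j
   + \sum_j A i j * \sum_k T3 i j k * s k + \sum_j A i j * B4 i j
   + (- 2) * \sum_j A i j * q i * psi j + (- (c2 / phi)) * \sum_j A i j * ddphi i j
   + c2 * \sum_j A i j * psi i * psi j
   + (ds i i * beta + s i * dbeta i).
  rewrite /dG; congr (_ + _); rewrite !mulr_sumr -!big_split/=.
  apply: eq_bigr => j _; rewrite dc2E big_split/=.
  have -> : \sum_k M j k * ds i k = B4 i j.
    rewrite /B4 /bform; apply: eq_bigr => k _; rewrite /ds mulr_sumr.
    by apply: eq_bigr => l _; ring.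
  rewrite /psi; field; rewrite gt_eqF//.
have -> : G i = \sum_j A i j * q j + (- c2) * \sum_j A i j * psi j + s i * beta.
  rewrite /G; congr (_ + _); rewrite !mulr_sumr -!big_split/=.
  apply: eq_bigr => j _; ring.
have -> : \sum_j A i j * e i * q j = e i * \sum_j A i j * q j.
  by rewrite mulr_sumr; apply: eq_bigr => j _; ring.
have -> : \sum_j A i j * e i * psi j = e i * \sum_j A i j * psi j.
  by rewrite mulr_sumr; apply: eq_bigr => j _; ring.
move: (ds i i) (dbeta i) (s i) => d1 d2 d3.
ring.
Qed.

(* The equation differentiated in direction [k], times [s k], summed over [k]:
   it trades the third derivatives [S3] and the derivatives of b in [S9] for
   [fp * c2]. *)
Let pdeE : fp * c2 + S13 + S3 + S9 = 0.
Proof.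
transitivity (\sum_k s k * (fp * p k + \sum_i \sum_j (DA k i j * M i j + A i j * T3 k i j) + dbeta k)).
  rewrite /c2 /dotf mulr_sumr /S3 /S13 /S9.
  have -> : \sum_i \sum_j A i j * \sum_k T3 i j k * s k = \sum_k s k * \sum_i \sum_j A i j * T3 k i j.
    under eq_bigr do under eq_bigr do rewrite mulr_sumr.
    under eq_bigr do rewrite exchange_big/=.
    rewrite exchange_big/=; apply: eq_bigr => k _.
    rewrite mulr_sumr; apply: eq_bigr => i _; rewrite mulr_sumr; apply: eq_bigr => j _.
    by rewrite (sT3 i j k); ring.
  rewrite -!big_split/=; apply: eq_bigr => k _.
  under [in RHS]eq_bigr do rewrite big_split/=.
  rewrite big_split/=; ring.
by apply: big1 => k _; rewrite pde mulr0.
Qed.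

Hypothesis c20 : 0 <= c2.

(* The drift of the operator written in divergence form. *)
Let bh j := b j - \sum_i DA i i j.

Let bhE z : dotf bh z = dotf b z - \sum_i \sum_j DA i i j * z j.
Proof.
rewrite exchange_big/= /dotf -sumrB; apply: eq_bigr => j _.
by rewrite /bh mulrBl mulr_suml.
Qed.

(* Stability bounds [fp] by [- (S6 / phi + b . psi)], which removes the second
   derivatives of phi. *)
Let D_ge : eta ^+ 2 * (S1 + S4 - 2 * bform A q psi + c2 * bform A psi psi + c2 * dotf bh psi + S8 * beta - S13)
   + 2 * eta * (bform A e q - c2 * bform A e psi + dotf s e * beta) <= D.
Proof.
have H : fp <= - (S6 / phi + dotf b psi).
  have -> : S6 / phi + dotf b psi = (S6 + \sum_i b i * dphi i) / phi.
    rewrite mulrDl; congr (_ + _); rewrite /dotf mulr_suml.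
    by apply: eq_bigr => i _; rewrite mulrA.
  by rewrite -mulNr ler_pdivlMr.
rewrite -subr_ge0 DE bhE -/S2.
have -> : S9 = - (fp * c2 + S13 + S3) by apply/eqP; rewrite -addr_eq0 addrC pdeE.
have : 0 <= eta ^+ 2 * c2 * (- (S6 / phi + dotf b psi) - fp).
  by rewrite mulr_ge0 ?subr_ge0// mulr_ge0// sqr_ge0.
move/le_trans; apply; rewrite le_eqVlt; apply/orP; left; apply/eqP; ring.
Qed.

Variable lam : R.
Hypotheses (lam0 : 0 < lam) (eA : forall z, lam * dotf z z <= bform A z z).
Hypothesis q_eq0 : c2 = 0 -> forall i, q i = 0.

Lemma bform3 (x y z : 'I_n -> R) (a1 a2 a3 : R) :
  bform A (fun i => a1 * x i + a2 * y i + a3 * z i) (fun i => a1 * x i + a2 * y i + a3 * z i) =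
  a1 ^+ 2 * bform A x x + a2 ^+ 2 * bform A y y + a3 ^+ 2 * bform A z z
  + (2 * a1 * a2) * bform A y x + (2 * a1 * a3) * bform A z x + (2 * a2 * a3) * bform A z y.
Proof.
have H u v : (2 : R) * bform A u v = bform A u v + bform A v u.
  by rewrite [bform A v u]bformC// mulr_natl mulr2n.
have -> : 2 * a1 * a2 * bform A y x = a1 * a2 * bform A y x + a1 * a2 * bform A x y.
  by rewrite -mulrDr -H; ring.
have -> : 2 * a1 * a3 * bform A z x = a1 * a3 * bform A z x + a1 * a3 * bform A x z.
  by rewrite -mulrDr -H; ring.
have -> : 2 * a2 * a3 * bform A z y = a2 * a3 * bform A z y + a2 * a3 * bform A y z.
  by rewrite -mulrDr -H; ring.
rewrite /bform !mulr_sumr -!big_split/=; apply: eq_bigr => i _.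
rewrite !mulr_sumr -!big_split/=; apply: eq_bigr => j _; ring.
Qed.

(* The square is that of [r = c2 eta psi - eta q - c2 e] in the metric [A], divided
   by [c2].  The drift term is linear in [psi], hence in [r]; it is compensated by
   [lam |r|^2], at the price of [|bh|^2 / (4 lam)].  If [c2 = 0], then [q = 0]. *)
Let square_ge : - (c2^-1 * (eta ^+ 2 * bform A q q)) - 2 * eta * bform A e q - c2 * bform A e e
    + eta ^+ 2 * dotf bh q + eta * c2 * dotf bh e - c2 * eta ^+ 2 * dotf bh bh / (4 * lam)
  <= eta ^+ 2 * (c2 * bform A psi psi - 2 * bform A q psi + c2 * dotf bh psi)
     - 2 * eta * c2 * bform A e psi.
Proof.
have [c2z|c2n] := eqVneq c2 0.
  have q0 := q_eq0 c2z.
  have bq x y : (forall i, x i = 0) -> bform A x y = 0.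
    by move=> x0; rewrite /bform big1// => i _; rewrite big1// => j _; rewrite x0 mulr0 mul0r.
  rewrite c2z invr0 (bq q q q0) (bq q psi q0) (bformC e q sA) (bq q e q0).
  have -> : dotf bh q = 0 by rewrite /dotf big1// => i _; rewrite q0 mulr0.
  by rewrite le_eqVlt; apply/orP; left; apply/eqP; ring.
have c2p : 0 < c2 by rewrite lt0r c2n.
pose r i := (c2 * eta) * psi i + (- eta) * q i + (- c2) * e i.
have Er : dotf bh r = (c2 * eta) * dotf bh psi + (- eta) * dotf bh q + (- c2) * dotf bh e.
  by rewrite /dotf !mulr_sumr -!big_split/=; apply: eq_bigr => i _; rewrite /r; ring.
have H1 : lam * dotf r r <= bform A r r := eA r.
rewrite [bform A r r]bform3 in H1.
have H2 : 0 <= dotf (fun i => r i + (c2 * eta / (2 * lam)) * bh i) (fun i => r i + (c2 * eta / (2 * lam)) * bh i).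
  exact: dotf_ge0.
rewrite dotf_line (dotfC r) Er in H2.
rewrite -subr_ge0.
have H3 := mulr_ge0 (ltW lam0) H2.
have H4 := addr_ge0 H3 (eqbRL (subr_ge0 _ _) H1).
have := mulr_ge0 (ltW (eqbRL (invr_gt0 c2) c2p)) H4.
move/le_trans; apply; rewrite le_eqVlt; apply/orP; left; apply/eqP.
move: (bform A psi psi) (bform A q q) (bform A e e) (bform A q psi) (bform A e psi) (bform A e q) (dotf bh psi) (dotf bh q) (dotf bh e) (dotf bh bh) (dotf r r) => *.
field.
by rewrite c2n gt_eqF.
Qed.

(** On the left side no third derivative of u and no derivative of phi is left. *)
Lemma stability_pointwise_exact :
  eta ^+ 2 * (S4 - c2^-1 * bform A q q) - c2 * bform A e e
  + eta ^+ 2 * (S1 + S8 * beta - S13 + dotf bh q)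
  + eta * (2 * dotf s e * beta + c2 * dotf bh e) - c2 * eta ^+ 2 * dotf bh bh / (4 * lam) <= D.
Proof.
apply: le_trans D_ge; rewrite -subr_ge0.
have := square_ge; rewrite -subr_ge0.
move/le_trans; apply; rewrite le_eqVlt; apply/orP; left; apply/eqP; ring.
Qed.

Variables (Lam eps Mn r E : R).
Hypotheses (eps0 : 0 <= eps) (Mn0 : 0 <= Mn) (r0 : 0 <= r) (E0 : 0 <= E).
Hypotheses (bA : forall i j, `|A i j| <= Lam) (bal : forall i j, `|al i j| <= Lam).
Hypotheses (bDA : forall k i j, `|DA k i j| <= eps) (bb : forall i, `|b i| <= eps).
Hypotheses (bp : forall i, `|p i| <= r) (bM : forall i j, `|M i j| <= Mn).
Hypotheses (be : forall i, `|e i| <= E).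

Let k : R := n%:R.
Let k0 : 0 <= k. Proof. exact: ler0n. Qed.

Let mul_le (x y a c : R) : `|x| <= a -> `|y| <= c -> `|x * y| <= a * c.
Proof. by move=> xa yc; rewrite normrM ler_pM. Qed.

Let s_le i : `|s i| <= k * (Lam * r).
Proof. by apply: ler_sum_const => j; exact: mul_le. Qed.

Let q_le i : `|q i| <= k * (Mn * (k * (Lam * r))).
Proof. by apply: ler_sum_const => j; exact: mul_le. Qed.

Let beta_le : `|beta| <= k * (eps * r).
Proof. by apply: ler_sum_const => j; exact: mul_le. Qed.

Let bh_le i : `|bh i| <= (1 + k) * eps.
Proof.
rewrite mulrDl mul1r (le_trans (ler_normB _ _))// lerD//.
exact: ler_sum_const.
Qed.

Let S1_le : `|S1| <= k * (k * (eps * (k * (Mn * (k * (Lam * r)))))).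
Proof. by apply: ler_sum_const => i; apply: ler_sum_const => j; exact: mul_le. Qed.

Let S8_le : `|S8| <= k * (k * (Lam * Mn)).
Proof. by apply: ler_sum_const => i; apply: ler_sum_const => j; exact: mul_le. Qed.

Let S13_le : `|S13| <= k * (k * (Lam * r) * (k * (k * (eps * Mn)))).
Proof.
apply: ler_sum_const => i; apply: mul_le => //.
by apply: ler_sum_const => j; apply: ler_sum_const => l; exact: mul_le.
Qed.

Let bhq_le : `|dotf bh q| <= k * ((1 + k) * eps * (k * (Mn * (k * (Lam * r))))).
Proof. by apply: ler_sum_const => i; exact: mul_le. Qed.

Let bhe_le : `|dotf bh e| <= k * ((1 + k) * eps * E).
Proof. by apply: ler_sum_const => i; exact: mul_le. Qed.

Let bhbh_le : `|dotf bh bh| <= k * ((1 + k) * eps * ((1 + k) * eps)).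
Proof. by apply: ler_sum_const => i; exact: mul_le. Qed.

Let se_le : `|dotf s e| <= k * (k * (Lam * r) * E).
Proof. by apply: ler_sum_const => i; exact: mul_le. Qed.

Let c2_le : `|c2| <= k * (k * (Lam * r) * r).
Proof. by apply: ler_sum_const => i; exact: mul_le. Qed.

Definition stab_hess_C : R := 2 * k ^+ 4 * Lam + k ^+ 3 * Lam + k ^+ 3 * (1 + k) * Lam.
Definition stab_mixed_C : R := 2 * k ^+ 3 * Lam + k ^+ 3 * (1 + k) * Lam.
Definition stab_grad_C : R := k ^+ 3 * (1 + k) ^+ 2 * Lam / (4 * lam).

(** Every error term has a factor [DA], [b] or [bh]; those multiplied by second
    derivatives of [u] give [stab_hess_C], those with [eta * e] give
    [stab_mixed_C], and [bh] squared gives [stab_grad_C]. *)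
Lemma stability_pointwise :
  eta ^+ 2 * curv A al M p <=
  D + c2 * bform A e e + stab_hess_C * eps * (Mn * r * eta ^+ 2)
   + stab_mixed_C * eps * (r ^+ 2 * (`|eta| * E)) + stab_grad_C * eps ^+ 2 * (r ^+ 2 * eta ^+ 2).
Proof.
have H := stability_pointwise_exact.
have e1 : - (stab_hess_C * eps * Mn * r) <= S1 + S8 * beta - S13 + dotf bh q.
  have := mul_le S8_le beta_le.
  move: S1_le S13_le bhq_le.
  rewrite !ler_norml => /andP[h1 _] /andP[_ h2] /andP[h3 _] /andP[h4 _].
  rewrite /stab_hess_C; lra.
have e2 : - (stab_mixed_C * eps * (r ^+ 2 * (`|eta| * E))) <= eta * (2 * dotf s e * beta + c2 * dotf bh e).
  suff : `|eta * (2 * dotf s e * beta + c2 * dotf bh e)| <= stab_mixed_C * eps * (r ^+ 2 * (`|eta| * E)).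
    by rewrite ler_norml => /andP[].
  have -> : stab_mixed_C * eps * (r ^+ 2 * (`|eta| * E)) = `|eta| * (stab_mixed_C * eps * r ^+ 2 * E) by ring.
  rewrite normrM ler_wpM2l//.
  have -> : 2 * dotf s e * beta + c2 * dotf bh e = 2 * (dotf s e * beta) + c2 * dotf bh e by ring.
  rewrite (le_trans (ler_normD _ _))// normrM gtr0_norm//.
  have := mul_le se_le beta_le; have := mul_le c2_le bhe_le.
  rewrite /stab_mixed_C; lra.
have e3 : c2 * eta ^+ 2 * dotf bh bh / (4 * lam) <= stab_grad_C * eps ^+ 2 * (r ^+ 2 * eta ^+ 2).
  have -> : stab_grad_C * eps ^+ 2 * (r ^+ 2 * eta ^+ 2) =
    eta ^+ 2 * (k ^+ 3 * (1 + k) ^+ 2 * Lam * eps ^+ 2 * r ^+ 2) / (4 * lam).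
    by rewrite /stab_grad_C; ring.
  rewrite ler_pM2r ?invr_gt0 ?mulr_gt0//.
  have -> : c2 * eta ^+ 2 * dotf bh bh = eta ^+ 2 * (c2 * dotf bh bh) by ring.
  rewrite ler_wpM2l ?sqr_ge0//.
  have := mul_le c2_le bhbh_le.
  rewrite ler_norml => /andP[_ /le_trans]; apply.
  by rewrite le_eqVlt; apply/orP; left; apply/eqP; ring.
have e4 := ler_wpM2l (sqr_ge0 eta) e1.
have -> : curv A al M p = S4 - c2^-1 * bform A q q by [].
move: H e2 e3 e4.
set X1 := eta * _; set X2 := _ / (4 * lam).
lra.
Qed.

End stability_algebra.

Section stability_inequality.
Context {R : realFieldType} {n : nat}.
Variables (A al M : 'I_n -> 'I_n -> R) (DA T3 : 'I_n -> 'I_n -> 'I_n -> R).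
Variables (b p dphi e : 'I_n -> R) (Db ddphi : 'I_n -> 'I_n -> R) (fp phi eta : R).

Definition logder i := dphi i / phi.

Definition dlogder i j := ddphi i j / phi - dphi i * dphi j / phi ^+ 2.

(** The field behind testing the linearised equation with [c2 eta^2 / phi], up to
    the factor [eta ^+ 2].  The last term cancels the derivatives of [b] in the
    differentiated equation, on which no bound is assumed. *)
Definition stab_field i :=
  \sum_j A i j * (mulv M (mulv al p) j - dotf (mulv al p) p * logder j)
  + mulv al p i * dotf b p.

(** The formal derivative of [stab_field i] in direction [k]. *)
Definition stab_dfield k i :=
  \sum_j (DA k i j * (mulv M (mulv al p) j - dotf (mulv al p) p * logder j) +
    A i j * (\sum_l (T3 k j l * mulv al p l + M j l * mulv al (M k) l)
             - ((\sum_l (mulv al (M k) l * p l + mulv al p l * M k l)) * logder j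
                + dotf (mulv al p) p * dlogder k j)))
  + (mulv al (M k) i * dotf b p + mulv al p i * \sum_l (Db k l * p l + b l * M k l)).

Variables (lam Lam eps Mn r E : R).
Hypotheses (sA : forall i j, A i j = A j i) (sal : forall i j, al i j = al j i).
Hypotheses (sT3 : forall i j k, T3 k i j = T3 i j k) (phi0 : 0 < phi).
Hypothesis pde : forall k, fp * p k + \sum_i \sum_j (DA k i j * M i j + A i j * T3 k i j)
  + \sum_l (Db k l * p l + b l * M k l) = 0.
Hypothesis stab : fp * phi <= - (\sum_i \sum_j A i j * ddphi i j + \sum_i b i * dphi i).
Hypotheses (lam0 : 0 < lam) (eA : forall z, lam * dotf z z <= bform A z z).
Hypothesis eal : forall z, lam * dotf z z <= bform al z z.
Hypotheses (eps0 : 0 <= eps) (Mn0 : 0 <= Mn) (r0 : 0 <= r) (E0 : 0 <= E).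
Hypotheses (bA : forall i j, `|A i j| <= Lam) (bal : forall i j, `|al i j| <= Lam).
Hypotheses (bDA : forall k i j, `|DA k i j| <= eps) (bb : forall i, `|b i| <= eps).
Hypotheses (bp : forall i, `|p i| <= r) (bM : forall i j, `|M i j| <= Mn).
Hypotheses (be : forall i, `|e i| <= E).

Lemma stability_inequality :
  eta ^+ 2 * curv A al M p <=
  \sum_i (stab_dfield i i * eta ^+ 2 + stab_field i * (2 * eta * e i))
   + dotf (mulv al p) p * bform A e e
   + @stab_hess_C R n Lam * eps * (Mn * r * eta ^+ 2)
   + @stab_mixed_C R n Lam * eps * (r ^+ 2 * (`|eta| * E))
   + @stab_grad_C R n lam Lam * eps ^+ 2 * (r ^+ 2 * eta ^+ 2).
Proof.
have c2E : dotf (mulv al p) p = bform al p p by exact: c2E.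
have c20 : 0 <= dotf (mulv al p) p.
  by rewrite c2E (le_trans _ (eal p))// mulr_ge0 ?(ltW lam0)// dotf_ge0.
have q0 : dotf (mulv al p) p = 0 -> forall i, mulv M (mulv al p) i = 0.
  move=> c2z i; have P0 : dotf p p = 0.
    apply/eqP; rewrite eq_le dotf_ge0 andbT -(ler_pM2l lam0) mulr0 -c2z c2E; exact: eal.
  rewrite /mulv big1// => j _; rewrite big1 ?mulr0// => l _.
  by rewrite (dotf_eq0 P0) mulr0.
exact: (@stability_pointwise R n A al M DA T3 b p dphi e Db ddphi fp phi eta sA sal sT3 phi0 pde stab c20 lam lam0 eA q0 Lam eps Mn r E).
Qed.

End stability_inequality.

(** * Derivatives given by formulas *)

Lemma offdiag_le (R : realFieldType) (l L c1 c2 c3 : R) : 0 < l -> l <= c1 -> l <= c3 ->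
  c1 + 1 * (2 * c2) + c3 <= L * 2 -> c1 + -1 * (2 * c2) + c3 <= L * 2 -> `|c2| <= L.
Proof. by move=> *; rewrite ler_norml; apply/andP; split; lra. Qed.

Section hasC1.
Context {R : realType} {n : nat}.
Implicit Types (F H : 'rV[R]_n -> R) (dF dH : 'I_n -> 'rV[R]_n -> R).
Variables (U : set 'rV[R]_n) (oU : open U).

(** C^1 together with formulas for the partial derivatives, so that the
    derivative of a compound expression is found by composing rules. *)
Definition hasC1 F dF := C1on U F /\ forall i x, U x -> partial i F x = dF i x.

Lemma hasC1_base F : C1on U F -> hasC1 F (fun i => partial i F).
Proof. by []. Qed.

Lemma hasC1_eq F dF dH : hasC1 F dF -> (forall i x, U x -> dF i x = dH i x) -> hasC1 F dH.
Proof. by move=> [CF pF] E; split => // i x Ux; rewrite pF// E. Qed.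

Lemma hasC1_cst (c : R) : hasC1 (fun=> c) (fun _ _ => 0).
Proof. by split; [exact: C1on_cst|move=> i x Ux; rewrite partial_cst]. Qed.

Lemma hasC1_add F H dF dH : hasC1 F dF -> hasC1 H dH ->
  hasC1 (fun y => F y + H y) (fun i y => dF i y + dH i y).
Proof.
move=> [CF pF] [CH pH]; split; first exact: C1onD.
by move=> i x Ux; rewrite partialD ?pF ?pH//; [exact: ((CF _ Ux).2 i).1|exact: ((CH _ Ux).2 i).1].
Qed.

Lemma hasC1_opp F dF : hasC1 F dF -> hasC1 (fun y => - F y) (fun i y => - dF i y).
Proof.
move=> [CF pF]; split; first exact: C1onN.
by move=> i x Ux; rewrite partialN ?pF//; exact: ((CF _ Ux).2 i).1.
Qed.

Lemma hasC1_mul F H dF dH : hasC1 F dF -> hasC1 H dH ->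
  hasC1 (fun y => F y * H y) (fun i y => dF i y * H y + F y * dH i y).
Proof.
move=> [CF pF] [CH pH]; split; first exact: C1onM.
by move=> i x Ux; rewrite partialM ?pF ?pH//; [exact: ((CF _ Ux).2 i).1|exact: ((CH _ Ux).2 i).1].
Qed.

Lemma hasC1_scale (c : R) F dF : hasC1 F dF ->
  hasC1 (fun y => c * F y) (fun i y => c * dF i y).
Proof.
move=> HF; apply: (hasC1_eq (hasC1_mul (hasC1_cst c) HF)) => i x _.
by rewrite mul0r add0r.
Qed.

Lemma hasC1_sqr F dF : hasC1 F dF -> hasC1 (fun y => F y ^+ 2) (fun i y => 2 * F y * dF i y).
Proof.
move=> HF; have -> : (fun y => F y ^+ 2) = (fun y => F y * F y).
  by apply/funext => y; rewrite expr2.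
by apply: (hasC1_eq (hasC1_mul HF HF)) => i x _; ring.
Qed.

Lemma hasC1_sum (I : Type) (r : seq I) (F : I -> 'rV[R]_n -> R) (dF : I -> 'I_n -> 'rV[R]_n -> R) :
  (forall j, hasC1 (F j) (dF j)) ->
  hasC1 (fun y => \sum_(j <- r) F j y) (fun i y => \sum_(j <- r) dF j i y).
Proof.
move=> HF; split; first by apply: C1on_sum => // j _; exact: (HF j).1.
move=> i x Ux; rewrite (partial_sum oU _ _ Ux); last by move=> j _; exact: (HF j).1.
by apply: eq_bigr => j _; rewrite (HF j).2.
Qed.

Lemma hasC1_inv F dF : (forall x, U x -> F x != 0) -> hasC1 F dF ->
  hasC1 (fun y => (F y)^-1) (fun i y => - dF i y / F y ^+ 2).
Proof.
move=> F0 [CF pF]; split; first exact: C1onV.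
by move=> i x Ux; rewrite partialV ?pF ?F0//; exact: ((CF _ Ux).2 i).1.
Qed.

Lemma hasC1_comp (h : R -> R) F dF : (forall x, U x -> derivable h (F x) 1) ->
  (forall x, U x -> {for F x, continuous (derive1 h)}) -> hasC1 F dF ->
  hasC1 (fun y => h (F y)) (fun i y => derive1 h (F y) * dF i y).
Proof.
move=> dh ch [CF pF]; split; first exact: C1on_comp.
move=> i x Ux; rewrite /partial (chain_rule ((CF _ Ux).2 i).1 (dh _ Ux)).2.
by rewrite -pF.
Qed.

End hasC1.

(** * Bounds on the coefficients *)

Section setting.
Context {R : realType} {n : nat}.
Variables (lam Lam eps : R) (a : 'rV[R]_n -> 'M[R]_n) (b : 'rV[R]_n -> 'cV[R]_n).
Variables (f : R -> R) (u : 'rV[R]_n -> R).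
Hypothesis (lam0 : 0 < lam) (HS : stable_setting lam Lam eps a b f u).

Local Notation B := (@eball R n 1).
Local Notation oB := (@open_eball R n 1).

Lemma eball0 : B 0.
Proof.
rewrite /eball /= /enorm big1 ?sqrtr0// => i _; rewrite big1// => j _.
by rewrite mxE expr0n.
Qed.

Lemma eball_ecball x : B x -> ecball 1 x.
Proof. by rewrite /eball /ecball /=; exact: ltW. Qed.

(** The bound on [DA] is stated for the extension to the closed ball; inside the
    ball it is a bound on the derivatives themselves. *)
Lemma cball_ext_in (g : 'rV[R]_n -> R) x : B x -> {for x, continuous g} -> cball_ext g x = g x.
Proof.
move=> Bx cg; rewrite /cball_ext.
have -> : within B (nbhs x) = nbhs x.
  by apply: within_interior; apply: open_nbhs_nbhs; split => //; exact: open_eball.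
exact: cvg_lim.
Qed.

Lemma C1_a i j : C1on B (fun x => a x i j).
Proof. by have [/(_ 1%N)/(@Ck_C1on _ _ _ _ _ [::])H _ _] := smooth_a HS i j; exact: H. Qed.

Lemma C1_b i : C1on B (fun x => b x i ord0).
Proof. by have [/(_ 1%N)/(@Ck_C1on _ _ _ _ _ [::])H _ _] := smooth_b HS i; exact: H. Qed.

Lemma C1_u s : C1on B (partials s u).
Proof. by have [/(_ (size s).+1)/(@Ck_C1on _ _ _ _ _ s)H _ _] := smooth_u HS; exact: H. Qed.

Lemma C0norm_ge (g : 'rV[R]_n -> R) x : ecball 1 x -> ((g x)%:E <= C0norm g)%E.
Proof. by move=> Bx; apply: ereal_sup_ubound; exists x. Qed.

Lemma C0norm_ge0 (g : 'rV[R]_n -> R) : 0 <= g 0 -> (0 <= C0norm g)%E.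
Proof. by move=> g0; apply: le_trans (C0norm_ge _ (eball_ecball eball0)); rewrite lee_fin. Qed.

Let bound_a x : ecball 1 x -> dmx_norm a x <= eps.
Proof.
move=> Bx; rewrite -lee_fin; apply: le_trans (coef_bound HS).
apply: (le_trans (C0norm_ge (dmx_norm a) Bx)); rewrite leeDl// C0norm_ge0//.
exact: enorm_ge0.
Qed.

Let bound_b x : ecball 1 x -> enorm (b x) <= eps.
Proof.
move=> Bx; rewrite -lee_fin; apply: le_trans (coef_bound HS).
apply: (le_trans (C0norm_ge (fun x => enorm (b x)) Bx)); rewrite leeDr// C0norm_ge0//.
exact: sqrtr_ge0.
Qed.

Lemma coef_b_le x i : B x -> `|b x i ord0| <= eps.
Proof.
by move=> /eball_ecball Bx; apply: (le_trans _ (bound_b Bx)); exact: enorm_entry.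
Qed.

Lemma triple_entry_le (F : 'I_n -> 'I_n -> 'I_n -> R) k i j :
  `|F k i j| <= Num.sqrt (\sum_k \sum_i \sum_j F k i j ^+ 2).
Proof.
have sum0 : forall (I : Type) (r : seq I) (P : pred I) (G : I -> R),
    (forall i, 0 <= G i) -> 0 <= \sum_(i <- r | P i) G i.
  by move=> I r P G G0; apply: sumr_ge0.
rewrite -sqrtr_sqr ler_sqrt; last first.
  by do 3! (apply: (@sum0) => ?); exact: sqr_ge0.
rewrite (bigD1 k)//= (bigD1 i)//= (bigD1 j)//= -!addrA lerDl.
apply: addr_ge0; first by apply: (@sum0) => ?; exact: sqr_ge0.
apply: addr_ge0; first by do 2! (apply: (@sum0) => ?); exact: sqr_ge0.
by do 3! (apply: (@sum0) => ?); exact: sqr_ge0.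
Qed.

Lemma coef_Da_le x k i j : B x -> `|partial k (fun y => a y i j) x| <= eps.
Proof.
move=> Bx; apply: (le_trans _ (bound_a (eball_ecball Bx))).
rewrite -(cball_ext_in Bx ((C1_a i j Bx).2 k).2).
exact: (triple_entry_le (fun k i j => cball_ext (partial k (fun y => a y i j)) x)).
Qed.

Lemma quad_bform (A : 'M[R]_n) (p : 'cV[R]_n) :
  (p^T *m A *m p) ord0 ord0 = bform (fun i j => A i j) (fun i => p i ord0) (fun i => p i ord0).
Proof.
rewrite mxE /bform exchange_big/=; apply: eq_bigr => j _; rewrite mxE mulr_suml.
by apply: eq_bigr => i _; rewrite mxE; ring.
Qed.

Lemma elliptic_bounds x z : B x ->
  lam * dotf z z <= bform (fun i j => a x i j) z z <= Lam * dotf z z.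
Proof.
move=> Bx; have [z0|z0] := eqVneq (dotf z z) 0.
  rewrite z0 !mulr0 /bform big1 ?lexx// => i _; rewrite big1// => j _.
  by rewrite !(dotf_eq0 z0) mulr0.
have zp : 0 < dotf z z by rewrite lt0r z0 dotf_ge0.
pose r := Num.sqrt (dotf z z).
have rp : 0 < r by rewrite sqrtr_gt0.
have rE : r ^+ 2 = dotf z z by rewrite sqr_sqrtr// ltW.
pose p : 'cV[R]_n := \col_i (z i / r).
have p1 : enorm p = 1.
  rewrite /enorm -[RHS]sqrtr1; congr Num.sqrt.
  transitivity (dotf z z / r ^+ 2); last by rewrite rE divff.
  rewrite /dotf mulr_suml.
  by apply: eq_bigr => i _; rewrite big_ord1 mxE expr2; field; rewrite gt_eqF.
have := elliptic_a HS Bx p1; rewrite quad_bform.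
have -> : bform (fun i j => a x i j) (fun i => p i ord0) (fun i => p i ord0) =
   bform (fun i j => a x i j) z z / dotf z z.
  rewrite -rE /bform mulr_suml; apply: eq_bigr => i _; rewrite mulr_suml; apply: eq_bigr => j _.
  by rewrite !mxE; field; rewrite gt_eqF.
by rewrite ler_pdivlMr// ler_pdivrMr.
Qed.

Lemma coef_a_sym x i j : B x -> a x i j = a x j i.
Proof. by move=> /eball_ecball/(sym_a HS) H; rewrite -[in LHS]H mxE. Qed.

(** The form at a basis vector bounds the diagonal entries, and at the sum and the
    difference of two basis vectors the other ones. *)
Lemma coef_a_le x i j : B x -> `|a x i j| <= Lam.
Proof.
move=> Bx.
have Hi l : lam <= a x l l <= Lam.
  have := elliptic_bounds (single l) Bx; rewrite bform_single /dotf sum_single.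
  by rewrite /single eqxx !mulr1.
have [->|ij] := eqVneq i j.
  by have /andP[h1 h2] := Hi j; rewrite ger0_norm// (le_trans (ltW lam0)).
have Hq (t : R) : t ^+ 2 = 1 -> a x i i + t * (2 * a x i j) + a x j j <= Lam * 2.
  move=> t1; have /andP[_] := elliptic_bounds (fun k => single i k + t * single j k) Bx.
  rewrite bform_line !bform_single (coef_a_sym j i Bx) dotf_line /dotf !sum_single t1.
  rewrite /single !eqxx [j == i]eq_sym (negPf ij).
  by move=> h; rewrite -subr_ge0 (le_trans (eqbRL (subr_ge0 _ _) h))// le_eqVlt; apply/orP; left; apply/eqP => /=; ring.
have H1 := Hq 1 (expr1n _ _); have H2 := Hq (-1) (etrans (sqrrN 1) (expr1n _ _)).
have /andP[h1 h2] := Hi i; have /andP[h3 h4] := Hi j.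
exact: (offdiag_le lam0 h1 h3 H1 H2).
Qed.

End setting.

(** * The stability field *)

Section derivative_entries.
Context {R : realType} {n : nat}.
Implicit Types (v : 'rV[R]_n -> R) (x : 'rV[R]_n).

Definition Dv v x i : R := partial i v x.
Definition D2v v x i j : R := partial i (partial j v) x.
Definition D3v v x k i j : R := partial k (partial i (partial j v)) x.

End derivative_entries.

Section stability_field.
Context {R : realType} {n : nat}.
Variables (lam Lam eps : R) (a : 'rV[R]_n -> 'M[R]_n) (b : 'rV[R]_n -> 'cV[R]_n).
Variables (f : R -> R) (u : 'rV[R]_n -> R).
Hypothesis (lam0 : 0 < lam) (HS : stable_setting lam Lam eps a b f u).

Local Notation B := (@eball R n 1).
Local Notation oB := (@open_eball R n 1).

Definition coefA x : 'I_n -> 'I_n -> R := fun i j => a x i j.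
Definition dcoefA x k i j : R := partial k (fun y => a y i j) x.
Definition coefB x i : R := b x i ord0.
Definition dcoefB x k i : R := partial k (fun y => b y i ord0) x.

Lemma C1_p i : C1on B (partial i u).
Proof. exact: (C1_u HS [:: i]). Qed.

Lemma C1_M i j : C1on B (partial i (partial j u)).
Proof. exact: (C1_u HS [:: i; j]). Qed.

Lemma D2u_sym x i j : B x -> D2v u x i j = D2v u x j i.
Proof.
move=> Bx; exact: (partial_comm oB Bx (C1_u HS [::]) (C1_p i) (C1_p j)).
Qed.

Lemma D3u_sym x i j k : B x -> D3v u x k i j = D3v u x i j k.
Proof.
move=> Bx; rewrite /D3v.
apply: (etrans (partial_comm oB Bx (C1_p j) (C1_M k j) (C1_M i j))).
apply: (@eq_partial R n B oB _ _ _ x Bx) => y By.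
exact: (partial_comm oB By (C1_u HS [::]) (C1_p k) (C1_p j)).
Qed.

Lemma elliptic_opE x (v : 'rV[R]_n -> R) : elliptic_op a b v x =
  \sum_i \sum_j coefA x i j * partial i (partial j v) x + \sum_i coefB x i * partial i v x.
Proof.
rewrite /elliptic_op; congr (_ + _); apply: eq_bigr => i _.
  by apply: eq_bigr => j _; rewrite mxE.
by rewrite mxE.
Qed.

Let ha i j : hasC1 B (fun y => coefA y i j) (fun k y => dcoefA y k i j).
Proof. exact: hasC1_base (C1_a HS i j). Qed.

Let hb i : hasC1 B (fun y => coefB y i) (fun k y => dcoefB y k i).
Proof. exact: hasC1_base (C1_b HS i). Qed.

Let hp i : hasC1 B (fun y => Dv u y i) (fun k y => D2v u y k i).
Proof. exact: hasC1_base (C1_p i). Qed.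

Let hM i j : hasC1 B (fun y => D2v u y i j) (fun k y => D3v u y k i j).
Proof. exact: hasC1_base (C1_M i j). Qed.

Lemma pde_derivative x k : B x ->
  derive1 f (u x) * Dv u x k
  + \sum_i \sum_j (dcoefA x k i j * D2v u x i j + coefA x i j * D3v u x k i j)
  + \sum_l (dcoefB x k l * Dv u x l + coefB x l * D2v u x k l) = 0.
Proof.
move=> Bx; have [eqn _] := stable_u HS.
have [df cf] := C1_f HS.
have hL : hasC1 B (fun y => \sum_i \sum_j coefA y i j * D2v u y i j + \sum_l coefB y l * Dv u y l)
  (fun k x => \sum_i \sum_j (dcoefA x k i j * D2v u x i j + coefA x i j * D3v u x k i j)
  + \sum_l (dcoefB x k l * Dv u x l + coefB x l * D2v u x k l)).
  apply: (hasC1_add oB).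
    apply: (hasC1_sum oB) => i; apply: (hasC1_sum oB) => j.
    exact: (hasC1_mul oB (ha i j) (hM i j)).
  apply: (hasC1_sum oB) => l; exact: (hasC1_mul oB (hb l) (hp l)).
have hf : hasC1 B (fun y => f (u y)) (fun k y => derive1 f (u y) * Dv u y k).
  apply: (hasC1_comp oB (F := u) (h := f)).
  - by move=> y _; exact: df.
  - by move=> y _; exact: cf.
  - exact: hasC1_base (C1_u HS [::]).
have hs := hasC1_add oB hf hL.
rewrite -addrA -(hs.2 k x Bx); apply: etrans (partial_cst k 0 x).
apply: (@eq_partial R n B oB _ _ _ x Bx) => y By.
by rewrite -(eqn _ By) elliptic_opE; exact: addNr.
Qed.

Variables (phi eta : 'rV[R]_n -> R).
Hypotheses (Cphi : Ck 2 B phi) (phi0 : forall x, B x -> 0 < phi x).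
Hypothesis stab : forall x, B x -> derive1 f (u x) * phi x <= - elliptic_op a b phi x.
Hypothesis Ceta : C1on B eta.

Let hphi : hasC1 B phi (fun k => partial k phi).
Proof. exact: hasC1_base (Ck_C1on (s := [::]) Cphi _). Qed.

Let hdphi j : hasC1 B (partial j phi) (fun k => partial k (partial j phi)).
Proof. exact: hasC1_base (Ck_C1on (s := [:: j]) Cphi _). Qed.

Let heta : hasC1 B eta (fun k => partial k eta).
Proof. exact: hasC1_base. Qed.

Let al := coefA 0.

Let sof y := mulv al (Dv u y).

Let hs k : hasC1 B (fun y => sof y k) (fun i y => mulv al (D2v u y i) k).
Proof.
by apply: (hasC1_sum oB) => l; exact: (hasC1_scale oB (al k l) (hp l)).
Qed.

Let hq j : hasC1 B (fun y => mulv (D2v u y) (sof y) j)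
  (fun i y => \sum_l (D3v u y i j l * sof y l + D2v u y j l * mulv al (D2v u y i) l)).
Proof.
by apply: (hasC1_sum oB) => l; exact: (hasC1_mul oB (hM j l) (hs l)).
Qed.

Let hc2 : hasC1 B (fun y => dotf (sof y) (Dv u y))
  (fun i y => \sum_l (mulv al (D2v u y i) l * Dv u y l + sof y l * D2v u y i l)).
Proof.
by apply: (hasC1_sum oB) => l; exact: (hasC1_mul oB (hs l) (hp l)).
Qed.

Let hbeta : hasC1 B (fun y => dotf (coefB y) (Dv u y))
  (fun i y => \sum_l (dcoefB y i l * Dv u y l + coefB y l * D2v u y i l)).
Proof.
by apply: (hasC1_sum oB) => l; exact: (hasC1_mul oB (hb l) (hp l)).
Qed.

Let hpsi j : hasC1 B (fun y => logder (Dv phi y) (phi y) j)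
  (fun i y => dlogder (Dv phi y) (D2v phi y) (phi y) i j).
Proof.
apply: (hasC1_eq (hasC1_mul oB (hdphi j) (hasC1_inv oB _ hphi))).
  by move=> x /phi0; exact: lt0r_neq0.
move=> i x Bx; rewrite /dlogder /D2v /Dv; ring.
Qed.

Definition stab_vector i (y : 'rV[R]_n) : R :=
  stab_field (coefA y) al (D2v u y) (coefB y) (Dv u y) (Dv phi y) (phi y) i * eta y ^+ 2.

Lemma stab_vectorP i0 : hasC1 B (stab_vector i0) (fun i y =>
  stab_dfield (coefA y) al (D2v u y) (dcoefA y) (D3v u y) (coefB y) (Dv u y) (Dv phi y) (dcoefB y)
     (D2v phi y) (phi y) i i0 * eta y ^+ 2
  + stab_field (coefA y) al (D2v u y) (coefB y) (Dv u y) (Dv phi y) (phi y) i0 * (2 * eta y * Dv eta y i)).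
Proof.
apply: (hasC1_mul oB); last exact: (hasC1_sqr oB heta).
apply: (hasC1_add oB); last exact: (hasC1_mul oB (hs i0) hbeta).
apply: (hasC1_sum oB) => j; apply: (hasC1_mul oB (ha i0 j)).
apply: (hasC1_add oB (hq j)); apply: (hasC1_opp oB).
exact: (hasC1_mul oB hc2 (hpsi j)).
Qed.

Lemma grad_entry_le x i : `|Dv u x i| <= enorm (grad u x).
Proof. by have := enorm_entry (grad u x) i ord0; rewrite mxE. Qed.

Lemma hess_entry_enorm x i j : `|D2v u x i j| <= enorm (hess u x).
Proof. by have := enorm_entry (hess u x) i j; rewrite mxE. Qed.

(** The stability inequality along the solution. *)
Lemma stab_divergence x : B x ->
  eta x ^+ 2 * curv (coefA x) al (D2v u x) (Dv u x) <=
  \sum_i partial i (stab_vector i) x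
   + bform al (Dv u x) (Dv u x) * bform (coefA x) (Dv eta x) (Dv eta x)
   + @stab_hess_C R n Lam * eps * (enorm (hess u x) * enorm (grad u x) * eta x ^+ 2)
   + @stab_mixed_C R n Lam * eps * (enorm (grad u x) ^+ 2 * (`|eta x| * enorm (grad eta x)))
   + @stab_grad_C R n lam Lam * eps ^+ 2 * (enorm (grad u x) ^+ 2 * eta x ^+ 2).
Proof.
move=> Bx; have B0 := @eball0 R n.
have -> : \sum_i partial i (stab_vector i) x = \sum_i (
  stab_dfield (coefA x) al (D2v u x) (dcoefA x) (D3v u x) (coefB x) (Dv u x) (Dv phi x) (dcoefB x)
     (D2v phi x) (phi x) i i * eta x ^+ 2
  + stab_field (coefA x) al (D2v u x) (coefB x) (Dv u x) (Dv phi x) (phi x) i * (2 * eta x * Dv eta x i)).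
  by apply: eq_bigr => i _; exact: (stab_vectorP i).2.
have <- : dotf (mulv al (Dv u x)) (Dv u x) = bform al (Dv u x) (Dv u x) by exact: c2E.
apply: (@stability_inequality R n (coefA x) al (D2v u x) (dcoefA x) (D3v u x) (coefB x) (Dv u x)
   (Dv phi x) (Dv eta x) (dcoefB x) (D2v phi x) (derive1 f (u x)) (phi x) (eta x)).
- by move=> i j; exact: (coef_a_sym HS).
- by move=> i j; exact: (coef_a_sym HS).
- by move=> i j k; exact: D3u_sym.
- exact: phi0.
- by move=> k; exact: pde_derivative.
- by rewrite -elliptic_opE; exact: stab.
- exact: lam0.
- by move=> z; have /andP[] := elliptic_bounds HS z Bx.
- by move=> z; have /andP[] := elliptic_bounds HS z B0.
- by move=> i j; exact: (coef_a_le lam0 HS).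
- by move=> k i j; exact: (coef_Da_le HS).
- by move=> i; exact: (coef_b_le HS).
- by move=> i; exact: grad_entry_le.
- by move=> i j; exact: hess_entry_enorm.
- by move=> i; have := enorm_entry (grad eta x) i ord0; rewrite mxE.
Qed.

End stability_field.

(** * The curvature term *)

Section continuity.
Context {R : realType} {n : nat}.
Implicit Types (x : 'rV[R]_n).

Lemma cts_bform (A : 'rV[R]_n -> 'I_n -> 'I_n -> R) (v w : 'rV[R]_n -> 'I_n -> R) x :
  (forall i j, {for x, continuous (fun y => A y i j)}) ->
  (forall i, {for x, continuous (fun y => v y i)}) ->
  (forall i, {for x, continuous (fun y => w y i)}) ->
  {for x, continuous (fun y => bform (A y) (v y) (w y))}.
Proof.
move=> cA cv cw; apply: cts_sum => i _; apply: cts_sum => j _.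
exact: ctsM (ctsM (cA i j) (cv i)) (cw j).
Qed.

Lemma enorm_gradE (g : 'rV[R]_n -> R) y :
  enorm (grad g y) = Num.sqrt (\sum_i partial i g y ^+ 2).
Proof.
by rewrite /enorm; congr Num.sqrt; apply: eq_bigr => i _; rewrite big_ord1 mxE.
Qed.

Lemma enorm_hessE (g : 'rV[R]_n -> R) y :
  enorm (hess g y) = Num.sqrt (\sum_i \sum_j partial i (partial j g) y ^+ 2).
Proof.
by rewrite /enorm; congr Num.sqrt; apply: eq_bigr => i _; apply: eq_bigr => j _; rewrite mxE.
Qed.

Lemma cts_enorm_grad (g : 'rV[R]_n -> R) x :
  (forall i, {for x, continuous (partial i g)}) ->
  {for x, continuous (fun y => enorm (grad g y))}.
Proof.
move=> cg; have -> : (fun y => enorm (grad g y)) = (fun y => Num.sqrt (\sum_i partial i g y ^+ 2)).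
  by apply/funext => y; exact: enorm_gradE.
apply: cts_sqrt; apply: cts_sum => i _; exact: ctsX.
Qed.

Lemma cts_enorm_hess (g : 'rV[R]_n -> R) x :
  (forall i j, {for x, continuous (partial i (partial j g))}) ->
  {for x, continuous (fun y => enorm (hess g y))}.
Proof.
move=> cg; have -> : (fun y => enorm (hess g y)) =
    (fun y => Num.sqrt (\sum_i \sum_j partial i (partial j g) y ^+ 2)).
  by apply/funext => y; exact: enorm_hessE.
apply: cts_sqrt; apply: cts_sum => i _; apply: cts_sum => j _; exact: ctsX.
Qed.

Lemma anorm_sq (A : 'M[R]_n) (p : 'cV[R]_n) :
  0 <= bform (fun i j => A i j) (fun i => p i ord0) (fun i => p i ord0) ->
  anorm A p ^+ 2 = bform (fun i j => A i j) (fun i => p i ord0) (fun i => p i ord0).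
Proof. by move=> p0; rewrite /anorm quad_bform sqr_sqrtr. Qed.

Lemma bform_eq (A : 'I_n -> 'I_n -> R) v v' w w' : v =1 v' -> w =1 w' ->
  bform A v w = bform A v' w'.
Proof.
by move=> vE wE; apply: eq_bigr => i _; apply: eq_bigr => j _; rewrite vE wE.
Qed.

Lemma mulmx_mulv m (A : 'M[R]_n) (p : 'M[R]_(n, m)) i j :
  (A *m p) i j = mulv (fun i j => A i j) (fun k => p k j) i.
Proof. by rewrite mxE. Qed.

Lemma trace_bform (A H P : 'M[R]_n) : \tr (A *m H *m P *m H) =
  \sum_i \sum_j A i j * bform (fun k l => P k l) (fun k => H j k) (fun l => H l i).
Proof.
rewrite /mxtrace; apply: eq_bigr => i _; rewrite -!mulmxA mulmx_mulv.
apply: eq_bigr => j _; congr (_ * _); rewrite mulmx_mulv /mulv /bform.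
apply: eq_bigr => k _; rewrite mxE mulr_sumr; apply: eq_bigr => l _; ring.
Qed.

Lemma partial_off_support (g : 'rV[R]_n -> R) (S : set 'rV[R]_n) i x :
  closed S -> (forall y, ~ S y -> g y = 0) -> ~ S x -> partial i g x = 0.
Proof.
move=> cS gS xS; apply: etrans (partial_cst i 0 x).
apply: (@eq_partial R n (~` S) _ g (fun=> 0) i x xS); first exact: closed_openC.
exact: gS.
Qed.

End continuity.

Section curvature_estimate.
Context {R : realType} {n : nat}.
Variables (lam Lam eps : R) (a : 'rV[R]_n -> 'M[R]_n) (b : 'rV[R]_n -> 'cV[R]_n).
Variables (f : R -> R) (u : 'rV[R]_n -> R).
Hypothesis (lam0 : 0 < lam) (HS : stable_setting lam Lam eps a b f u).

Local Notation B := (@eball R n 1).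
Local Notation oB := (@open_eball R n 1).
Local Notation al := (coefA a 0).

Lemma bform_ge0 x z : B x -> 0 <= bform (coefA a x) z z.
Proof.
move=> Bx; have /andP[h _] := elliptic_bounds HS z Bx.
by apply: le_trans h; rewrite mulr_ge0 ?(ltW lam0)// dotf_ge0.
Qed.

Lemma anorm0_grad_sq x : anorm (a 0) (grad u x) ^+ 2 = bform al (Dv u x) (Dv u x).
Proof.
have E : bform (fun i j => a 0 i j) (fun i => grad u x i ord0) (fun i => grad u x i ord0) =
  bform al (Dv u x) (Dv u x) by apply: bform_eq => i; rewrite mxE.
by rewrite -E anorm_sq// E; exact: (bform_ge0 _ (@eball0 R n)).
Qed.

Lemma anorm_grad_sq (eta : 'rV[R]_n -> R) x : B x ->
  anorm (a x) (grad eta x) ^+ 2 = bform (coefA a x) (Dv eta x) (Dv eta x).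
Proof.
move=> Bx.
have E : bform (fun i j => a x i j) (fun i => grad eta x i ord0) (fun i => grad eta x i ord0) =
  bform (coefA a x) (Dv eta x) (Dv eta x) by apply: bform_eq => i; rewrite mxE.
by rewrite -E anorm_sq// E; exact: bform_ge0.
Qed.

(** The curvature term controls the part of the Hessian off the gradient. *)
Lemma normal_deficit x : B x ->
  lam ^+ 2 * (\sum_i dotf (fun k => D2v u x i k - (dotf (Dv u x) (Dv u x))^-1 * dotf (D2v u x i) (Dv u x) * Dv u x k)
     (fun k => D2v u x i k - (dotf (Dv u x) (Dv u x))^-1 * dotf (D2v u x i) (Dv u x) * Dv u x k))
  <= curv (coefA a x) al (D2v u x) (Dv u x).
Proof.
move=> Bx; have B0 := @eball0 R n.
apply: (normal_deficit_le (A := coefA a x) (al := al) (D2v u x) (Dv u x) lam0).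
- by move=> i j; exact: (coef_a_sym HS).
- by move=> i j; exact: (coef_a_sym HS).
- by move=> z; have /andP[] := elliptic_bounds HS z Bx.
- by move=> z; have /andP[] := elliptic_bounds HS z B0.
Qed.

Lemma curv_ge0 x : B x -> 0 <= curv (coefA a x) al (D2v u x) (Dv u x).
Proof.
move=> Bx; apply: le_trans (normal_deficit Bx).
by rewrite mulr_ge0 ?sqr_ge0//; apply: sumr_ge0 => i _; exact: dotf_ge0.
Qed.

(** Equality holds where the gradient does not vanish; where it vanishes, [curlyA]
    is zero and [curv] is nonnegative. *)
Lemma curlyA_sq_le x : B x ->
  curlyA a u x ^+ 2 <= curv (coefA a x) al (D2v u x) (Dv u x).
Proof.
move=> Bx; rewrite /curlyA; case: ifP => _.
  by rewrite expr0n/=; exact: curv_ge0.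
set Q := (X in Num.sqrt X).
have -> : Q = curv (coefA a x) al (D2v u x) (Dv u x).
  rewrite /Q /curv; congr (_ - _).
    rewrite trace_bform; apply: eq_bigr => i _; apply: eq_bigr => j _; congr (_ * _).
    apply: bform_eq => k; rewrite mxE; first by [].
    exact: (D2u_sym HS k i Bx).
  rewrite -exprVn -exprMn mulrC exprMn exprVn anorm0_grad_sq -/(coefA a).
  rewrite mulrC; congr (_^-1 * _); first by rewrite (c2E al).
  have E i : (hess u x *m a 0 *m grad u x) i ord0 = mulv (D2v u x) (mulv al (Dv u x)) i.
    rewrite -mulmxA mulmx_mulv; apply: eq_bigr => k _; rewrite mxE; congr (_ * _).
    by rewrite mulmx_mulv; apply: eq_bigr => l _; rewrite mxE.
  rewrite anorm_sq; first exact: bform_eq.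
  by rewrite (bform_eq _ E E); exact: bform_ge0.
by rewrite sqr_sqrtr//; exact: curv_ge0.
Qed.

Lemma grad_sq_dotf x : enorm (grad u x) ^+ 2 = dotf (Dv u x) (Dv u x).
Proof. by rewrite enorm_cV_sq; apply: eq_bigr => i _; rewrite mxE expr2. Qed.

Lemma grad_sq_le x : lam * enorm (grad u x) ^+ 2 <= bform al (Dv u x) (Dv u x).
Proof.
by rewrite grad_sq_dotf; have /andP[] := elliptic_bounds HS (Dv u x) (@eball0 R n).
Qed.

Lemma enorm_grad_of_sq (eta : 'rV[R]_n -> R) x : C1on B eta -> B x ->
  enorm (grad (fun y => eta y ^+ 2) x) = 2 * (`|eta x| * enorm (grad eta x)).
Proof.
move=> Ceta Bx; have h := hasC1_sqr oB (hasC1_base Ceta).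
rewrite !enorm_gradE.
have -> : \sum_i partial i (fun y => eta y ^+ 2) x ^+ 2 =
  (2 * eta x) ^+ 2 * \sum_i partial i eta x ^+ 2.
  by rewrite mulr_sumr; apply: eq_bigr => i _; rewrite (h.2 i x Bx) exprMn.
by rewrite sqrtrM ?sqr_ge0// sqrtr_sqr normrM gtr0_norm// mulrA.
Qed.

End curvature_estimate.

(** * Integration of the stability inequality *)

Section curvature_integral.
Context {R : realType} {n : nat}.
Variables (lam Lam eps : R) (a : 'rV[R]_n -> 'M[R]_n) (b : 'rV[R]_n -> 'cV[R]_n).
Variables (f : R -> R) (u : 'rV[R]_n -> R).
Hypothesis (lam0 : 0 < lam) (HS : stable_setting lam Lam eps a b f u).

Local Notation B := (@eball R n 1).
Local Notation oB := (@open_eball R n 1).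
Local Notation al := (coefA a 0).

Variables (S : set 'rV[R]_n) (eta : 'rV[R]_n -> R).
Hypotheses (cS : closed S) (SB : S `<=` B) (Ceta : C1on B eta).
Hypothesis eta0 : forall y, ~ S y -> eta y = 0.

(** The supersolution [phi] enters the estimates only through this field. *)
Lemma stab_vector_exists : exists X : 'I_n -> 'rV[R]_n -> R,
  [/\ forall i, C1on B (X i), forall i x, ~ S x -> X i x = 0 &
   forall x, B x -> eta x ^+ 2 * curv (coefA a x) al (D2v u x) (Dv u x) <=
  \sum_i partial i (X i) x
   + bform al (Dv u x) (Dv u x) * bform (coefA a x) (Dv eta x) (Dv eta x)
   + @stab_hess_C R n Lam * eps * (enorm (hess u x) * enorm (grad u x) * eta x ^+ 2)
   + @stab_mixed_C R n Lam * eps * (enorm (grad u x) ^+ 2 * (`|eta x| * enorm (grad eta x)))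
   + @stab_grad_C R n lam Lam * eps ^+ 2 * (enorm (grad u x) ^+ 2 * eta x ^+ 2)].
Proof.
have [_ [phi [Cphi _ stab phi0 _]]] := stable_u HS.
exists (stab_vector a b u phi eta); split.
- move=> i; exact: (stab_vectorP HS Cphi phi0 Ceta i).1.
- by move=> i x xS; rewrite /stab_vector eta0// expr0n mulr0.
- move=> x Bx; exact: (stab_divergence lam0 HS Cphi phi0 stab Ceta Bx).
Qed.

Lemma cts_a x i j : B x -> {for x, continuous (fun y => coefA a y i j)}.
Proof. by move=> Bx; exact: (C1_a HS i j Bx).1. Qed.

Lemma cts_p x i : B x -> {for x, continuous (fun y => Dv u y i)}.
Proof. by move=> Bx; exact: (C1_p HS i Bx).1. Qed.

Lemma cts_grad x : B x -> {for x, continuous (fun y => enorm (grad u y))}.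
Proof. by move=> Bx; apply: cts_enorm_grad => i; exact: (C1_p HS i Bx).1. Qed.

Lemma cts_hess x : B x -> {for x, continuous (fun y => enorm (hess u y))}.
Proof. by move=> Bx; apply: cts_enorm_hess => i j; exact: (C1_M HS i j Bx).1. Qed.

Lemma cts_eta x : B x -> {for x, continuous eta}.
Proof. by move=> Bx; exact: (Ceta Bx).1. Qed.

Lemma cts_grad_eta x : B x -> {for x, continuous (fun y => enorm (grad eta y))}.
Proof. by move=> Bx; apply: cts_enorm_grad => i; exact: ((Ceta Bx).2 i).2. Qed.

Lemma cts_energy x : B x -> {for x, continuous (fun y => bform al (Dv u y) (Dv u y))}.
Proof.
by move=> Bx; apply: cts_bform => [i j|i|i]; [exact: cts_cst|exact: cts_p|exact: cts_p].
Qed.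

Lemma cts_aeta x : B x -> {for x, continuous (fun y => bform (coefA a y) (Dv eta y) (Dv eta y))}.
Proof.
by move=> Bx; apply: cts_bform => [i j|i|i]; [exact: cts_a|exact: ((Ceta Bx).2 i).2|exact: ((Ceta Bx).2 i).2].
Qed.

Lemma grad_eta0 x i : ~ S x -> partial i eta x = 0.
Proof. by move=> xS; exact: (partial_off_support i cS eta0 xS). Qed.

Lemma enorm_grad_eta0 x : ~ S x -> enorm (grad eta x) = 0.
Proof.
move=> xS; rewrite enorm_gradE big1 ?sqrtr0// => i _.
by rewrite (grad_eta0 i xS) expr0n.
Qed.

Lemma aeta0 x : ~ S x -> bform (coefA a x) (Dv eta x) (Dv eta x) = 0.
Proof.
move=> xS; apply: big1 => i _; apply: big1 => j _.
by rewrite /Dv (grad_eta0 j xS) mulr0.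
Qed.

(** The division by [lam] turns [|grad u|^2] into [|grad u|_al^2]. *)
Definition curv_C : R := 1 + `|@stab_hess_C R n Lam| + `|@stab_mixed_C R n Lam| / lam + `|@stab_grad_C R n lam Lam| / lam.

Lemma curv_C_gt0 : 0 < curv_C.
Proof. by rewrite /curv_C -!addrA ltr_pwDl// !addr_ge0// divr_ge0// ltW. Qed.

Lemma weighted_le (c d P c2 : R) : 0 <= P -> lam * P <= c2 -> `|c| / lam <= d -> c * P <= d * c2.
Proof.
move=> P0 Pc cd.
have c20 : 0 <= c2 by apply: le_trans Pc; rewrite mulr_ge0 ?(ltW lam0).
apply: le_trans (ler_wpM2r c20 cd).
apply: (@le_trans _ _ (`|c| * P)); first by rewrite ler_wpM2r// ler_norm.
by rewrite -mulrA ler_wpM2l// ler_pdivlMl.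
Qed.

Lemma curvature_integral :
    (\int[lebesgue_rV R n]_(x in B)
        (curlyA a u x ^+ 2 * eta x ^+ 2)%:E
     <= \int[lebesgue_rV R n]_(x in B)
          (anorm (a 0%R) (grad u x) ^+ 2
           * (anorm (a x) (grad eta x) ^+ 2
              + curv_C * eps * enorm (grad (fun y => eta y ^+ 2) x)
              + curv_C * eps ^+ 2 * eta x ^+ 2))%:E
        + (curv_C * eps)%:E * \int[lebesgue_rV R n]_(x in B)
            (enorm (hess u x) * enorm (grad u x) * eta x ^+ 2)%:E)%E.
Proof.
have [X [CX XS HX]] := stab_vector_exists.
have mB := open_measurable_rV oB.
have e0 := eps_gt0 HS.
have [iD zD] := integral_cutoff_div oB cS SB (@eball_norm R n) CX (fun i x _ => XS i x).
pose E1 x := bform al (Dv u x) (Dv u x) * (bform (coefA a x) (Dv eta x) (Dv eta x)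
   + curv_C * eps * (2 * (`|eta x| * enorm (grad eta x))) + curv_C * eps ^+ 2 * eta x ^+ 2).
pose E2 x := enorm (hess u x) * enorm (grad u x) * eta x ^+ 2.
have iE1 : (lebesgue_rV R n).-integrable B (EFin \o E1).
  apply: (cutoff_integrable oB cS SB (@eball_norm R n)) => x Bx.
    apply: ctsM; first exact: cts_energy.
    apply: ctsD; first (apply: ctsD; first exact: cts_aeta).
      apply: ctsM; first exact: cts_cst.
      apply: ctsM; first exact: cts_cst.
      by apply: ctsM; [apply: cts_norm; exact: cts_eta|exact: cts_grad_eta].
    by apply: ctsM; [exact: cts_cst|apply: ctsX; exact: cts_eta].
  by move=> xS; rewrite /E1 aeta0// enorm_grad_eta0// eta0// expr0n !mulr0 !addr0 mulr0.
have iE2 : (lebesgue_rV R n).-integrable B (EFin \o E2).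
  apply: (cutoff_integrable oB cS SB (@eball_norm R n)) => x Bx.
    apply: ctsM; last by apply: ctsX; exact: cts_eta.
    by apply: ctsM; [exact: cts_hess|exact: cts_grad].
  by move=> xS; rewrite /E2 eta0// expr0n mulr0.
have iCE2 : (lebesgue_rV R n).-integrable B (fun x => (curv_C * eps)%:E * (E2 x)%:E)%E.
  exact: (integrableZl mB _ iE2).
have -> : (\int[lebesgue_rV R n]_(x in B)
          (anorm (a 0%R) (grad u x) ^+ 2
           * (anorm (a x) (grad eta x) ^+ 2
              + curv_C * eps * enorm (grad (fun y => eta y ^+ 2) x)
              + curv_C * eps ^+ 2 * eta x ^+ 2))%:E =
    \int[lebesgue_rV R n]_(x in B) (E1 x)%:E)%E.
  apply: eq_integral => x /set_mem Bx; congr (_%:E).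
  by rewrite /E1 (anorm0_grad_sq lam0 HS) (anorm_grad_sq lam0 HS _ Bx) (enorm_grad_of_sq Ceta Bx).
rewrite -(integralZl mB iE2).
have iS := integrableD mB iE1 iCE2.
rewrite -[leRHS]adde0 -zD -(integralD mB iE1 iCE2) -(integralD mB iS iD).
apply: ge0_le_integral_nomeas => x Bx.
  by rewrite lee_fin mulr_ge0// sqr_ge0.
rewrite -EFinM -!EFinD lee_fin.
have := HX x Bx.
have H1 : curlyA a u x ^+ 2 * eta x ^+ 2 <= eta x ^+ 2 * curv (coefA a x) al (D2v u x) (Dv u x).
  by rewrite mulrC ler_wpM2l ?sqr_ge0//; exact: (curlyA_sq_le lam0 HS Bx).
move/(le_trans H1) => {}H1; apply: (le_trans H1).
set P := enorm (grad u x); set c2 := bform al _ _; set D := \sum_i _.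
have Pc : lam * P ^+ 2 <= c2 by exact: (grad_sq_le HS).
have P0 : 0 <= P ^+ 2 by exact: sqr_ge0.
have eg : 0 <= enorm (grad eta x) by exact: enorm_ge0.
have cC := curv_C_gt0.
have h1 : @stab_hess_C R n Lam * eps * E2 x <= curv_C * eps * E2 x.
  apply: ler_wpM2r.
    by apply: mulr_ge0; [apply: mulr_ge0; exact: enorm_ge0|exact: sqr_ge0].
  apply: ler_wpM2r; first exact: ltW.
  apply: (le_trans (ler_norm _)); rewrite /curv_C addrC -!addrA.
  rewrite addrCA addrA addrC -addrA lerDl.
  by rewrite !addr_ge0 ?divr_ge0 ?(ltW lam0).
have h2 : @stab_mixed_C R n Lam * eps * (P ^+ 2 * (`|eta x| * enorm (grad eta x))) <=
   c2 * (curv_C * eps * (2 * (`|eta x| * enorm (grad eta x)))).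
  have -> : @stab_mixed_C R n Lam * eps * (P ^+ 2 * (`|eta x| * enorm (grad eta x))) =
    @stab_mixed_C R n Lam * P ^+ 2 * (eps * (`|eta x| * enorm (grad eta x))) by ring.
  have -> : c2 * (curv_C * eps * (2 * (`|eta x| * enorm (grad eta x)))) =
    (2 * curv_C * c2) * (eps * (`|eta x| * enorm (grad eta x))) by ring.
  rewrite ler_wpM2r ?mulr_ge0 ?(ltW e0)//; apply: weighted_le => //.
  have h3 : `|@stab_mixed_C R n Lam| / lam <= curv_C.
    rewrite /curv_C -!addrA [leRHS]addrA addrC -addrA lerDl !addr_ge0// divr_ge0// ltW//.
  by rewrite (le_trans h3)// ler_peMl ?(ltW cC)// ler1n.
have h3 : @stab_grad_C R n lam Lam * eps ^+ 2 * (P ^+ 2 * eta x ^+ 2) <=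
   c2 * (curv_C * eps ^+ 2 * eta x ^+ 2).
  have -> : @stab_grad_C R n lam Lam * eps ^+ 2 * (P ^+ 2 * eta x ^+ 2) =
    @stab_grad_C R n lam Lam * P ^+ 2 * (eps * eta x) ^+ 2 by ring.
  have -> : c2 * (curv_C * eps ^+ 2 * eta x ^+ 2) =
    (curv_C * c2) * (eps * eta x) ^+ 2 by ring.
  rewrite ler_wpM2r ?sqr_ge0//; apply: weighted_le => //.
  by rewrite /curv_C lerDr !addr_ge0// divr_ge0// ltW.
rewrite /E1 -/c2 -/(E2 x) !mulrDr; lra.
Qed.

End curvature_integral.

(** * The weighted flux of the gradient *)

Lemma sum_sum_const (R : realFieldType) n (c : R) :
  \sum_(i < n) \sum_(j < n) c = n%:R ^+ 2 * c.
Proof.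
have E (e : R) : \sum_(i < n) e = n%:R * e by rewrite sumr_const card_ord mulr_natl.
by rewrite !E mulrA.
Qed.

Section weighted_flux_algebra.
Context {R : realFieldType}.

(** Here [P] is the length of the gradient, [w] its regularisation, [T] the trace of
    [A D^2 u], [bA] the form [A (D^2 u) p . p] and [Dz] the divergence of the flux.
    Since [bA] is close to [P^2 T], the divergence contains [(P^2 / w + w) T], and
    [P^2 / w + w >= 2 P] because the difference is [(P - w)^2 / w].  The upper bound
    on [T] makes [|T|] equal to [- T] up to an error, which fixes the sign. *)
Lemma flux_bound (P w d T bA nu divp Ye k eps Lam K5 eta E Dz : R) :
  0 <= P -> 0 < w -> P <= w -> w <= P + d -> 0 <= nu -> 0 <= k -> 0 <= eps -> 0 <= Lam -> 0 <= K5 -> 0 <= E ->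
  `|bA - P ^+ 2 * T| <= K5 * nu * P ^+ 2 ->
  T <= k * eps * P -> `|divp| <= k ^+ 2 * eps * P ->
  `|Ye| <= k ^+ 2 * Lam * w * P * E ->
  Dz = eta ^+ 2 * (w^-1 * bA + w * divp + w * T) + 2 * eta * Ye ->
  2 * (P * `|T|) * eta ^+ 2 <= - Dz + K5 * nu * P * eta ^+ 2
   + (4 * k + k ^+ 2) * eps * (P ^+ 2 + d * P) * eta ^+ 2
   + 2 * k ^+ 2 * Lam * (P ^+ 2 + d * P) * (`|eta| * E).
Proof.
move=> P0 w0 Pw wd nu0 k0 e0 L0 K50 E0 HbA HT Hd HY DzE.
have Pw0 : 0 <= P / w by rewrite divr_ge0// ltW.
have Pw1 : P / w <= 1 by rewrite ler_pdivrMr// mul1r.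
have s1 : P ^+ 2 / w <= P by rewrite expr2 -mulrA ler_piMr.
have s10 : 0 <= P ^+ 2 / w by rewrite divr_ge0 ?sqr_ge0// ltW.
have s2 : 2 * P <= P ^+ 2 / w + w.
  rewrite -subr_ge0.
  have -> : P ^+ 2 / w + w - 2 * P = (P - w) ^+ 2 / w by field; rewrite gt_eqF.
  by rewrite divr_ge0 ?sqr_ge0// ltW.
have wP : w * P <= P ^+ 2 + d * P by rewrite expr2 -mulrDl ler_wpM2r.
have wP0 : 0 <= w * P by rewrite mulr_ge0// ltW.
have t1 : w^-1 * bA <= P ^+ 2 / w * T + K5 * nu * P.
  have : bA <= P ^+ 2 * T + K5 * nu * P ^+ 2.
    by rewrite -lerBlDl (le_trans (ler_norm _)).
  rewrite -(ler_pM2l (_ : 0 < w^-1)) ?invr_gt0// => /le_trans; apply.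
  have -> : w^-1 * (P ^+ 2 * T + K5 * nu * P ^+ 2) = P ^+ 2 / w * T + K5 * nu * (P ^+ 2 / w) by ring.
  by rewrite lerD2l ler_wpM2l// mulr_ge0.
have t2 : `|T| <= - T + 2 * (k * eps * P).
  have h : 0 <= k * eps * P by rewrite !mulr_ge0.
  by rewrite ler_norml; apply/andP; split; lra.
have t3 : (P ^+ 2 / w + w) * T <= - (2 * (P * `|T|)) + 4 * (k * eps * (w * P)).
  have h : 0 <= k * eps * P by rewrite !mulr_ge0.
  have q0 : 0 <= P ^+ 2 / w + w by rewrite addr_ge0// ltW.
  have h1 : (P ^+ 2 / w + w) * T <= (P ^+ 2 / w + w) * (2 * (k * eps * P) - `|T|).
    by rewrite ler_wpM2l//; lra.
  apply: (le_trans h1).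
  have h2 : (P ^+ 2 / w + w) * (k * eps * P) <= 2 * w * (k * eps * P).
    by rewrite ler_wpM2r//; lra.
  have h3 : 2 * P * `|T| <= (P ^+ 2 / w + w) * `|T| by rewrite ler_wpM2r.
  have -> : k * eps * (w * P) = w * (k * eps * P) by ring.
  have -> : (P ^+ 2 / w + w) * (2 * (k * eps * P) - `|T|) =
    2 * ((P ^+ 2 / w + w) * (k * eps * P)) - (P ^+ 2 / w + w) * `|T| by ring.
  lra.
have t4 : w * divp <= k ^+ 2 * eps * (w * P).
  have -> : k ^+ 2 * eps * (w * P) = w * (k ^+ 2 * eps * P) by ring.
  by rewrite ler_wpM2l ?(ltW w0)// (le_trans (ler_norm _)).
have t5 : w^-1 * bA + w * divp + w * T <=
   - (2 * (P * `|T|)) + K5 * nu * P + (4 * k + k ^+ 2) * eps * (P ^+ 2 + d * P).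
  have h : (4 * k + k ^+ 2) * eps * (w * P) <= (4 * k + k ^+ 2) * eps * (P ^+ 2 + d * P).
    by rewrite ler_wpM2l// mulr_ge0// addr_ge0 ?sqr_ge0// mulr_ge0.
  move: t1 t3 t4 h; rewrite mulrDl; lra.
have t6 : 2 * eta * Ye <= 2 * k ^+ 2 * Lam * (P ^+ 2 + d * P) * (`|eta| * E).
  have h : 2 * eta * Ye <= 2 * (`|eta| * `|Ye|).
    by rewrite -mulrA ler_pM2l// -normrM ler_norm.
  apply: (le_trans h).
  have -> : 2 * k ^+ 2 * Lam * (P ^+ 2 + d * P) * (`|eta| * E) =
    2 * (`|eta| * (k ^+ 2 * Lam * E * (P ^+ 2 + d * P))) by ring.
  rewrite ler_pM2l// ler_wpM2l// (le_trans HY)//.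
  have -> : k ^+ 2 * Lam * w * P * E = k ^+ 2 * Lam * E * (w * P) by ring.
  by rewrite ler_wpM2l// !mulr_ge0 ?sqr_ge0.
have t7 := ler_wpM2l (sqr_ge0 eta) t5.
rewrite DzE; move: t6 t7.
set Z1 := eta ^+ 2 * (w^-1 * bA + w * divp + w * T).
set Z2 := 2 * eta * Ye; set Z3 := 2 * k ^+ 2 * Lam * _ * _.
by move=> t6 t7; lra.
Qed.

End weighted_flux_algebra.

Section hasC1_sqrt.
Context {R : realType} {n : nat} (U : set 'rV[R]_n) (oU : open U).

Lemma hasC1_sqrt (F : 'rV[R]_n -> R) dF : (forall x, U x -> 0 < F x) -> hasC1 U F dF ->
  hasC1 U (fun y => Num.sqrt (F y)) (fun i y => dF i y / (2 * Num.sqrt (F y))).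
Proof.
move=> F0 [CF pF].
have sF x : U x -> derivable (@Num.sqrt R) (F x) 1 /\ derive1 (@Num.sqrt R) (F x) = (2 * Num.sqrt (F x))^-1.
  move=> /F0 h; have [d e] := is_derive1_sqrt h.
  by split; [exact: d|rewrite derive1E; exact: e].
have pE i x : U x -> partial i (fun y => Num.sqrt (F y)) x = (2 * Num.sqrt (F x))^-1 * partial i F x.
  move=> Ux; have [d e] := sF x Ux.
  by rewrite -e; exact: (chain_rule ((CF x Ux).2 i).1 d).2.
split; last by move=> i x Ux; rewrite pE// pF// mulrC.
apply: (C1onP oU (F' := fun i y => (2 * Num.sqrt (F y))^-1 * partial i F y)).
- by move=> x Ux; apply: cts_sqrt; exact: (CF x Ux).1.
- by move=> x i Ux; exact: (chain_rule ((CF x Ux).2 i).1 (sF x Ux).1).1.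
- by move=> x i Ux; exact: pE.
- move=> x i Ux; apply: ctsM; last exact: ((CF x Ux).2 i).2.
  apply: ctsV; first by rewrite mulf_neq0 ?gt_eqF ?sqrtr_gt0 ?F0.
  by apply: ctsM; [exact: cts_cst|apply: cts_sqrt; exact: (CF x Ux).1].
Qed.

End hasC1_sqrt.

Section weighted_flux.
Context {R : realType} {n : nat}.
Variables (lam Lam eps : R) (a : 'rV[R]_n -> 'M[R]_n) (b : 'rV[R]_n -> 'cV[R]_n).
Variables (f : R -> R) (u : 'rV[R]_n -> R).
Hypothesis (lam0 : 0 < lam) (HS : stable_setting lam Lam eps a b f u).
Hypothesis f0 : forall t, 0 <= f t.

Local Notation B := (@eball R n 1).
Local Notation oB := (@open_eball R n 1).
Local Notation al := (coefA a 0).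
Local Notation k := (n%:R : R).

Variables (eta : 'rV[R]_n -> R) (Ceta : C1on B eta) (d : R) (d0 : 0 < d).

(** The length of the gradient, regularised by [d > 0] so that it is C^1 where the
    gradient vanishes. *)
Definition reg_norm y : R := Num.sqrt (dotf (Dv u y) (Dv u y) + d ^+ 2).

Definition flux i y : R := reg_norm y * mulv (coefA a y) (Dv u y) i.

Definition flux_vector i (y : 'rV[R]_n) : R := flux i y * eta y ^+ 2.

Let hp i : hasC1 B (fun y => Dv u y i) (fun k y => D2v u y k i).
Proof. exact: hasC1_base (C1_p HS i). Qed.

Let reg_arg_gt0 y : 0 < dotf (Dv u y) (Dv u y) + d ^+ 2.
Proof. by rewrite ltr_wpDl ?dotf_ge0// exprn_gt0. Qed.

Let hw : hasC1 B reg_norm (fun i y => (reg_norm y)^-1 * dotf (D2v u y i) (Dv u y)).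
Proof.
have h1 : hasC1 B (fun y => dotf (Dv u y) (Dv u y))
    (fun i y => \sum_j (D2v u y i j * Dv u y j + Dv u y j * D2v u y i j)).
  by apply: (hasC1_sum oB) => j; exact: (hasC1_mul oB (hp j) (hp j)).
have h2 : hasC1 B (fun y => dotf (Dv u y) (Dv u y)) (fun i y => 2 * dotf (D2v u y i) (Dv u y)).
  apply: (hasC1_eq h1) => i x _.
  by rewrite /dotf mulr_sumr; apply: eq_bigr => j _; ring.
have hd : hasC1 B (fun y => dotf (Dv u y) (Dv u y) + d ^+ 2)
    (fun i y => 2 * dotf (D2v u y i) (Dv u y)).
  by apply: (hasC1_eq (hasC1_add oB h2 (hasC1_cst B (d ^+ 2)))) => i x _; rewrite addr0.
apply: (hasC1_eq (hasC1_sqrt oB (fun y _ => reg_arg_gt0 y) hd)) => i x _.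
have w0 : reg_norm x != 0 by rewrite gt_eqF// sqrtr_gt0.
by rewrite -/(reg_norm x); field.
Qed.

Let hap i : hasC1 B (fun y => mulv (coefA a y) (Dv u y) i)
  (fun k y => \sum_j (dcoefA a y k i j * Dv u y j + coefA a y i j * D2v u y k j)).
Proof.
apply: (hasC1_sum oB) => j; apply: (hasC1_mul oB _ (hp j)).
exact: hasC1_base (C1_a HS i j).
Qed.

Lemma flux_vectorP i0 : hasC1 B (flux_vector i0) (fun i y =>
  ((reg_norm y)^-1 * dotf (D2v u y i) (Dv u y) * mulv (coefA a y) (Dv u y) i0
   + reg_norm y * \sum_j (dcoefA a y i i0 j * Dv u y j + coefA a y i0 j * D2v u y i j)) * eta y ^+ 2
  + flux i0 y * (2 * eta y * Dv eta y i)).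
Proof.
apply: (hasC1_mul oB); last exact: (hasC1_sqr oB (hasC1_base Ceta)).
exact: (hasC1_mul oB hw (hap i0)).
Qed.

Definition trA y := \sum_i \sum_j coefA a y i j * D2v u y i j.

Lemma flux_divergence x : B x -> \sum_i partial i (flux_vector i) x =
  eta x ^+ 2 * ((reg_norm x)^-1 * bform (coefA a x) (fun i => dotf (D2v u x i) (Dv u x)) (Dv u x)
     + reg_norm x * (\sum_i \sum_j dcoefA a x i i j * Dv u x j) + reg_norm x * trA x)
  + 2 * eta x * \sum_i flux i x * Dv eta x i.
Proof.
move=> Bx; under eq_bigr do rewrite ((flux_vectorP _).2 _ x Bx).
rewrite /trA /bform !mulrDr !mulr_sumr -!big_split/=; apply: eq_bigr => i _.
rewrite big_split/=.
have -> : \sum_j coefA a x i j * dotf (D2v u x i) (Dv u x) * Dv u x j =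
  dotf (D2v u x i) (Dv u x) * mulv (coefA a x) (Dv u x) i.
  by rewrite /mulv mulr_sumr; apply: eq_bigr => j _; ring.
move: (dotf (D2v u x i) (Dv u x)) (mulv (coefA a x) (Dv u x) i) => z1 z2.
by ring.
Qed.

Definition normal_part x i j : R :=
  D2v u x i j - (dotf (Dv u x) (Dv u x))^-1 * dotf (D2v u x i) (Dv u x) * Dv u x j.

Definition normal_norm x : R := Num.sqrt (\sum_i dotf (normal_part x i) (normal_part x i)).

Lemma normal_norm_sq x : normal_norm x ^+ 2 = \sum_i dotf (normal_part x i) (normal_part x i).
Proof. by rewrite sqr_sqrtr//; apply: sumr_ge0 => i _; exact: dotf_ge0. Qed.

Lemma normal_norm_ge0 x : 0 <= normal_norm x. Proof. exact: sqrtr_ge0. Qed.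

Lemma normal_norm_le x : B x -> lam ^+ 2 * normal_norm x ^+ 2 <= curv (coefA a x) al (D2v u x) (Dv u x).
Proof. by move=> Bx; rewrite normal_norm_sq; exact: (normal_deficit lam0 HS Bx). Qed.

Definition flux_normal_C := k ^+ 3 * Lam + k ^+ 2 * Lam * (1 + k).

Lemma hess_le x : B x -> enorm (hess u x) <=
  k * ((1 + k) * normal_norm x + lam^-1 * (`|trA x| + k ^+ 2 * Lam * ((1 + k) * normal_norm x))).
Proof.
move=> Bx.
set bd := (1 + k) * normal_norm x + _.
have Hbd i j : `|D2v u x i j| <= bd.
  apply: (@hess_entry_le R n (coefA a x) (D2v u x) (Dv u x) lam lam0 _ _ Lam (normal_norm x) (enorm (grad u x))).
  - by move=> z; have /andP[] := elliptic_bounds HS z Bx.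
  - by move=> i' j'; exact: (D2u_sym HS).
  - by move=> i' j'; exact: (coef_a_le lam0 HS).
  - exact: normal_norm_ge0.
  - exact: normal_norm_sq.
  - exact: enorm_ge0.
  - exact: grad_sq_dotf.
case: (posnP n) => [n0|n0].
  rewrite enorm_hessE big1 ?sqrtr0; last by move=> i; case: i => m h; exfalso; rewrite n0 in h.
  by rewrite n0 mul0r.
have bd0 : 0 <= bd by exact: le_trans (Hbd (Ordinal n0) (Ordinal n0)).
rewrite -(ler_pXn2r (_ : (0 < 2)%N)) ?nnegrE ?enorm_ge0 ?mulr_ge0//.
rewrite enorm_sq exprMn.
rewrite -sum_sum_const.
apply: ler_sum => i _; apply: ler_sum => j _; rewrite mxE.
by rewrite -real_normK ?num_real// ler_pXn2r ?nnegrE//; exact: Hbd.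
Qed.

Lemma Lam_ge0 : 0 <= Lam \/ n = 0%N.
Proof.
case: (posnP n) => [n0|n0]; [by right|left].
apply: le_trans (normr_ge0 _) (coef_a_le lam0 HS (Ordinal n0) (Ordinal n0) (@eball0 R n)).
Qed.

Lemma reg_norm_bounds x : [/\ 0 < reg_norm x, enorm (grad u x) <= reg_norm x &
  reg_norm x <= enorm (grad u x) + d].
Proof.
have P0 := enorm_ge0 (grad u x).
have w0 : 0 < reg_norm x by rewrite sqrtr_gt0.
have wE : reg_norm x ^+ 2 = enorm (grad u x) ^+ 2 + d ^+ 2.
  by rewrite sqr_sqrtr ?(ltW (reg_arg_gt0 _))// grad_sq_dotf.
split => //.
  rewrite -(ler_pXn2r (_ : (0 < 2)%N)) ?nnegrE// ?(ltW w0)// wE lerDl sqr_ge0//.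
rewrite -(ler_pXn2r (_ : (0 < 2)%N)) ?nnegrE// ?(ltW w0) ?addr_ge0 ?(ltW d0)//.
rewrite wE sqrrD addrAC lerDl mulrn_wge0// mulr_ge0// ltW//.
Qed.

(** The sign of [f] enters here: [tr (A D^2 u) = - f(u) - b . grad u] is bounded
    above by a multiple of [eps |grad u|]. *)
Lemma flux_estimate x : B x ->
  2 * (enorm (grad u x) * `|trA x|) * eta x ^+ 2 <=
   - (\sum_i partial i (flux_vector i) x) + flux_normal_C * normal_norm x * enorm (grad u x) * eta x ^+ 2
   + (4 * k + k ^+ 2) * eps * (enorm (grad u x) ^+ 2 + d * enorm (grad u x)) * eta x ^+ 2
   + 2 * k ^+ 2 * Lam * (enorm (grad u x) ^+ 2 + d * enorm (grad u x)) * (`|eta x| * enorm (grad eta x)).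
Proof.
move=> Bx.
have P0 := enorm_ge0 (grad u x).
have [w0 Pw wd] := reg_norm_bounds x.
have k0 : 0 <= k by exact: ler0n.
have e0 := ltW (eps_gt0 HS).
have pP i : `|Dv u x i| <= enorm (grad u x) by exact: grad_entry_le.
have ml (y z c e : R) : `|y| <= c -> `|z| <= e -> `|y * z| <= c * e.
  by move=> yc ze; rewrite normrM ler_pM.
have bL i j : `|coefA a x i j| <= Lam by exact: (coef_a_le lam0 HS).
have [L0|n0] := Lam_ge0; last first.
  have e00 (F : 'I_n -> R) : \sum_i F i = 0.
    by apply: big1 => i; case: i => m h; exfalso; rewrite n0 in h.
  have g0 : enorm (grad u x) = 0 by rewrite enorm_gradE e00 sqrtr0.
  by rewrite g0 e00 expr0n /= !(mulr0, mul0r, addr0) oppr0.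
apply: (@flux_bound R (enorm (grad u x)) (reg_norm x) d (trA x)
  (bform (coefA a x) (fun i => dotf (D2v u x i) (Dv u x)) (Dv u x)) (normal_norm x)
  (\sum_i \sum_j dcoefA a x i i j * Dv u x j) (\sum_i flux i x * Dv eta x i) k eps Lam flux_normal_C (eta x)
  (enorm (grad eta x)) _) => //.
- exact: normal_norm_ge0.
- by rewrite addr_ge0// !mulr_ge0 ?exprn_ge0// addr_ge0.
- exact: enorm_ge0.
- rewrite grad_sq_dotf.
  apply: (@hess_normal_le R n (coefA a x) (D2v u x) (Dv u x) _ Lam (normal_norm x) (enorm (grad u x))).
  + by move=> i' j'; exact: (D2u_sym HS).
  + exact: bL.
  + exact: normal_norm_ge0.
  + exact: normal_norm_sq.
  + exact: enorm_ge0.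
  + exact: grad_sq_dotf.
- have [eqn _] := stable_u HS; have := eqn x Bx; rewrite elliptic_opE.
  rewrite -/(trA x) => Hf.
  have h : `|\sum_i coefB b x i * partial i u x| <= k * (eps * enorm (grad u x)).
    apply: ler_sum_const => i; apply: (@ml); first exact: (coef_b_le HS).
    exact: grad_entry_le.
  have := f0 (u x); rewrite -Hf oppr_ge0 => h2.
  have h3 : - (k * (eps * enorm (grad u x))) <= \sum_i coefB b x i * partial i u x.
    by move: h; rewrite ler_norml => /andP[].
  rewrite -mulrA; move: h2 h3; rewrite -/(trA x).
  move: (trA x) (\sum_i coefB b x i * partial i u x) => t1 t2 h2 h3.
  by rewrite -subr_ge0; have := addr_ge0 (eqbRL (subr_ge0 _ _) h2) (eqbRL (subr_ge0 _ _) h3); congr (0 <= _); ring.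
- rewrite expr2 -!mulrA; apply: ler_sum_const => i; apply: ler_sum_const => j.
  by apply: (@ml) => //; exact: (coef_Da_le HS).
- have -> : k ^+ 2 * Lam * reg_norm x * enorm (grad u x) * enorm (grad eta x) =
    k * (reg_norm x * (k * (Lam * enorm (grad u x))) * enorm (grad eta x)) by ring.
  apply: ler_sum_const => i; apply: (@ml); last first.
    by have := enorm_entry (grad eta x) i ord0; rewrite mxE.
  apply: (@ml); first by rewrite gtr0_norm.
  by apply: ler_sum_const => j; exact: ml.
- exact: flux_divergence.
Qed.

End weighted_flux.

(** * The integral of the Hessian *)

Section absorption_algebra.
Context {R : realFieldType}.

(** Combination of three estimates: [Hn] (the Hessian) by [aT] (the trace) and
    [nu] (its part off the gradient), the flux estimate for [aT], and the stability
    inequality for [nu].  The mixed term [nu P] is split by Young's inequality, so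
    that only [nu^2] remains. *)
Lemma absorption (P Hn nu aT curv il eps d E eta Dx Dz c2 Aee K1 K2 K5 K6 K7 C1 C2 C3 K11 : R) :
  0 <= P -> 0 <= Hn -> 0 <= nu -> 0 <= aT -> 0 <= il -> 0 <= eps -> eps <= 1 -> 0 <= d -> 0 <= E ->
  0 <= K1 -> 0 <= K6 -> 0 <= K7 -> 0 <= c2 -> 0 <= Aee ->
  Hn <= K1 * aT + K2 * nu ->
  2 * (P * aT) * eta ^+ 2 <= - Dz + K5 * nu * P * eta ^+ 2
    + K6 * eps * (P ^+ 2 + d * P) * eta ^+ 2 + K7 * (P ^+ 2 + d * P) * (`|eta| * E) ->
  eta ^+ 2 * curv <= Dx + c2 * Aee + C1 * eps * (Hn * P * eta ^+ 2)
    + C2 * eps * (P ^+ 2 * (`|eta| * E)) + C3 * eps ^+ 2 * (P ^+ 2 * eta ^+ 2) ->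
  nu ^+ 2 <= il * curv -> c2 <= K11 * P ^+ 2 -> Aee <= K11 * E ^+ 2 ->
  Hn * P * eta ^+ 2 <= (il * Dx - K1 / 2 * Dz) + il * `|C1| * eps * (Hn * P * eta ^+ 2)
   + ((K1 * K5 / 2 + K2) ^+ 2 + K1 / 2 * (K6 + K7) + il * (K11 ^+ 2 + `|C2| + `|C3|))
       * (P ^+ 2 * (eta ^+ 2 + `|eta| * E + E ^+ 2))
   + d * ((K1 / 2 * (K6 + K7)) * (P * (eta ^+ 2 + `|eta| * E + E ^+ 2))).
Proof.
move=> P0 Hn0 nu0 aT0 il0 e0 e1 d0 E0 K10 K60 K70 c20 A0 H1 H2 H3 H4 H5 H6.
pose y := eta ^+ 2; pose w := `|eta| * E.
have y0 : 0 <= y by exact: sqr_ge0.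
have w0 : 0 <= w by rewrite mulr_ge0.
rewrite -/y -/w in H2 H3 *; clearbody y w.
have E20 : 0 <= E ^+ 2 by exact: sqr_ge0.
have P20 : 0 <= P ^+ 2 by exact: sqr_ge0.
pose K8 := K1 * K5 / 2 + K2.
have Py0 : 0 <= P * y by rewrite mulr_ge0.
have s1 : Hn * P * y <= K1 * (P * aT * y) + K2 * nu * P * y.
  have -> : K1 * (P * aT * y) + K2 * nu * P * y = (K1 * aT + K2 * nu) * (P * y) by ring.
  by rewrite -mulrA ler_wpM2r.
pose Q := P ^+ 2 + d * P.
have Q0 : 0 <= Q by rewrite addr_ge0// mulr_ge0.
have s2 : K1 * (P * aT * y) <= K1 / 2 * (- Dz + K5 * nu * P * y + K6 * eps * Q * y + K7 * Q * w).
  have := ler_wpM2l (_ : 0 <= K1 / 2) H2; rewrite divr_ge0// => /(_ isT).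
  by congr (_ <= _); rewrite /Q; field.
have s3 : K8 * nu * P * y <= nu ^+ 2 * y + K8 ^+ 2 * (P ^+ 2 * y).
  rewrite -subr_ge0.
  have -> : nu ^+ 2 * y + K8 ^+ 2 * (P ^+ 2 * y) - K8 * nu * P * y =
     y * ((nu - K8 * P / 2) ^+ 2 + 3 * (K8 * P / 2) ^+ 2) by field.
  by rewrite mulr_ge0// addr_ge0 ?sqr_ge0// mulr_ge0// sqr_ge0.
have s4 : nu ^+ 2 * y <= il * (Dx + c2 * Aee + C1 * eps * (Hn * P * y) + C2 * eps * (P ^+ 2 * w)
      + C3 * eps ^+ 2 * (P ^+ 2 * y)).
  apply: (@le_trans _ _ (il * (y * curv))); last exact: ler_wpM2l H3.
  have -> : il * (y * curv) = il * curv * y by ring.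
  exact: ler_wpM2r.
have s5 : c2 * Aee <= K11 ^+ 2 * (P ^+ 2 * E ^+ 2).
  have -> : K11 ^+ 2 * (P ^+ 2 * E ^+ 2) = (K11 * P ^+ 2) * (K11 * E ^+ 2) by ring.
  exact: ler_pM.
have HPy : 0 <= Hn * P * y by rewrite mulr_ge0// mulr_ge0.
have s6 : C1 * eps * (Hn * P * y) <= `|C1| * eps * (Hn * P * y).
  by rewrite ler_wpM2r// ler_wpM2r// ler_norm.
have s7 : C2 * eps * (P ^+ 2 * w) <= `|C2| * (P ^+ 2 * w).
  rewrite ler_wpM2r ?mulr_ge0// (@le_trans _ _ (`|C2| * eps))//.
    by rewrite ler_wpM2r// ler_norm.
  by rewrite ler_piMr.
have e21 : eps ^+ 2 <= 1 by rewrite expr_le1.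
have s8 : C3 * eps ^+ 2 * (P ^+ 2 * y) <= `|C3| * (P ^+ 2 * y).
  rewrite ler_wpM2r ?mulr_ge0// (@le_trans _ _ (`|C3| * eps ^+ 2))//.
    by rewrite ler_wpM2r ?sqr_ge0// ler_norm.
  by rewrite ler_piMr.
have s9 := ler_wpM2l il0 s5; have s10 := ler_wpM2l il0 s6.
have s11 := ler_wpM2l il0 s7; have s12 := ler_wpM2l il0 s8.
have s13 : K6 * eps * Q * y <= K6 * Q * y.
  by rewrite ler_wpM2r// ler_wpM2r// ler_piMr.
pose Kd := K1 / 2 * (K6 + K7).
have K12 : 0 <= K1 / 2 by rewrite divr_ge0.
have s14 : K1 / 2 * (K6 * Q * y + K7 * Q * w) <= Kd * (Q * (y + w + E ^+ 2)).
  rewrite -subr_ge0.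
  have -> : Kd * (Q * (y + w + E ^+ 2)) - K1 / 2 * (K6 * Q * y + K7 * Q * w) =
    K1 / 2 * Q * (K6 * w + K6 * E ^+ 2 + K7 * y + K7 * E ^+ 2) by rewrite /Kd; ring.
  by rewrite !mulr_ge0// !addr_ge0// mulr_ge0.
have s15 : K8 ^+ 2 * (P ^+ 2 * y) <= K8 ^+ 2 * (P ^+ 2 * (y + w + E ^+ 2)).
  by rewrite ler_wpM2l ?sqr_ge0// ler_wpM2l// -addrA lerDl addr_ge0.
have s16 : il * (K11 ^+ 2 * (P ^+ 2 * E ^+ 2)) + il * (`|C2| * (P ^+ 2 * w)) + il * (`|C3| * (P ^+ 2 * y))
   <= il * (K11 ^+ 2 + `|C2| + `|C3|) * (P ^+ 2 * (y + w + E ^+ 2)).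
  rewrite -subr_ge0.
  have -> : il * (K11 ^+ 2 + `|C2| + `|C3|) * (P ^+ 2 * (y + w + E ^+ 2)) -
    (il * (K11 ^+ 2 * (P ^+ 2 * E ^+ 2)) + il * (`|C2| * (P ^+ 2 * w)) + il * (`|C3| * (P ^+ 2 * y))) =
    il * P ^+ 2 * (K11 ^+ 2 * (y + w) + `|C2| * (y + E ^+ 2) + `|C3| * (w + E ^+ 2)) by ring.
  by rewrite !mulr_ge0// !addr_ge0// mulr_ge0 ?sqr_ge0// addr_ge0.
rewrite -/K8.
have s17 := ler_wpM2l K12 s13.
have s18 : Kd * (Q * (y + w + E ^+ 2)) = Kd * (P ^+ 2 * (y + w + E ^+ 2)) + d * (Kd * (P * (y + w + E ^+ 2))).
  by rewrite /Q; ring.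
rewrite -/Kd; move: s1 s2 s3 s4 s9 s10 s11 s12 s14 s15 s16 s17; rewrite s18 /K8.
set V := y + w + E ^+ 2.
rewrite !(mulrDl, mulrDr) ?mulrN.
lra.
Qed.

End absorption_algebra.

Section hessian_integral.
Context {R : realType} {n : nat}.
Variables (lam Lam eps : R) (a : 'rV[R]_n -> 'M[R]_n) (b : 'rV[R]_n -> 'cV[R]_n).
Variables (f : R -> R) (u : 'rV[R]_n -> R).
Hypotheses (n0 : (0 < n)%N) (lam0 : 0 < lam) (HS : stable_setting lam Lam eps a b f u).
Hypothesis f0 : forall t, 0 <= f t.

Local Notation B := (@eball R n 1).
Local Notation oB := (@open_eball R n 1).
Local Notation al := (coefA a 0).
Local Notation k := (n%:R : R).

Variables (S : set 'rV[R]_n) (eta : 'rV[R]_n -> R).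
Hypotheses (cS : closed S) (SB : S `<=` B) (Ceta : C1on B eta).
Hypothesis eta0 : forall y, ~ S y -> eta y = 0.

Definition hess_trace_C : R := k / lam.
Definition hess_normal_C : R := k * (1 + k) + k / lam * (k ^+ 2 * Lam * (1 + k)).
Definition flux_C : R := (4 * k + k ^+ 2) + 2 * k ^+ 2 * Lam.
Definition hess_C : R := (hess_trace_C * @flux_normal_C R n Lam / 2 + hess_normal_C) ^+ 2 + hess_trace_C / 2 * flux_C
  + lam ^- 2 * ((k ^+ 2 * Lam) ^+ 2 + `|@stab_mixed_C R n Lam| + `|@stab_grad_C R n lam Lam|).
Definition reg_C : R := hess_trace_C / 2 * flux_C.
(** Such that the error [lam ^- 2 * stab_hess_C * eps] of the stability inequality
    is at most one half, and [eps <= 1]. *)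
Definition hess_eps0 : R := Num.min 1 (2 * (lam ^- 2 * `|@stab_hess_C R n Lam| + 1))^-1.

Lemma hess_eps0_gt0 : 0 < hess_eps0.
Proof.
rewrite lt_min ltr01 invr_gt0 mulr_gt0// ltr_wpDl// mulr_ge0// invr_ge0 exprn_ge0//.
exact: ltW.
Qed.

Hypothesis eps_le : eps <= hess_eps0.

(** A common bound for the weights that multiply [|grad u|^2]. *)
Definition zeta x : R := eta x ^+ 2 + `|eta x| * enorm (grad eta x) + enorm (grad eta x) ^+ 2.

Lemma zeta_ge0 x : 0 <= zeta x.
Proof. by rewrite !addr_ge0 ?sqr_ge0// mulr_ge0 ?enorm_ge0. Qed.

Lemma zeta_out x : ~ S x -> zeta x = 0.
Proof.
move=> xS; rewrite /zeta (eta0 xS) (enorm_grad_eta0 cS eta0 xS).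
by rewrite expr0n normr0 mul0r !addr0.
Qed.

Lemma cts_zeta x : B x -> {for x, continuous zeta}.
Proof.
move=> Bx; have c1 := cts_eta Ceta Bx; have c2 := cts_grad_eta Ceta Bx.
apply: ctsD; last exact: ctsX.
by apply: ctsD; [exact: ctsX|apply: ctsM => //; exact: cts_norm].
Qed.

Let L0 : 0 <= Lam.
Proof. by have [//|h] := Lam_ge0 lam0 HS; move: n0; rewrite h. Qed.

Let k0 : 0 <= k. Proof. exact: ler0n. Qed.

Lemma reg_C_ge0 : 0 <= reg_C.
Proof.
rewrite /reg_C /flux_C /hess_trace_C !mulr_ge0 ?invr_ge0 ?(ltW lam0)//.
by rewrite !addr_ge0 ?mulr_ge0 ?exprn_ge0.
Qed.

Lemma bform_le (A : 'I_n -> 'I_n -> R) (v : 'I_n -> R) (r : R) :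
  (forall i j, `|A i j| <= Lam) -> (forall i, `|v i| <= r) -> bform A v v <= k ^+ 2 * Lam * r ^+ 2.
Proof.
move=> bA bv; apply: (le_trans (ler_norm _)).
have -> : k ^+ 2 * Lam * r ^+ 2 = k * (k * (Lam * r * r)) by ring.
apply: ler_sum_const => i; apply: ler_sum_const => j; rewrite !normrM.
by rewrite ler_pM ?mulr_ge0// ler_pM.
Qed.

Let F x := enorm (hess u x) * enorm (grad u x) * eta x ^+ 2.
Let G x := enorm (grad u x) ^+ 2 * zeta x.
Let G1 x := enorm (grad u x) * zeta x.

(** The term with [eps |D^2 u|] on the right of [absorption] is absorbed in the left
    side, which doubles the other constants. *)
Lemma hessian_pointwise (d : R) (X : 'I_n -> 'rV[R]_n -> R) x : 0 < d -> B x ->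
  eta x ^+ 2 * curv (coefA a x) al (D2v u x) (Dv u x) <=
  \sum_i partial i (X i) x
   + bform al (Dv u x) (Dv u x) * bform (coefA a x) (Dv eta x) (Dv eta x)
   + @stab_hess_C R n Lam * eps * (enorm (hess u x) * enorm (grad u x) * eta x ^+ 2)
   + @stab_mixed_C R n Lam * eps * (enorm (grad u x) ^+ 2 * (`|eta x| * enorm (grad eta x)))
   + @stab_grad_C R n lam Lam * eps ^+ 2 * (enorm (grad u x) ^+ 2 * eta x ^+ 2) ->
  F x <= 2 * lam ^- 2 * (\sum_i partial i (X i) x)
    + (- hess_trace_C) * (\sum_i partial i (flux_vector a u eta d i) x)
    + (2 * hess_C) * G x + (2 * d * reg_C) * G1 x.
Proof.
move=> d0 Bx HX.
have e0 := eps_gt0 HS.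
have il0 : 0 <= lam ^- 2 by rewrite invr_ge0 exprn_ge0// ltW.
have e1 : eps <= 1 by apply: le_trans eps_le _; rewrite ge_min lexx.
have Hhess := hess_le lam0 HS Bx.
have H4 : normal_norm u x ^+ 2 <= lam ^- 2 * curv (coefA a x) al (D2v u x) (Dv u x).
  by rewrite ler_pdivlMl ?exprn_gt0//; exact: (normal_norm_le lam0 HS Bx).
have H6 : bform (coefA a x) (Dv eta x) (Dv eta x) <= k ^+ 2 * Lam * enorm (grad eta x) ^+ 2.
  apply: bform_le => [i j|i]; first exact: (coef_a_le lam0 HS).
  by have := enorm_entry (grad eta x) i ord0; rewrite mxE.
have H5 : bform al (Dv u x) (Dv u x) <= k ^+ 2 * Lam * enorm (grad u x) ^+ 2.
  apply: bform_le => [i j|i]; first exact: (coef_a_le lam0 HS _ _ (@eball0 R n)).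
  exact: grad_entry_le.
have := @absorption R (enorm (grad u x)) (enorm (hess u x)) (normal_norm u x) (`|trA a u x|)
  (curv (coefA a x) al (D2v u x) (Dv u x)) (lam ^- 2) eps d (enorm (grad eta x)) (eta x)
  (\sum_i partial i (X i) x) (\sum_i partial i (flux_vector a u eta d i) x)
  (bform al (Dv u x) (Dv u x)) (bform (coefA a x) (Dv eta x) (Dv eta x))
  hess_trace_C hess_normal_C (@flux_normal_C R n Lam) (4 * k + k ^+ 2) (2 * k ^+ 2 * Lam)
  (@stab_hess_C R n Lam) (@stab_mixed_C R n Lam) (@stab_grad_C R n lam Lam) (k ^+ 2 * Lam)
  (enorm_ge0 _) (enorm_ge0 _) (normal_norm_ge0 u x) (normr_ge0 _) il0 (ltW e0) e1 (ltW d0) (enorm_ge0 _).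
have q1 : 0 <= hess_trace_C by rewrite divr_ge0// ltW.
have q2 : 0 <= 4 * k + k ^+ 2 by rewrite addr_ge0 ?mulr_ge0 ?exprn_ge0.
have q3 : 0 <= 2 * k ^+ 2 * Lam by rewrite !mulr_ge0 ?exprn_ge0.
move=> /(_ q1 q2 q3 (bform_ge0 lam0 HS _ (@eball0 R n)) (bform_ge0 lam0 HS _ Bx)).
have H1 : enorm (hess u x) <= hess_trace_C * `|trA a u x| + hess_normal_C * normal_norm u x.
  apply: (le_trans Hhess); rewrite le_eqVlt; apply/orP; left; apply/eqP.
  by rewrite /hess_trace_C /hess_normal_C; ring.
move=> /(_ H1 (flux_estimate lam0 HS f0 Ceta d0 Bx) HX H4 H5 H6).
rewrite -/(zeta x) -/(F x) -/flux_C -/hess_C -/reg_C -/(G x) -/(G1 x).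
have F0 : 0 <= F x by rewrite /F mulr_ge0 ?sqr_ge0// mulr_ge0// enorm_ge0.
have absb : lam ^- 2 * `|@stab_hess_C R n Lam| * eps * F x <= F x / 2.
  have h1 : 0 < lam ^- 2 * `|@stab_hess_C R n Lam| + 1 by rewrite ltr_wpDl// mulr_ge0.
  rewrite mulrC ler_wpM2l//.
  have h2 : eps <= (2 * (lam ^- 2 * `|@stab_hess_C R n Lam| + 1))^-1.
    by apply: le_trans eps_le _; rewrite ge_min lexx orbT.
  apply: (@le_trans _ _ ((lam ^- 2 * `|@stab_hess_C R n Lam| + 1) * eps)).
    by rewrite ler_wpM2r ?(ltW e0)// lerDl.
  apply: (le_trans (ler_wpM2l (ltW h1) h2)).
  move: h1; move: (lam ^- 2 * `|@stab_hess_C R n Lam| + 1) => c h1.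
  by rewrite le_eqVlt; apply/orP; left; apply/eqP; field; rewrite gt_eqF.
move: absb; move: (lam ^- 2 * `|@stab_hess_C R n Lam| * eps * F x) => Z h1 h2.
lra.
Qed.

Let mB := open_measurable_rV oB.

Lemma integral_lin (c1 c2 : R) (g h : 'rV[R]_n -> R) :
  (lebesgue_rV R n).-integrable B (EFin \o g) -> (lebesgue_rV R n).-integrable B (EFin \o h) ->
  (lebesgue_rV R n).-integrable B (EFin \o (fun x => c1 * g x + c2 * h x)) /\
  (\int[lebesgue_rV R n]_(x in B) (c1 * g x + c2 * h x)%:E =
   c1%:E * \int[lebesgue_rV R n]_(x in B) (g x)%:E +
   c2%:E * \int[lebesgue_rV R n]_(x in B) (h x)%:E)%E.
Proof.
move=> ig ih.
have i1 := integrableZl mB c1 ig; have i2 := integrableZl mB c2 ih.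
split; first exact: (integrableD mB i1 i2).
rewrite -(integralZl mB ig) -(integralZl mB ih) -(integralD mB i1 i2).
by apply: eq_integral => x _; rewrite EFinD !EFinM.
Qed.

Lemma integrable_hess : (lebesgue_rV R n).-integrable B (EFin \o F).
Proof.
apply: (cutoff_integrable oB cS SB (@eball_norm R n)) => x Bx.
  apply: ctsM; last by apply: ctsX; exact: (cts_eta Ceta).
  by apply: ctsM; [exact: (cts_hess HS)|exact: (cts_grad HS)].
by move=> xS; rewrite /F (eta0 xS) expr0n mulr0.
Qed.

Lemma integrable_energy : (lebesgue_rV R n).-integrable B (EFin \o G).
Proof.
apply: (cutoff_integrable oB cS SB (@eball_norm R n)) => x Bx.
  by apply: ctsM; [apply: ctsX; exact: (cts_grad HS)|exact: cts_zeta].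
by move=> xS; rewrite /G (zeta_out xS) mulr0.
Qed.

Lemma integrable_grad : (lebesgue_rV R n).-integrable B (EFin \o G1).
Proof.
apply: (cutoff_integrable oB cS SB (@eball_norm R n)) => x Bx.
  by apply: ctsM; [exact: (cts_grad HS)|exact: cts_zeta].
by move=> xS; rewrite /G1 (zeta_out xS) mulr0.
Qed.

Lemma hessian_integral_reg (d : R) : 0 < d ->
  (\int[lebesgue_rV R n]_(x in B) (F x)%:E <=
   (2 * hess_C)%:E * \int[lebesgue_rV R n]_(x in B) (G x)%:E
   + (2 * d * reg_C)%:E * \int[lebesgue_rV R n]_(x in B) (G1 x)%:E)%E.
Proof.
move=> d0.
have [X [CX XS HX]] := stab_vector_exists lam0 HS Ceta eta0.
have [iX zX] := integral_cutoff_div oB cS SB (@eball_norm R n) CX (fun i x _ => XS i x).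
have CZ i : C1on B (flux_vector a u eta d i) := (flux_vectorP HS Ceta d0 i).1.
have ZS i x : B x -> ~ S x -> flux_vector a u eta d i x = 0.
  by move=> _ xS; rewrite /flux_vector (eta0 xS) expr0n mulr0.
have [iZ zZ] := integral_cutoff_div oB cS SB (@eball_norm R n) CZ ZS.
have [i1 e1] := integral_lin (2 * lam ^- 2) (- hess_trace_C) iX iZ.
have [i2 e2] := integral_lin (2 * hess_C) (2 * d * reg_C) integrable_energy integrable_grad.
have [i3 e3] := integral_lin 1 1 i1 i2.
rewrite zX zZ !mule0 adde0 in e1.
rewrite !mul1e in e3.
rewrite -e2 -[leRHS]add0e -[X in (_ <= X + _)%E]e1 -e3.
apply: ge0_le_integral_nomeas => x Bx.
  by rewrite lee_fin /F mulr_ge0 ?sqr_ge0// mulr_ge0// enorm_ge0.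
rewrite lee_fin !mul1r addrA.
exact: (hessian_pointwise d0 Bx (HX x Bx)).
Qed.

(** The regularisation costs [d] times a finite integral, and [d] is arbitrary. *)
Lemma hessian_integral :
  (\int[lebesgue_rV R n]_(x in B) (F x)%:E <=
   (2 * hess_C)%:E * \int[lebesgue_rV R n]_(x in B) (G x)%:E)%E.
Proof.
apply/lee_addgt0Pr => e e0.
have fG1 : (\int[lebesgue_rV R n]_(x in B) (G1 x)%:E \is a fin_num)%E.
  exact: (integrable_fin_num mB integrable_grad).
have G10 : (0 <= \int[lebesgue_rV R n]_(x in B) (G1 x)%:E)%E.
  by apply: integral_ge0 => x _; rewrite lee_fin mulr_ge0 ?enorm_ge0 ?zeta_ge0.
pose J := fine (\int[lebesgue_rV R n]_(x in B) (G1 x)%:E)%E.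
have J0 : 0 <= J by exact: fine_ge0.
have K0 := reg_C_ge0.
have D0 : 0 < 2 * reg_C * J + 1 by apply: ltr_wpDl => //; exact: (mulr_ge0 (mulr_ge0 (ler0n _ 2) K0) J0).
have d0 : 0 < e / (2 * reg_C * J + 1) by rewrite divr_gt0.
apply: (le_trans (hessian_integral_reg d0)); apply: leeD => //.
rewrite -(fineK fG1) -/J -EFinM lee_fin.
have -> : 2 * (e / (2 * reg_C * J + 1)) * reg_C * J =
  e * ((2 * reg_C * J) / (2 * reg_C * J + 1)) by ring.
rewrite ler_piMr ?(ltW e0)//; move: D0; move: (2 * reg_C * J) => z D0.
by rewrite ler_pdivrMr// mul1r lerDl.
Qed.

(** [O1] is where the cutoff is bounded below, [O2] contains the points where it or
    its gradient is not zero. *)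
Lemma hessian_regions (O1 O2 : set 'rV[R]_n) (c0 Kz : R) :
  measurable O1 -> measurable O2 -> O1 `<=` B -> O2 `<=` B ->
  0 < c0 -> 0 <= Kz -> (forall x, O1 x -> c0 <= eta x ^+ 2) ->
  (forall x, B x -> zeta x <= Kz) -> (forall x, B x -> ~ O2 x -> zeta x = 0) ->
  (\int[lebesgue_rV R n]_(x in O1) (enorm (grad u x) * enorm (hess u x))%:E <=
   (c0^-1 * (2 * hess_C * Kz))%:E *
   \int[lebesgue_rV R n]_(x in O2) (enorm (grad u x) ^+ 2)%:E)%E.
Proof.
move=> mO1 mO2 O1B O2B c00 Kz0 Hc HK HO.
have K90 : 0 <= 2 * hess_C.
  have l2 : 0 <= lam ^- 2 by rewrite invr_ge0 exprn_ge0// ltW.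
  rewrite mulr_ge0// /hess_C !addr_ge0 ?sqr_ge0 ?reg_C_ge0//.
  by rewrite mulr_ge0// !addr_ge0 ?sqr_ge0.
have s1 : (\int[lebesgue_rV R n]_(x in O1) (enorm (grad u x) * enorm (hess u x))%:E <=
   \int[lebesgue_rV R n]_(x in B) (c0^-1 * F x)%:E)%E.
  rewrite [leLHS]integral_mkcond [leRHS]integral_mkcond.
  apply: ge0_le_integral_nomeas => x _.
    by apply: erestrict_ge0 => y _; rewrite lee_fin mulr_ge0 ?enorm_ge0.
  rewrite !patchE; case: ifPn => [/set_mem O1x|_].
    rewrite (mem_set (O1B _ O1x)) lee_fin ler_pdivlMl// mulrC /F.
    rewrite [enorm (grad u x) * _]mulrC ler_wpM2l ?mulr_ge0 ?enorm_ge0//.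
    exact: Hc.
  case: ifPn => [_|_]; last exact: lexx.
  rewrite lee_fin mulr_ge0 ?invr_ge0 ?(ltW c00)// /F mulr_ge0 ?sqr_ge0//.
  by rewrite mulr_ge0 ?enorm_ge0.
have s2 : (\int[lebesgue_rV R n]_(x in B) (c0^-1 * F x)%:E =
   c0^-1%:E * \int[lebesgue_rV R n]_(x in B) (F x)%:E)%E.
  by rewrite -(integralZl mB integrable_hess); apply: eq_integral => x _; rewrite EFinM.
have s3 : (\int[lebesgue_rV R n]_(x in B) (G x)%:E <=
   Kz%:E * \int[lebesgue_rV R n]_(x in O2) (enorm (grad u x) ^+ 2)%:E)%E.
  rewrite -ge0_integralZl//.
  - rewrite [leLHS]integral_mkcond [leRHS]integral_mkcond.
    apply: ge0_le_integral_nomeas => x _.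
      by apply: erestrict_ge0 => y _; rewrite lee_fin mulr_ge0 ?sqr_ge0 ?zeta_ge0.
    rewrite !patchE; case: ifPn => [/set_mem Bx|xB].
      case: ifPn => [_|]; last first.
        by rewrite notin_setE => xO2; rewrite /G HO// mulr0.
      by rewrite -EFinM lee_fin /G mulrC ler_wpM2r ?sqr_ge0// HK.
    by case: ifPn => [/set_mem/O2B Bx|_]; [rewrite mem_set in xB|exact: lexx].
  - apply/measurable_EFinP; apply: (measurable_funS mB O2B).
    by apply: (continuous_measurable_rV oB) => x Bx; apply: ctsX; exact: (cts_grad HS).
  - by move=> x _; rewrite lee_fin sqr_ge0.
apply: (le_trans s1); rewrite s2 (EFinM c0^-1) -muleA.
rewrite lee_wpmul2l ?lee_fin ?invr_ge0 ?(ltW c00)//.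
apply: (le_trans hessian_integral); rewrite (EFinM (2 * hess_C)) -muleA.
by rewrite lee_wpmul2l ?lee_fin.
Qed.

End hessian_integral.

(** * Cutoff functions and the theorem *)

Section cutoff_functions.
Context {R : realType}.

(** C^1 but not C^2, which suffices: only first derivatives of a cutoff occur. *)
Definition pos2 (t : R) : R := Num.max 0 t ^+ 2.

Lemma pos2_le0 t : t <= 0 -> pos2 t = 0.
Proof. by move=> t0; rewrite /pos2 max_l// expr0n. Qed.

Lemma pos2_ge (t c : R) : 0 <= c -> c <= t -> c ^+ 2 <= pos2 t.
Proof.
move=> c0 ct; rewrite /pos2 max_r ?(le_trans c0 ct)//.
by rewrite ler_pXn2r ?nnegrE// (le_trans c0).
Qed.

Lemma is_derive_pos2 (t : R) : is_derive t 1 pos2 (2 * Num.max 0 t).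
Proof.
have [t0|t0|<-] := ltgtP 0 t.
- apply: (@near_eq_is_derive _ _ _ (fun s : R => s ^+ 2)).
    near=> s; rewrite /pos2 max_r//; apply: ltW; near: s; exact: lt_nbhsr.
  by apply: is_derive_eq; rewrite /GRing.scale/= mulr1 -mulr2n mulr_natl.
- rewrite mulr0; apply: (@near_eq_is_derive _ _ _ (fun _ : R => 0)).
  by near=> s; rewrite pos2_le0//; apply: ltW; near: s; exact: lt_nbhsl.
- rewrite mulr0.
  have H : (fun h : R => h^-1 *: ((pos2 \o shift 0) (h *: 1) - pos2 0)) @ 0^' --> (0 : R).
    apply/cvgr0Pnorm_le => e e0; near=> h.
    rewrite /= [h *: 1]mulr1 addr0 (pos2_le0 (lexx 0)) subr0 /GRing.scale/=.
    have [h0|h0] := leP h 0; first by rewrite pos2_le0// mulr0 normr0 ltW.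
    rewrite /pos2 max_r ?(ltW h0)// expr2 mulKf ?gt_eqF//.
    by near: h; apply: dnbhs0_le.
  by apply: DeriveDef; [apply/cvg_ex; exists 0|exact: cvg_lim].
Unshelve. all: by end_near. Qed.

Lemma derive1_pos2 : derive1 pos2 = fun t => t + `|t|.
Proof.
apply/funext => t; rewrite derive1E; have [_ ->] := is_derive_pos2 t.
have [t0|t0] := leP 0 t; first by rewrite ger0_norm// mulr_natl.
by rewrite mulr0 ltr0_norm// subrr.
Qed.

Lemma continuous_derive1_pos2 : continuous (derive1 pos2).
Proof.
rewrite derive1_pos2 => t; apply: cvgD; first exact: cvg_id.
exact: norm_continuous.
Qed.

Variable n : nat.

Definition sqn (y : 'rV[R]_n) : R := \sum_i y ord0 i ^+ 2.

Lemma sqnE y : sqn y = enorm y ^+ 2.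
Proof. by rewrite enorm_rV_sq. Qed.

Let U := [set: 'rV[R]_n].
Let oU : open U := openT.

Lemma hasC1_coord j : hasC1 U (fun y => y ord0 j) (fun i _ => (i == j)%:R).
Proof.
have L i (y : 'rV[R]_n) : is_derive y (delta_mx ord0 i) (fun y : 'rV[R]_n => y ord0 j) (i == j)%:R.
  have d : is_derive (0 : R) 1 (fun h : R => h * (i == j)%:R + y ord0 j) (i == j)%:R.
    by apply: is_derive_eq; rewrite /GRing.scale/= !(mulr0, mulr1, addr0, add0r).
  have H h : (h *: delta_mx ord0 i + y : 'rV[R]_n) ord0 j =
     (fun h : R => h * (i == j)%:R + y ord0 j) (h *: 1 + 0).
    by rewrite !mxE eqxx/= [h *: 1]mulr1 addr0 eq_sym.
  have [E D] := @derive_line R _ R^o (fun y : 'rV[R]_n => y ord0 j) (fun h => h * (i == j)%:R + y ord0 j) y 0 _ 1 H.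
  by have [d1 d2] := d; apply: DeriveDef; [exact: (iffRL D d1)|rewrite E].
have P i y : partial i (fun y : 'rV[R]_n => y ord0 j) y = (i == j)%:R by have [] := L i y.
split; last by move=> i y _; exact: P.
apply: (C1onP oU (F' := fun i _ => (i == j)%:R)).
- by move=> x _; exact: coord_continuous.
- by move=> x i _; have [] := L i x.
- by move=> x i _; exact: P.
- by move=> x i _; exact: cts_cst.
Qed.

Lemma C1on_sqn : C1on U sqn.
Proof.
rewrite /sqn; apply: (C1on_sum oU) => j _.
by have [] := hasC1_sqr oU (hasC1_coord j).
Qed.

Lemma C1on_pos2 (g : 'rV[R]_n -> R) : C1on U g -> C1on U (fun y => pos2 (g y)).
Proof.
move=> Cg; apply: (C1on_comp oU) => // x _.
  by have [] := is_derive_pos2 (g x).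
exact: continuous_derive1_pos2.
Qed.

(** Positive exactly in the ball of radius 7/8, as [49 / 64 = (7 / 8) ^+ 2]. *)
Definition ball_cutoff y : R := pos2 (49 / 64 - sqn y).

(** Positive exactly between the radii 1/8 and 7/8. *)
Definition annulus_cutoff y : R := ball_cutoff y * pos2 (sqn y - 1 / 64).

Lemma C1on_ball_cutoff : C1on U ball_cutoff.
Proof.
by apply: C1on_pos2; apply: (C1onD oU); [exact: C1on_cst|apply: (C1onN oU); exact: C1on_sqn].
Qed.

Lemma C1on_annulus_cutoff : C1on U annulus_cutoff.
Proof.
apply: (C1onM oU); first exact: C1on_ball_cutoff.
by apply: C1on_pos2; apply: (C1onD oU); [exact: C1on_sqn|exact: C1on_cst].
Qed.

Lemma ecball_eball : @ecball R n (7 / 8) `<=` eball 1.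
Proof.
move=> x /= x78; apply: le_lt_trans x78 _; lra.
Qed.

Lemma ball_cutoff_out y : ~ ecball (7 / 8) y -> ball_cutoff y = 0.
Proof.
move/negP; rewrite -ltNge => h; apply: pos2_le0; rewrite sqnE.
by move: h; have := enorm_ge0 y; move: (enorm y) => z; nra.
Qed.

Lemma annulus_cutoff_out y : ~ ecball (7 / 8) y -> annulus_cutoff y = 0.
Proof. by move=> h; rewrite /annulus_cutoff ball_cutoff_out// mul0r. Qed.

Lemma annulus_cutoff_in y : ~ (~` eball (1 / 8)) y -> annulus_cutoff y = 0.
Proof.
move=> /contrapT h; rewrite /annulus_cutoff pos2_le0 ?mulr0// sqnE.
by move: h; rewrite /eball/=; have := enorm_ge0 y; move: (enorm y) => z; nra.
Qed.

(** [13 / 64 = (7 / 8) ^+ 2 - (3 / 4) ^+ 2]. *)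
Lemma ball_cutoff_ge y : eball (3 / 4) y -> (13 / 64) ^+ 4 <= ball_cutoff y ^+ 2.
Proof.
move=> h; have c0 : 0 <= (13 / 64 : R) by lra.
have : (13 / 64) ^+ 2 <= ball_cutoff y.
  apply: pos2_ge => //; rewrite sqnE.
  by move: h; rewrite /eball/=; have := enorm_ge0 y; move: (enorm y) => z; nra.
move=> h1; have c2 := sqr_ge0 (13 / 64 : R).
by rewrite (exprM _ 2 2) ler_pXn2r ?nnegrE//; exact: le_trans h1.
Qed.

(** [33 / 64 = (7 / 8) ^+ 2 - (1 / 2) ^+ 2] and [3 / 64 = (1 / 4) ^+ 2 - (1 / 8) ^+ 2]. *)
Lemma annulus_cutoff_ge y : (eball (1 / 2) `\` eball (1 / 4)) y ->
  ((33 / 64) ^+ 2 * (3 / 64) ^+ 2) ^+ 2 <= annulus_cutoff y ^+ 2.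
Proof.
move=> [h1 h2]; move/negP: h2; rewrite -leNgt => h2.
have E0 := enorm_ge0 y.
have q1 : (33 / 64) ^+ 2 <= ball_cutoff y.
  apply: pos2_ge; first by lra.
  by rewrite sqnE; move: h1; rewrite /eball/=; move: E0; move: (enorm y) => z; nra.
have q2 : (3 / 64) ^+ 2 <= pos2 (sqn y - 1 / 64).
  apply: pos2_ge; first by lra.
  by rewrite sqnE; move: h2 E0; move: (enorm y) => z; nra.
have c1 : 0 <= (33 / 64 : R) ^+ 2 by exact: sqr_ge0.
have c2 : 0 <= (3 / 64 : R) ^+ 2 by exact: sqr_ge0.
have q3 : (33 / 64) ^+ 2 * (3 / 64) ^+ 2 <= annulus_cutoff y by exact: ler_pM.
rewrite ler_pXn2r// nnegrE; first exact: mulr_ge0.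
exact: le_trans (mulr_ge0 c1 c2) q3.
Qed.

(** Extended by zero, [zeta] is continuous with compact support.  The bound depends
    on the cutoff only, so it does not spoil the universality of the constants. *)
Lemma zeta_bounded (eta : 'rV[R]_n -> R) : C1on (eball 1) eta ->
  (forall y, ~ ecball (7 / 8) y -> eta y = 0) ->
  exists2 Kz, 0 <= Kz & forall x, eball 1 x -> zeta eta x <= Kz.
Proof.
move=> Ceta eta0.
have cz : continuous ((zeta eta) \_ (eball 1)).
  apply: (cutoff_continuous (@open_eball R n 1) (@closed_ecball R n (7 / 8)) ecball_eball).
    by move=> x Bx; exact: cts_zeta.
  by move=> x _ xS; exact: (zeta_out (@closed_ecball R n (7 / 8)) eta0 xS).
have /compact_bounded[M [Mr HM]] : compact ((zeta eta) \_ (eball 1) @` (@rV_box R n 1)).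
  apply: continuous_compact; last exact: compact_rV_box.
  exact: continuous_subspaceT.
exists (`|M| + 1); first by rewrite addr_ge0.
move=> x Bx.
have bx : rV_box 1 x.
  by apply/rV_boxP => i; apply: le_trans (rV_norm_coord x i) _; exact: eball_norm.
have MM : M < `|M| + 1 by rewrite (le_lt_trans (ler_norm M))// ltrDl.
have := HM _ MM ((zeta eta \_ (eball 1)) x).
rewrite patchE mem_set// => h; apply: (le_trans (ler_norm _)); apply: h.
by exists x => //; rewrite patchE mem_set.
Qed.

End cutoff_functions.

Lemma test_function_C1 (R : realType) n (eta : 'rV[R]_n -> R) :
  test_function (eball 1) eta -> C1on (eball 1) eta.
Proof.
move=> [/(_ 1%N) seta _ _]; apply: C1onW (Ck_C1on (s := [::]) seta _) => //.
Qed.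

Theorem theorem1p2 (R : realType) (n : nat) (lam Lam : R) (n_gt0 : (0 < n)%N)
    (lam_gt0 : 0 < lam) :
  (exists C : R, 0 < C /\
    forall (eps : R) (a : 'rV[R]_n -> 'M[R]_n) (b : 'rV[R]_n -> 'cV[R]_n)
      (f : R -> R) (u : 'rV[R]_n -> R),
    stable_setting lam Lam eps a b f u ->
    forall eta : 'rV[R]_n -> R, test_function (eball 1) eta ->
    (\int[lebesgue_rV R n]_(x in eball 1)
        (curlyA a u x ^+ 2 * eta x ^+ 2)%:E
     <= \int[lebesgue_rV R n]_(x in eball 1)
          (anorm (a 0%R) (grad u x) ^+ 2
           * (anorm (a x) (grad eta x) ^+ 2
              + C * eps * enorm (grad (fun y => eta y ^+ 2) x)
              + C * eps ^+ 2 * eta x ^+ 2))%:E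
        + (C * eps)%:E * \int[lebesgue_rV R n]_(x in eball 1)
            (enorm (hess u x) * enorm (grad u x) * eta x ^+ 2)%:E)%E) /\
  (exists eps0 C : R, 0 < eps0 /\ 0 < C /\
    forall (eps : R) (a : 'rV[R]_n -> 'M[R]_n) (b : 'rV[R]_n -> 'cV[R]_n)
      (f : R -> R) (u : 'rV[R]_n -> R),
    stable_setting lam Lam eps a b f u ->
    (forall t : R, 0 <= f t) -> eps <= eps0 ->
    (\int[lebesgue_rV R n]_(x in eball (3 / 4))
        (enorm (grad u x) * enorm (hess u x))%:E
     <= C%:E * \int[lebesgue_rV R n]_(x in eball 1)
          (enorm (grad u x) ^+ 2)%:E)%E /\
    (\int[lebesgue_rV R n]_(x in eball (1 / 2) `\` eball (1 / 4))
        (enorm (grad u x) * enorm (hess u x))%:E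
     <= C%:E * \int[lebesgue_rV R n]_(x in eball 1 `\` eball (1 / 8))
          (enorm (grad u x) ^+ 2)%:E)%E).
Proof.
split.
  exists (@curv_C R n lam Lam); split; first exact: curv_C_gt0.
  move=> eps a b f u HS eta Heta.
  have Ceta := test_function_C1 Heta.
  have [_ _ suppB] := Heta.
  apply: (curvature_integral lam_gt0 HS (@closed_closure _ [set x | eta x != 0]) suppB Ceta).
  move=> y yS; apply/eqP; apply/negPn/negP => ny; apply: yS.
  exact: subset_closure.
have C1W (g : 'rV[R]_n -> R) : C1on setT g -> C1on (eball 1) g by exact: C1onW.
have Cb := C1W _ (@C1on_ball_cutoff R n).
have Ca := C1W _ (@C1on_annulus_cutoff R n).
have [K1 K10 HK1] := zeta_bounded Cb (@ball_cutoff_out R n).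
have [K2 K20 HK2] := zeta_bounded Ca (@annulus_cutoff_out R n).
pose c1 : R := (13 / 64) ^+ 4; pose c2 : R := ((33 / 64) ^+ 2 * (3 / 64) ^+ 2) ^+ 2.
have c10 : 0 < c1 by rewrite exprn_gt0//; lra.
have c20 : 0 < c2 by rewrite exprn_gt0// mulr_gt0// exprn_gt0//; lra.
pose A1 := c1^-1 * (2 * @hess_C R n lam Lam * K1).
pose A2 := c2^-1 * (2 * @hess_C R n lam Lam * K2).
exists (@hess_eps0 R n lam Lam), (1 + `|A1| + `|A2|); split; first exact: hess_eps0_gt0.
split; first by rewrite ltr_pwDl// ltr_pwDl.
move=> eps a b f u HS f0 eps_le.
have mball r : measurable (@eball R n r) := open_measurable_rV (@open_eball R n r).
have ballS (r : R) : r <= 1 -> @eball R n r `<=` eball 1.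
  by move=> r1 x /= xr; exact: lt_le_trans xr r1.
have cE := @closed_ecball R n (7 / 8).
have intge0 (O : set 'rV[R]_n) : (0 <= \int[lebesgue_rV R n]_(x in O) (enorm (grad u x) ^+ 2)%:E)%E.
  by apply: integral_ge0 => x _; rewrite lee_fin sqr_ge0.
have mono (A C : R) (O : set 'rV[R]_n) : A <= C ->
   (A%:E * \int[lebesgue_rV R n]_(x in O) (enorm (grad u x) ^+ 2)%:E <=
    C%:E * \int[lebesgue_rV R n]_(x in O) (enorm (grad u x) ^+ 2)%:E)%E.
  by move=> AC; rewrite lee_wpmul2r// lee_fin.
split.
  apply: le_trans (mono A1 _ _ _); last first.
    by rewrite (le_trans (ler_norm _))// addrAC [leRHS]addrC lerDl addr_ge0.
  apply: (hessian_regions n_gt0 lam_gt0 HS f0 cE (@ecball_eball R n) Cb (@ball_cutoff_out R n) eps_le) => //.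
  - by apply: ballS; lra.
  - exact: ball_cutoff_ge.
apply: le_trans (mono A2 _ _ _); last first.
  by rewrite (le_trans (ler_norm _))// lerDr addr_ge0.
apply: (hessian_regions n_gt0 lam_gt0 HS f0 cE (@ecball_eball R n) Ca (@annulus_cutoff_out R n) eps_le) => //.
- exact: measurableD.
- exact: measurableD.
- by move=> x [h _]; move: h; apply: ballS; lra.
- exact: annulus_cutoff_ge.
- move=> x Bx xO.
  apply: (@zeta_out R n (~` eball (1 / 8)) (@annulus_cutoff R n)).
  + by apply: open_closedC; exact: open_eball.
  + exact: annulus_cutoff_in.
  + by move=> h; apply: xO.
Qed.
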